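(* Let $G$ be a unimodular, locally compact, second countable, Hausdorff group and let $\mathrm{Del}_*:=\mathrm{Del}_{U,K}$ be the compact space of Delone sets in $G$ with fixed $U$ and $K$. Consider a uniquely ergodic Delone dynamical system $\Omega\in\mathcal{I}_G(\mathrm{Del}_* )$ with invariant measure $\mu$. If $(\Omega_l,\mu_l,G)$, $l\in\mathbb{N}$, are Delone dynamical systems in $\mathcal{I}_G(\mathrm{Del}_* )$ such that $\Omega_l\to\Omega$ in the Chabauty-Fell topology, then, for every self-adjoint random bounded operator $A$, $$\lim_{l\to\infty}\eta^A_{\Omega_l,\mu_l}=\eta^A_{\Omega,\mu}$$ in the weak-$*$ topology of Radon measures on $\mathbb{R}$.
   Context: Chabauty-Fell topology: for a locally compact, second countable, Hausdorff space $Z$, the set $\mathcal{C}(Z)$ of closed subsets of $Z$ carries the topology with basis $\{Y\in\mathcal{C}(Z): C\cap Y=\emptyset,\ O\cap Y\ne\emptyset\ \forall O\in\mathcal{O}\}$, $C\subseteq Z$ compact, $\mathcal{O}$ a finite family of open sets. Fix an open neighborhood $U$ of the identity $e\in G$ and a compact $K\subseteq G$. $\mathrm{Del}_{U,K}$ is the set of non-empty $D\subseteq G$ with $\#(gU\cap D)\le1$ for all $g\in G$ and $D\cdot K=G$; it is a compact subspace of $\mathcal{C}(G)$ with $G$ acting by left translation. $\mathcal{I}_G(\mathrm{Del}_* )$ is the set of non-empty, closed, $G$-invariant subsets of $\mathrm{Del}_*$ with the topology induced from $\mathcal{C}(\mathrm{Del}_* )$. A Delone dynamical system $(\Omega,\mu,G)$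 is such an $\Omega$ with a $G$-invariant Borel probability measure $\mu$ on it; $\Omega$ is uniquely ergodic if it carries exactly one such measure. Let $X=\{(x,D,y): D\in\mathrm{Del}_*,\ x,y\in D\}$, a closed subset of $G\times\mathrm{Del}_*\times G$. A kernel of finite type is a bounded continuous $a:X\to\mathbb{C}$ such that there is a compact $K_a=K_a^{-1}\subseteq G$ with $a(x,D,y)=0$ whenever $x^{-1}y\notin K_a$, and $a(gx,gD,gy)=a(x,D,y)$ for all $g\in G$. These form a $*$-algebra with $a^*(x,D,y)=\overline{a(y,D,x)}$, $(a\star b)(x,D,y)=\sum_{z\in D}a(x,D,z)b(z,D,y)$, and $(\lambda^D(a)u)(x)=\sum_{y\in D}a(x,D,y)u(y)$ defines a $*$-representation on $\ell^2(D)$. Let $\mathfrak{C}$ be the $C^*$-algebra obtained by completion in the norm $\|a\|=\sup_{D\in\mathrm{Del}_*}\|\lambda^D(a)\|$; $\lambda^D$ extends to $\mathfrak{C}$. A random bounded operator is a family $A=(A_D)_{D\in\mathrm{Del}_*}$, $A_D=\lambda^D(a)$, with $a\in\mathfrak{C}$; it is self-adjoint if $a=a^*$. Density of states: fix a non-negative $\rho\in C_c(G)$ with $\int_G\rho\,dm_G=1$ ($m_G$ Haar measure). For self-adjoint $A$, $\eta^A_{\Omega,\mu}$ is the measure on $\mathbb{R}$ with $\eta^A_{\Omega,\mu}(\phi)=\int_\Omega\sum_{x\in D}\rho(x)\langle\delta_x,\phi(A_D)\delta_x\rangle\,d\mu(D)$ for $\phi\in C_c(\mathbb{R})$; it does not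 depend on $\rho$. Weak-$*$ convergence on $\mathbb{R}$ is tested against $\phi\in C_c(\mathbb{R})$. *)

(* Defs.v *)
From HB Require Import structures.
From mathcomp Require Import all_boot all_order all_algebra.
From mathcomp Require Import complex.
From mathcomp Require Import all_classical all_reals all_analysis.
From mathcomp Require Import summability.
From mathcomp Require Import ring.
Import Order.TTheory GRing.Theory Num.Theory.
Import numFieldNormedType.Exports.

Set Implicit Arguments.
Unset Strict Implicit.
Unset Printing Implicit Defensive.

Local Open Scope ring_scope.
Local Open Scope complex_scope.
Local Open Scope classical_set_scope.

HB.instance Definition _ (R : realType) := NormedModule.copy R[i] R[i]^o.

(* The point required by [ptopologicalType] plays no role; it is there because *)
(* [measurableType] extends [pointedType].                                     *)
HB.mixin Record isTopologicalGroup G of PointedTopological G & Group G := {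
  mulg_continuous : continuous (fun p : G * G => (p.1 * p.2)%g) ;
  invg_continuous : continuous (fun x : G => (x^-1)%g)
}.

#[short(type="topGroupType")]
HB.structure Definition TopologicalGroup :=
  {G of isTopologicalGroup G & PointedTopological G & Group G}.

Definition borel (T : ptopologicalType) := g_sigma_algebraType (@open T).

Section FellTopology.
Context {Z : topologicalType}.

Record closed_set := ClosedSet { cset :> set Z ; cset_closed : closed cset }.

HB.instance Definition _ := gen_eqMixin closed_set.
HB.instance Definition _ := gen_choiceMixin closed_set.

Lemma closed_set_inj (A B : closed_set) : cset A = cset B -> A = B.
Proof.
case: A B => [A cA] [B cB] /= AB; case: _ / AB cB => cB.
by rewrite (Prop_irrelevance cA cB).
Qed.

Definition fell_index : set (set Z * set (set Z)) :=
  [set i | [/\ compact i.1, finite_set i.2 & i.2 `<=` open]].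

Definition fell_base (i : set Z * set (set Z)) : set closed_set :=
  [set Y | i.1 `&` Y = set0 /\ forall O, i.2 O -> (O `&` Y) !=set0].

Let fell_cover : \bigcup_(i in fell_index) fell_base i = setT.
Proof.
apply/seteqP; split=> // Y _; exists (set0, set0) => /=.
  by split; [exact: compact0 | exact: finite_set0 | exact: sub0set].
by split=> //=; rewrite set0I.
Qed.

Let fell_join i j Y : fell_index i -> fell_index j ->
  fell_base i Y -> fell_base j Y ->
  exists k, [/\ fell_index k, fell_base k Y &
    fell_base k `<=` fell_base i `&` fell_base j].
Proof.
case: i j => [C1 O1] [C2 O2] [/= c1 f1 o1] [/= c2 f2 o2] [/= d1 m1] [/= d2 m2].
exists (C1 `|` C2, O1 `|` O2); split => /=.
- split=> /=; [exact: compactU | by rewrite finite_setU | by move=> O [/o1|/o2]].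
- by split=> [|O [/m1|/m2]] //=; rewrite setIUl d1 d2 setU0.
- move=> B [/= + m]; rewrite setIUl setU_eq0 => -[e1 e2].
  by split; split=> //= O hO; apply: m; [left | right].
Qed.

HB.instance Definition _ := isBaseTopological.Build closed_set
  fell_cover fell_join.

End FellTopology.
Arguments closed_set Z : clear implicits.

Section Delone.
Context {G : topGroupType}.
Implicit Types (U K : set G) (g : G).

Definition translate g (A : set G) : set G := [set (g * x)%g | x in A].

(* Such sets D are automatically closed, so that considering only elements of  *)
(* [closed_set G] is no restriction.                                           *)
Definition Delone U K : set (closed_set G) :=
  [set D : closed_set G | [/\ D !=set0,
     forall g, is_subset1 (translate g U `&` D) &
     [set (p.1 * p.2)%g | p in D `*` K] = setT]].

Lemma translateE g (A : set G) :
  translate g A = (fun x => (g^-1 * x)%g) @^-1` A.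
Proof.
apply/seteqP; split=> [_ [x Ax <-]|x Ax] /=; first by rewrite mulKg.
by exists (g^-1 * x)%g => //; rewrite mulVKg.
Qed.

Lemma translateM g h (A : set G) :
  translate g (translate h A) = translate (g * h)%g A.
Proof.
by rewrite !translateE; apply/seteqP; split=> x /=; rewrite invgM mulgA.
Qed.

Lemma translate_closed g (A : set G) : closed A -> closed (translate g A).
Proof.
move=> cA; rewrite translateE; apply: closed_comp => // x _.
apply: (@continuous_comp _ _ _ (fun x : G => ((g^-1)%g, x))
  (fun p : G * G => (p.1 * p.2)%g)); last exact: mulg_continuous.
by apply: cvg_pair; [exact: cvg_cst | exact: cvg_id].
Qed.

Definition translate_closed_set g (D : closed_set G) : closed_set G :=
  ClosedSet (@translate_closed g D (@cset_closed _ D)).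

Lemma translate_Delone U K g (D : closed_set G) :
  Delone U K D -> Delone U K (translate_closed_set g D).
Proof.
move=> [[x Dx] Dd DK]; split.
- by exists (g * x)%g; exists x.
- move=> h _ _ [[u Uu <-] [y Dy gy]] [[v Uv <-] [z Dz gz]].
  rewrite -gy -gz; congr (g * _)%g; apply: (Dd (g^-1 * h)%g); split=> //.
    by exists u => //; rewrite -mulgA -gy mulKg.
  by exists v => //; rewrite -mulgA -gz mulKg.
- apply/seteqP; split=> // y _.
  have : [set (p.1 * p.2)%g | p in D `*` K] (g^-1 * y)%g by rewrite DK.
  move=> [[d k] /= [Dd' Kk] dk]; exists ((g * d)%g, k) => /=.
    by split=> //; exists d.
  by rewrite -mulgA dk mulVKg.
Qed.

(* [Delone U K] is coerced to the type of its elements, which carries the      *)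
(* subspace topology of [closed_set G].                                        *)
Definition pts U K (D : Delone U K) : set G := cset (set_val D).

Definition Delone_act U K g (D : Delone U K) : Delone U K :=
  exist (fun E => E \in Delone U K) (translate_closed_set g (set_val D))
    (mem_set (@translate_Delone U K g _ (set_mem (valP D)))).

End Delone.

Section DeloneSystems.
Context {G : topGroupType} (U K : set G).

Definition invariant_sets : set (closed_set (Delone U K)) :=
  [set Om : closed_set (Delone U K) | Om !=set0 /\
     forall g D, cset Om D -> cset Om (Delone_act g D)].

Definition phase (Om : invariant_sets) := set_type (cset (set_val Om)).

HB.instance Definition _ (Om : invariant_sets) :=
  Topological.copy (phase Om) (set_type (cset (set_val Om))).

Lemma phase_nonempty (Om : invariant_sets) : exists _ : phase Om, True.
Proof.
have [[D OmD] _] := set_mem (valP Om).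
by exists (exist (fun E => E \in cset (set_val Om)) D (mem_set OmD)).
Qed.

HB.instance Definition _ (Om : invariant_sets) :=
  isPointed.Build (phase Om) (projT1 (cid (phase_nonempty Om))).

Definition phase_act (Om : invariant_sets) (g : G) (w : phase Om) : phase Om :=
  exist (fun E => E \in cset (set_val Om)) (Delone_act g (set_val w))
    (mem_set ((set_mem (valP Om)).2 g _ (set_mem (valP w)))).

Definition invariant_measure (R : realType) (Om : invariant_sets)
    (mu : probability (borel (phase Om)) R) :=
  forall (g : G) (B : set (borel (phase Om))), measurable B ->
    mu (@phase_act Om g @^-1` B) = mu B.

Definition uniquely_ergodic (R : realType) (Om : invariant_sets) :=
  (exists mu : probability (borel (phase Om)) R, invariant_measure mu) /\
  (forall mu nu : probability (borel (phase Om)) R,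
     invariant_measure mu -> invariant_measure nu ->
     forall B, measurable B -> mu B = nu B).

End DeloneSystems.
Arguments invariant_sets {G} U K.

Section Haar.
Context {R : realType} {G : topGroupType}.

(* On a second countable locally compact Hausdorff space a Borel measure which *)
(* is finite on compact sets is automatically regular.                         *)
Definition left_haar_measure (m : {measure set (borel G) -> \bar R}) :=
  [/\ m setT <> 0%E,
      forall C : set G, compact C -> (m C < +oo)%E &
      forall (g : G) (B : set (borel G)), measurable B ->
        m [set (g * x)%g | x in B] = m B].

Definition right_invariant (m : {measure set (borel G) -> \bar R}) :=
  forall (g : G) (B : set (borel G)), measurable B ->
    m [set (x * g)%g | x in B] = m B.

End Haar.

Definition unimodular (R : realType) (G : topGroupType) :=
  forall m : {measure set (borel G) -> \bar R},
    left_haar_measure m -> right_invariant m.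

Definition Cc (T V : topologicalType) (z : V) (f : T -> V) :=
  continuous f /\ compact (closure [set x | f x <> z]).

Section Ell2.
Context {R : realType} {I : choiceType}.
Local Notation C := R[i].
Local Notation normc := (@Normc.normc R).

Definition ell2_pred : {pred I -> C} :=
  [pred u | `[< (\esum_(i in [set: I]) ((normc (u i) ^+ 2)%:E) < +oo)%E >]].

Let esumZ_le (k : R) (a : I -> \bar R) : 0 <= k -> (forall i, (0 <= a i)%E) ->
  (\esum_(i in [set: I]) (k%:E * a i) <= k%:E * \esum_(i in [set: I]) a i)%E.
Proof.
move=> k0 a0; apply: ge_ereal_sup => _ [X [finX XI] <-].
rewrite -ge0_mule_fsumr// lee_wpmul2l ?lee_fin//.
by apply: ereal_sup_ubound; exists X.
Qed.

Lemma ell2_submod : submod_closed ell2_pred.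
Proof.
split.
  apply/asboolP; rewrite esum1 => [|i _]; first exact: ltry.
  by rewrite Normc.normc0 expr0n.
move=> c u v /asboolP hu /asboolP hv; apply/asboolP.
have sq0 (w : I -> C) i : (0 <= (normc (w i) ^+ 2)%:E)%E.
  by rewrite lee_fin sqr_ge0.
have c0 : 0 <= 2 * normc c ^+ 2 by rewrite mulr_ge0 ?sqr_ge0.
set A := (\esum_(i in _) _)%E in hu; set B := (\esum_(i in _) _)%E in hv.
apply: (@le_lt_trans _ _ ((2 * normc c ^+ 2)%:E * A + 2%:E * B)%E); last first.
  by rewrite lte_add_pinfty ?lte_mul_pinfty ?lee_fin.
apply: (le_trans _ (leeD (esumZ_le c0 (sq0 u)) (esumZ_le (ler0n R 2) (sq0 v)))).
rewrite -esumD; last 2 first.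
  by move=> i _; apply: mule_ge0 => //; rewrite lee_fin.
  by move=> i _; apply: mule_ge0 => //; rewrite lee_fin.
apply: le_esum => i _; rewrite -!EFinM -EFinD lee_fin /=.
pose x := normc c * normc (u i); pose y := normc (v i).
have xy : normc ((c *: u + v) i) <= x + y.
  by rewrite /x -Normc.normcM; exact: le_normcD.
apply: (@le_trans _ _ ((x + y) ^+ 2)).
  have n0 (z : C) : 0 <= normc z by case: z => ? ?; exact: sqrtr_ge0.
  by rewrite ler_sqr ?nnegrE ?n0//; exact: addr_ge0 (mulr_ge0 (n0 _) (n0 _)) (n0 _).
rewrite -subr_ge0 [leRHS](_ : _ = (x - y) ^+ 2) ?sqr_ge0// /x /y; ring.
Qed.

HB.instance Definition _ :=
  GRing.isSubmodClosed.Build C (I -> C) ell2_pred ell2_submod.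

Record ell2 := Ell2 { ell2_val :> I -> C ; ell2_valP : ell2_val \in ell2_pred }.

HB.instance Definition _ := [isSub for ell2_val].
HB.instance Definition _ := [Choice of ell2 by <:].
HB.instance Definition _ := [SubChoice_isSubLmodule of ell2 by <:].

Definition l2norm (u : ell2) : R :=
  Num.sqrt (fine (\esum_(i in [set: I]) (normc (u i) ^+ 2)%:E)).

(* Linear in the second argument; [sum] is the limit of the net of finite      *)
(* partial sums.                                                               *)
Definition l2dot (u v : ell2) : C := sum (fun i => (u i)^* * v i : C).

Definition delta_fun (x : I) : I -> C := fun y => (y == x)%:R.

Lemma delta_ell2 x : delta_fun x \in ell2_pred.
Proof.
apply/asboolP.
have -> : (\esum_(i in [set: I]) (normc (delta_fun x i) ^+ 2)%:E =
    \esum_(i in [set x]) (1%R : R)%:E)%E.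
  rewrite esum_mkcond [RHS]esum_mkcond; apply: eq_esum => i _.
  rewrite /delta_fun in_setT; have [->|ix] := eqVneq i x.
    by rewrite mem_set// Normc.normc1 expr1n.
  by rewrite memNset ?Normc.normc0 ?expr0n// => /eqP; exact/negP.
by rewrite esum_set1 ?lee_fin// ltry.
Qed.

Definition delta x : ell2 := Ell2 (delta_ell2 x).

Definition bounded_operator (T : ell2 -> ell2) :=
  (forall (c : C) u v, T (c *: u + v) = c *: T u + T v) /\
  exists M : R, forall u, l2norm (T u) <= M * l2norm u.

Definition opnorm (T : ell2 -> ell2) : \bar R :=
  ereal_sup [set (l2norm (T u))%:E | u in [set u | l2norm u <= 1]].

Definition spectrum (T : ell2 -> ell2) : set C :=
  [set z | ~ exists S : ell2 -> ell2, [/\ bounded_operator S,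
     forall u, S (T u - z *: u) = u & forall u, T (S u) - z *: S u = u]].

Definition operator_poly (p : {poly C}) (T : ell2 -> ell2) : ell2 -> ell2 :=
  fun u => \sum_(i < size p) p`_i *: iter i T u.

(* Continuous functional calculus of a bounded self-adjoint operator: if the   *)
(* polynomials [p n] converge to [phi] uniformly on the spectrum of [T], which *)
(* is real, then the operators [(p n)(T)] converge in norm to [phi(T)].        *)
Definition is_functional_calculus (phi : R -> C) (T S : ell2 -> ell2) :=
  bounded_operator S /\ exists p : nat -> {poly C},
    (forall e : R, 0 < e -> \forall n \near \oo,
       forall t : R, spectrum T t%:C -> normc ((p n).[t%:C] - phi t) < e) /\
    opnorm (fun u => operator_poly (p n) T u - S u) @[n --> \oo] --> 0%E.

(* There is exactly one such [S] when [T] is bounded and self-adjoint and      *)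
(* [phi] is continuous; [0] is a default value.                                *)
Definition functional_calculus (phi : R -> C) (T : ell2 -> ell2) :
    ell2 -> ell2 :=
  xget (fun=> 0) [set S | is_functional_calculus phi T S].

End Ell2.
Arguments ell2 R I : clear implicits.

Section Kernels.
Context {R : realType} {G : topGroupType} (U K : set G).
Local Notation C := R[i].
Local Notation normc := (@Normc.normc R).

Definition kernel_domain : set (G * Delone U K * G) :=
  [set p | pts p.1.2 p.1.1 /\ pts p.1.2 p.2].

Lemma kernel_domain_flip (p : kernel_domain) :
  ((set_val p).2, (set_val p).1.2, (set_val p).1.1) \in kernel_domain.
Proof. by have [xD yD] := set_mem (valP p); exact/mem_set. Qed.

Definition kernel_flip (p : kernel_domain) : kernel_domain :=
  exist (fun q => q \in kernel_domain) _ (kernel_domain_flip p).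

Lemma kernel_domain_act (g : G) (p : kernel_domain) :
  ((g * (set_val p).1.1)%g, Delone_act g (set_val p).1.2,
   (g * (set_val p).2)%g) \in kernel_domain.
Proof.
have [xD yD] := set_mem (valP p); apply/mem_set; split=> /=.
  by exists (set_val p).1.1.
by exists (set_val p).2.
Qed.

Definition kernel_act (g : G) (p : kernel_domain) : kernel_domain :=
  exist (fun q => q \in kernel_domain) _ (kernel_domain_act g p).

Lemma kernel_domain_pair (D : Delone U K) (x y : pts D) :
  (set_val x, D, set_val y) \in kernel_domain.
Proof. by apply/mem_set; split; apply/set_mem/valP. Qed.

Definition kernel_pair (D : Delone U K) (x y : pts D) : kernel_domain :=
  exist (fun q => q \in kernel_domain) _ (kernel_domain_pair x y).

Definition finite_type (a : kernel_domain -> C) :=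
  [/\ continuous a,
      exists M : R, forall p, normc (a p) <= M,
      exists Ka : set G, [/\ compact Ka, [set x^-1%g | x in Ka] = Ka &
        forall p : kernel_domain,
          ~ Ka ((set_val p).1.1^-1 * (set_val p).2)%g -> a p = 0] &
      forall g p, a (kernel_act g p) = a p].

Definition kernel_adjoint (a : kernel_domain -> C) : kernel_domain -> C :=
  fun p => (a (kernel_flip p))^*.

(* $\lambda^D(a)$; for [a] of finite type the sums are finite and the image of *)
(* a square summable [u] is square summable, so that the default value of      *)
(* [insubd] is not used.                                                       *)
Definition kernel_operator (a : kernel_domain -> C) (D : Delone U K)
    (u : ell2 R (pts D)) : ell2 R (pts D) :=
  insubd 0 (fun x : pts D =>
    \sum_(y \in [set: pts D]) a (kernel_pair x y) * u y : C).

Definition kernel_norm (a : kernel_domain -> C) : \bar R :=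
  ereal_sup [set opnorm (@kernel_operator a D) | D in [set: Delone U K]].

(* Elements of the completion are presented by Cauchy sequences; two of them   *)
(* present the same element when the norm of their difference tends to 0.      *)
Record completion := Completion {
  approx :> nat -> kernel_domain -> C ;
  approx_finite_type : forall n, finite_type (approx n) ;
  approx_cauchy : forall e : R, 0 < e -> exists N, forall m n,
    (N <= m)%N -> (N <= n)%N -> (kernel_norm (approx m - approx n)%R < e%:E)%E
}.

(* $a = a^*$ in the completion. *)
Definition self_adjoint (a : completion) :=
  kernel_norm (a n - kernel_adjoint (a n)) @[n --> \oo] --> 0%E.

(* $T = \lambda^D(a)$ for the continuous extension of $\lambda^D$. *)
Definition represents (a : completion) (D : Delone U K)
    (T : ell2 R (pts D) -> ell2 R (pts D)) :=
  bounded_operator T /\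
  opnorm (fun u => kernel_operator (a n) u - T u) @[n --> \oo] --> 0%E.

Definition self_adjoint_random_operator
    (A : forall D : Delone U K, ell2 R (pts D) -> ell2 R (pts D)) :=
  exists2 a : completion, self_adjoint a & forall D, represents a (A D).

Definition complex_integral d (T : measurableType d)
    (m : {measure set T -> \bar R}) (f : T -> C) : C :=
  (\int[m]_x complex.Re (f x)) +i* (\int[m]_x complex.Im (f x)).

(* [eta] is a locally finite Borel measure, hence Radon, and is determined by  *)
(* its values on compactly supported continuous functions.                     *)
Definition density_of_states (rho : G -> R)
    (A : forall D : Delone U K, ell2 R (pts D) -> ell2 R (pts D))
    (Om : invariant_sets U K) (mu : probability (borel (phase Om)) R)
    (eta : {measure set (measurableTypeR R) -> \bar R}) :=
  (forall B : set R, compact B -> (eta B < +oo)%E) /\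
  forall phi : R -> C, Cc 0 phi ->
    complex_integral eta phi =
    complex_integral mu (fun w : phase Om =>
      let D := set_val w in
      \sum_(x \in [set: pts D]) (rho (set_val x))%:C *
        l2dot (delta x) (functional_calculus phi (A D) (delta x))).

Definition weak_star_cvg
    (eta_ : nat -> {measure set (measurableTypeR R) -> \bar R})
    (eta : {measure set (measurableTypeR R) -> \bar R}) :=
  forall phi : R -> C, Cc 0 phi ->
    complex_integral (eta_ l) phi @[l --> \oo] --> complex_integral eta phi.

End Kernels.

(* Main.v *)
Require Import Defs.
From HB Require Import structures.
From mathcomp Require Import all_boot all_order all_algebra finmap.
From mathcomp Require Import complex.
From mathcomp Require Import all_classical all_reals all_analysis.
From mathcomp Require Import summability ring lra.
Import Order.TTheory GRing.Theory Num.Theory.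
Import numFieldNormedType.Exports.

Set Implicit Arguments.
Unset Strict Implicit.
Unset Printing Implicit Defensive.

Local Open Scope ring_scope.
Local Open Scope complex_scope.
Local Open Scope classical_set_scope.

(** The theorem says that integrals of one function converge. With
    [F(D) = \sum_(x in D) rho(x) <delta_x, phi(A_D) delta_x>], the integrals of
    [phi] against the densities of states are the integrals of [F] against [mu]
    and against the [mu_ l]. The proof has two halves: [F] is continuous on the
    compact Hausdorff space of Delone sets ([density_continuous]), and unique
    ergodicity of the limit system forces the measures [mu_ l] to converge to
    [mu] when tested against continuous functions on that space
    ([system_mean_cvg]).

    Continuity. A Delone set close to [D] has exactly one point near each of the
    finitely many points of [D] in a given compact set, so that sums of
    continuous summands over the points in a compact set vary continuously
    ([local_sum_cvg]). Hence products of kernels of finite type have continuous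
    matrix coefficients, and so have the polynomials in [A_D], since [A_D] is
    approximated by kernel operators uniformly in [D]. Next, [phi] is a uniform
    limit of polynomials on an interval containing all the spectra
    ([weierstrass]), and [p(A_D)] differs from [phi(A_D)] in norm by at most the
    supremum of [|p - phi|] there ([functional_calculus_dist]). This last fact
    comes down to the estimate [|p(T)| <= sup |p|] on the spectrum of a symmetric
    operator [T], proved without spectral measures: if [N] is the norm of
    [p(T)], the polynomial [|p|^2 - N^2] takes [T] to an operator that is not
    bounded below; factoring it over the complex numbers produces a root of it in
    the approximate spectrum of [T], which is real ([symop_poly_norm]).

    Convergence. If the integrals of a continuous function did not converge,
    there would be an ultrafilter on the indices that refines the filter of
    neighbourhoods of infinity and along which they stay away from their alleged
    limit. Limits along this ultrafilter define a positive normalised functional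
    on continuous functions of a Delone set. If [f] vanishes on the limit system,
    the compact set where [|f| >= e] misses that system, and therefore misses the
    approximating ones eventually, by the definition of the Chabauty-Fell
    topology: the functional depends only on the restriction of [f] to the limit
    system ([limit_mean_eq]). By the Tietze extension theorem it is a functional
    on all continuous functions on the limit system, and by the Riesz
    representation theorem it is the integral against a probability measure,
    which inherits invariance. Unique ergodicity identifies this measure with
    [mu], a contradiction. *)

(** * Square summable functions *)

Section ComplexNorm.
Context {R : realType}.
Local Notation C := R[i].
Local Notation normc := (@Normc.normc R).

Lemma normc_ge0 (z : C) : 0 <= normc z.
Proof. by case: z => a b; exact: sqrtr_ge0. Qed.

Lemma normcE (z : C) : `|z| = (normc z)%:C.
Proof. by []. Qed.

Lemma normc_sq (z : C) : normc z ^+ 2 = complex.Re z ^+ 2 + complex.Im z ^+ 2.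
Proof. by case: z => a b /=; rewrite sqr_sqrtr// addr_ge0// sqr_ge0. Qed.

Lemma normc_real (t : R) : normc t%:C = `|t|.
Proof. by rewrite /= expr0n addr0 sqrtr_sqr. Qed.

Lemma normcN (z : C) : normc (- z) = normc z.
Proof. by have := normrN z; rewrite !normcE => -[]. Qed.

Lemma normcB (z w : C) : normc (z - w) = normc (w - z).
Proof. by rewrite -normcN opprB. Qed.

Lemma normc_eq0 (z : C) : (normc z == 0) = (z == 0).
Proof.
by apply/eqP/eqP => [/Normc.eq0_normc//|->]; rewrite Normc.normc0.
Qed.

Lemma normc_conj (z : C) : normc (conjc z) = normc z.
Proof. by case: z => a b /=; rewrite sqrrN. Qed.

Lemma normc_Re (z : C) : `|complex.Re z| <= normc z.
Proof.
rewrite -(ler_sqr (normr_ge0 _) (normc_ge0 _)) normc_sq real_normK ?num_real//.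
by rewrite lerDl sqr_ge0.
Qed.

Lemma normc_Im (z : C) : `|complex.Im z| <= normc z.
Proof.
rewrite -(ler_sqr (normr_ge0 _) (normc_ge0 _)) normc_sq real_normK ?num_real//.
by rewrite lerDr sqr_ge0.
Qed.

Lemma normc_ReIm (z : C) : normc z <= `|complex.Re z| + `|complex.Im z|.
Proof.
have p : 0 <= `|complex.Re z| + `|complex.Im z| by rewrite addr_ge0.
rewrite -(ler_sqr (normc_ge0 _) p) normc_sq sqrrD !real_normK ?num_real//.
by rewrite -addrA lerD2l lerDr mulrn_wge0// mulr_ge0.
Qed.

Lemma normc_sum (J : Type) (s : seq J) (f : J -> C) :
  normc (\sum_(j <- s) f j) <= \sum_(j <- s) normc (f j).
Proof.
elim: s => [|j s IH]; rewrite ?big_nil ?Normc.normc0// !big_cons.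
by apply: le_trans (le_normcD _ _) _; rewrite lerD2l.
Qed.

Lemma ltC_real (z : C) (e : R) : (`|z| < e%:C) = (normc z < e).
Proof. by rewrite normcE ltcR. Qed.

(** The norm of [R[i]] takes its values in [R[i]]; epsilon estimates are simpler
    with the real-valued modulus. *)
Lemma cvgC_normP (T : Type) (F : set_system T) (FF : Filter F) (f : T -> C) (l : C) :
  f @ F --> l <-> forall e : R, 0 < e -> \forall x \near F, normc (l - f x) < e.
Proof.
split=> [/cvgrPdist_lt fl e e0|H].
  have /fl : (0 : C) < e%:C by rewrite ltcR.
  by apply: filterS => x; rewrite ltC_real.
apply/cvgrPdist_lt => e e0.
have ->: e = (complex.Re e)%:C by case: e e0 => a b; rewrite ltcE /= => /andP[/eqP -> _].
have {}e0 : 0 < complex.Re e by case: e e0 => a b; rewrite ltcE /= => /andP[].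
by apply: filterS (H _ e0) => x; rewrite ltC_real.
Qed.

Lemma cvg_Re (T : Type) (F : set_system T) (FF : Filter F) (f : T -> C) (l : C) :
  f @ F --> l -> (fun x => complex.Re (f x)) @ F --> complex.Re l.
Proof.
move=> /cvgC_normP H; apply/cvgrPdist_lt => e /H; apply: filterS => x.
by apply: le_lt_trans; rewrite -raddfB; exact: normc_Re.
Qed.

Lemma cvg_Im (T : Type) (F : set_system T) (FF : Filter F) (f : T -> C) (l : C) :
  f @ F --> l -> (fun x => complex.Im (f x)) @ F --> complex.Im l.
Proof.
move=> /cvgC_normP H; apply/cvgrPdist_lt => e /H; apply: filterS => x.
by apply: le_lt_trans; rewrite -raddfB; exact: normc_Im.
Qed.

Lemma cvg_ReIm (T : Type) (F : set_system T) (FF : Filter F) (f : T -> C) (l : C) :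
  (fun x => complex.Re (f x)) @ F --> complex.Re l ->
  (fun x => complex.Im (f x)) @ F --> complex.Im l -> f @ F --> l.
Proof.
move=> /cvgrPdist_lt Hr /cvgrPdist_lt Hi; apply/cvgC_normP => e e0.
have e2 : 0 < e / 2 by rewrite divr_gt0.
apply: filterS2 (Hr _ e2) (Hi _ e2) => x rx ix.
by apply: le_lt_trans (normc_ReIm _) _; rewrite !raddfB [e]splitr; exact: ltrD.
Qed.

End ComplexNorm.

Local Existing Instance totally_filter.

Section Ell2Space.
Context {R : realType} {I : choiceType}.
Local Notation C := R[i].
Local Notation normc := (@Normc.normc R).
Local Notation ell2 := (ell2 R I).
Implicit Types (u v w : ell2) (A : {fset I}).

Definition l2sq u : R := fine (\esum_(i in [set: I]) (normc (u i) ^+ 2)%:E)%E.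

Lemma l2sqE u : (\esum_(i in [set: I]) (normc (u i) ^+ 2)%:E)%E = (l2sq u)%:E.
Proof.
have /asboolP h := ell2_valP u; rewrite /l2sq fineK// ge0_fin_numE//.
by apply: esum_ge0 => i _; rewrite lee_fin sqr_ge0.
Qed.

Lemma l2sq_ge u A : \sum_(i <- A) normc (u i) ^+ 2 <= l2sq u.
Proof.
rewrite -lee_fin -l2sqE; apply: ereal_sup_ubound => /=.
exists [set` A] => //; rewrite fsbig_finite//= set_fsetK sumEFin//.
Qed.

(** The partial sums increase with the finite set, so that the supremum defining
    [esum] is their limit along the net of finite sets. *)
Lemma l2sq_cvg u :
  (fun A => \sum_(i <- A) normc (u i) ^+ 2) @ totally --> l2sq u.
Proof.
apply/cvgrPdist_lt => e e0.
have : ((l2sq u - e)%:E < \esum_(i in [set: I]) (normc (u i) ^+ 2)%:E)%E.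
  by rewrite l2sqE lte_fin ltrBlDr ltrDl.
move=> /ereal_sup_gt[_ [X [finX _] <-]]; rewrite fsbig_finite//= sumEFin lte_fin.
move=> ltX; exists (fset_set X) => // A /= XA.
rewrite ger0_norm ?subr_ge0 ?l2sq_ge//.
rewrite ltrBlDr -ltrBlDl; apply: lt_le_trans ltX _.
rewrite [leRHS](big_fsetID _ (mem (fset_set X)))/=.
rewrite (_ : [fset x | x in A & x \in fset_set X]%fset = fset_set X); last first.
  apply/fsetP => i; rewrite !inE /=; apply/idP/idP => [/andP[]//|iX].
  by rewrite iX (fsubsetP XA).
by rewrite lerDl sumr_ge0// => i _; exact: sqr_ge0.
Qed.

Lemma ell2D u v i : (u + v) i = u i + v i. Proof. by []. Qed.
Lemma ell2B u v i : (u - v) i = u i - v i. Proof. by []. Qed.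
Lemma ell2Z c u i : (c *: u) i = c * u i. Proof. by []. Qed.
Lemma ell2P u v : (forall i, u i = v i) -> u = v.
Proof. by move=> uv; apply/val_inj/funext. Qed.

Arguments l2sq_cvg : clear implicits.

(** The real part of the inner product, obtained from the norm by polarisation.
    Symmetry of operators and the Cauchy-Schwarz inequality only involve this
    real form. *)
Definition redot u v : R := (l2sq (u + v) - l2sq (u - v)) / 4.

(** The parallelogram identity holds coordinatewise, so that the polarised
    norm is the net limit of the real parts of the partial inner products;
    all its algebraic properties are inherited from these finite sums. *)
Lemma redot_cvg u v :
  (fun A => \sum_(i <- A) complex.Re ((u i)^* * v i)) @ totally --> redot u v.
Proof.
have -> : (fun A => \sum_(i <- A) complex.Re ((u i)^* * v i)) =
    (fun A => (\sum_(i <- A) normc ((u + v : ell2) i) ^+ 2 -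
               \sum_(i <- A) normc ((u - v : ell2) i) ^+ 2) * 4^-1).
  apply/funext => A; rewrite -sumrB big_distrl /=; apply: eq_bigr => i _.
  rewrite -[RHS]/((normc (u i + v i) ^+ 2 - normc (u i - v i) ^+ 2) / 4) !normc_sq.
  by case: (u i) (v i) => a b [c d] /=; lra.
by apply: cvgMl; apply: cvgB; exact: l2sq_cvg.
Qed.

Arguments redot_cvg : clear implicits.

Lemma redot_eq u v (g : {fset I} -> R) (x : R) : g @ totally --> x ->
  (forall A, \sum_(i <- A) complex.Re ((u i)^* * v i) = g A) -> redot u v = x.
Proof.
move=> gx E; apply: (cvg_unique _ (redot_cvg u v)) => //.
by rewrite -(funext E) in gx.
Qed.

Lemma redotC u v : redot u v = redot v u.
Proof.
apply: redot_eq (redot_cvg v u) _ => A.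
by apply: eq_bigr => i _; case: (u i) (v i) => a b [c d] /=; ring.
Qed.

Lemma redotDr u v w : redot u (v + w) = redot u v + redot u w.
Proof.
apply: redot_eq (cvgD (redot_cvg u v) (redot_cvg u w)) _ => A.
rewrite [RHS]/= -[RHS]big_split; apply: eq_bigr => i _.
by rewrite ell2D; case: (u i) (v i) (w i) => a b [c d] [e f] /=; ring.
Qed.

Lemma redotZr u v (c : C) : redot u (c *: v) = redot (conjc c *: u) v.
Proof.
apply: redot_eq (redot_cvg _ v) _ => A.
by apply: eq_bigr => i _; rewrite !ell2Z; case: c (u i) (v i) => a b [c d] [e f] /=; ring.
Qed.

Lemma redotRr u v (t : R) : redot u (t%:C *: v) = t * redot u v.
Proof.
apply: redot_eq (cvgMr (redot_cvg u v)) _ => A.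
rewrite big_distrr; apply: eq_bigr => i _; rewrite !ell2Z.
by case: (u i) (v i) => c d [e f] /=; ring.
Qed.

Lemma redotDl u v w : redot (v + w) u = redot v u + redot w u.
Proof. by rewrite redotC redotDr redotC [redot u w]redotC. Qed.

Lemma redotRl u v (t : R) : redot (t%:C *: v) u = t * redot v u.
Proof. by rewrite redotC redotRr redotC. Qed.

Lemma redotNr u v : redot u (- v) = - redot u v.
Proof.
by rewrite -scaleN1r [X in X *: _](_ : _ = (-1)%:C) ?redotRr ?mulN1r// rmorphN1.
Qed.

Lemma redotNl u v : redot (- v) u = - redot v u.
Proof. by rewrite redotC redotNr redotC. Qed.

Lemma redotBr u v w : redot u (v - w) = redot u v - redot u w.
Proof. by rewrite redotDr redotNr. Qed.

Lemma redotBl u v w : redot (v - w) u = redot v u - redot w u.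
Proof. by rewrite redotDl redotNl. Qed.

Lemma redot0r u : redot u 0 = 0.
Proof. by rewrite -(subrr 0) redotBr subrr. Qed.

Lemma redot_sq u : redot u u = l2sq u.
Proof.
apply: redot_eq (l2sq_cvg u) _ => A.
by apply: eq_bigr => i _; rewrite normc_sq; case: (u i) => a b /=; ring.
Qed.

Lemma l2sq_ge0 u : 0 <= l2sq u.
Proof. by have := l2sq_ge u fset0; rewrite big_nil. Qed.

Lemma l2normE u : l2norm u = Num.sqrt (l2sq u). Proof. by []. Qed.

Lemma l2norm_ge0 u : 0 <= l2norm u. Proof. exact: sqrtr_ge0. Qed.

Lemma l2norm_sq u : l2norm u ^+ 2 = l2sq u.
Proof. by rewrite sqr_sqrtr// l2sq_ge0. Qed.

Lemma l2sqD u v : l2sq (u + v) = l2sq u + redot u v *+ 2 + l2sq v.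
Proof. by rewrite -!redot_sq redotDl !redotDr [redot v u]redotC; ring. Qed.

Lemma l2sqB u v : l2sq (u - v) = l2sq u - redot u v *+ 2 + l2sq v.
Proof. by rewrite -!redot_sq redotBl !redotBr [redot v u]redotC; ring. Qed.

Lemma l2sqR u (t : R) : l2sq (t%:C *: u) = t ^+ 2 * l2sq u.
Proof. by rewrite -!redot_sq redotRl redotRr; ring. Qed.

Lemma redot_CS u v : redot u v <= l2norm u * l2norm v.
Proof.
have H : (redot u v) ^+ 2 <= l2sq u * l2sq v.
  have P t : 0 <= l2sq u + t * redot u v *+ 2 + t ^+ 2 * l2sq v.
    by rewrite -l2sqR -redotRr -l2sqD l2sq_ge0.
  have [v0|v0] := ltP 0 (l2sq v).
    (* The minimum over [t] of the polynomial in [P]. *)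
    have := P (- (redot u v) / l2sq v).
    rewrite -(pmulr_lge0 _ v0); set b := redot u v; set c := l2sq v; set a := l2sq u.
    rewrite [X in 0 <= X -> _](_ : _ = a * c - b ^+ 2); first by rewrite subr_ge0.
    by field; rewrite gt_eqF.
  have {v0}v0 : l2sq v = 0 by apply/eqP; rewrite eq_le v0 l2sq_ge0.
  rewrite v0 mulr0; have [->|b0] := eqVneq (redot u v) 0; first by rewrite expr0n.
  (* If [l2sq v = 0] the polynomial is affine in [t], and equals [-1] at this [t]. *)
  have := P (- (l2sq u + 1) / (2 * redot u v)); rewrite v0 mulr0 addr0.
  rewrite [X in 0 <= X -> _](_ : _ = -1) ?ler0N1//.
  by field.
have [b0|b0] := leP (redot u v) 0.
  by apply: le_trans b0 _; rewrite mulr_ge0 ?l2norm_ge0.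
rewrite -ler_sqr ?nnegrE ?(ltW b0) ?mulr_ge0 ?l2norm_ge0//.
by rewrite [X in _ <= X]exprMn !l2norm_sq.
Qed.

Lemma l2normN u : l2norm (- u) = l2norm u.
Proof. by rewrite !l2normE -!redot_sq redotNl redotNr opprK. Qed.

Lemma redot_CSabs u v : `|redot u v| <= l2norm u * l2norm v.
Proof.
rewrite ler_norml redot_CS andbT lerNl -redotNl.
by apply: le_trans (redot_CS _ _) _; rewrite l2normN.
Qed.

Lemma l2normD u v : l2norm (u + v) <= l2norm u + l2norm v.
Proof.
rewrite -ler_sqr ?nnegrE ?addr_ge0 ?l2norm_ge0//.
rewrite l2norm_sq l2sqD -!l2norm_sq sqrrD lerD2r lerD2l lerMn2r.
by rewrite redot_CS orbT.
Qed.

Lemma l2normB u v : l2norm (u - v) <= l2norm u + l2norm v.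
Proof. by rewrite -[l2norm v]l2normN; exact: l2normD. Qed.

Lemma l2norm_distC u v : l2norm (u - v) = l2norm (v - u).
Proof. by rewrite -l2normN opprB. Qed.

Lemma l2norm0 : l2norm (0 : ell2) = 0.
Proof. by rewrite l2normE -redot_sq redot0r sqrtr0. Qed.

Lemma l2normZ (c : C) u : l2norm (c *: u) = normc c * l2norm u.
Proof.
apply/eqP; rewrite -(eqrXn2 (ltn0Sn 1)) ?mulr_ge0 ?l2norm_ge0 ?normc_ge0//.
rewrite exprMn !l2norm_sq -redot_sq redotZr scalerA.
rewrite [X in X *: _](_ : _ = (normc c ^+ 2)%:C) ?redotRl ?redot_sq//.
by rewrite normc_sq; case: c => a b /=; apply/eqP; rewrite eq_complex/=; apply/andP; split; apply/eqP; ring.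
Qed.

Lemma l2norm_coord u i : normc (u i) <= l2norm u.
Proof.
rewrite -ler_sqr ?nnegrE ?normc_ge0 ?l2norm_ge0// l2norm_sq.
by have := l2sq_ge u [fset i]%fset; rewrite big_seq_fset1.
Qed.

Lemma l2norm_eq0 u : l2norm u = 0 -> u = 0.
Proof.
move=> u0; apply: ell2P => i; apply/eqP; rewrite -normc_eq0 eq_le normc_ge0 andbT.
by rewrite -u0 l2norm_coord.
Qed.

Lemma deltaE (x y : I) : (delta x : ell2) y = (y == x)%:R.
Proof. by []. Qed.

Lemma redot_delta (c : C) x v : redot (c *: delta x) v = complex.Re (conjc c * v x).
Proof.
apply: (cvg_unique _ (redot_cvg _ v)) => //; apply: (cvg_trans _ (cvg_cst _)); last first.
  exact: totally_filter.
apply: near_eq_cvg; exists [fset x]%fset => // A xA.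
have {}xA : x \in A by apply: (fsubsetP xA); rewrite inE.
rewrite (bigD1_seq x) ?fset_uniq// big1 ?[RHS]addr0 => [|i ix].
  by rewrite ell2Z deltaE eqxx mulr1.
by rewrite ell2Z deltaE (negbTE ix) mulr0 rmorph0 mul0r.
Qed.

Lemma l2norm_delta x : l2norm (delta x : ell2) = 1.
Proof.
rewrite l2normE -redot_sq -[X in redot X]scale1r redot_delta deltaE eqxx mulr1.
by rewrite rmorph1 sqrtr1.
Qed.

Lemma l2dot_delta x v : l2dot (delta x) v = v x.
Proof.
apply: (@cvg_lim _ (@norm_hausdorff _ _)); apply: (cvg_trans _ (cvg_cst _)); last first.
  exact: totally_filter.
apply: near_eq_cvg; exists [fset x]%fset => // A /= xA.
have {}xA : x \in A by apply: (fsubsetP xA); rewrite inE.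
rewrite /partial_sum -(big_seq_fsetE _ _ xpredT (fun i => (delta x i)^* * v i : C)).
rewrite (bigD1_seq x) ?fset_uniq// big1 ?[RHS]addr0 => [|i ix].
  by rewrite deltaE eqxx rmorph1 mul1r.
by rewrite deltaE (negbTE ix) rmorph0 mul0r.
Qed.

Definition trunc A u : ell2 := \sum_(i <- A) u i *: delta i.

Lemma ell2_sum (J : Type) (s : seq J) (f : J -> ell2) i :
  (\sum_(j <- s) f j) i = \sum_(j <- s) f j i.
Proof. by elim: s => [|j s IH]; rewrite ?big_nil// !big_cons ell2D IH. Qed.

Lemma truncE A u i : trunc A u i = if i \in A then u i else 0.
Proof.
rewrite ell2_sum; case: ifPn => iA.
  rewrite (bigD1_seq i) ?fset_uniq// big1 ?[LHS]addr0 => [|j ji].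
    by rewrite ell2Z deltaE eqxx mulr1.
  by rewrite ell2Z deltaE eq_sym (negbTE ji) mulr0.
rewrite big_seq big1// => j jA; rewrite ell2Z deltaE; case: eqVneq => [ij|]; last by rewrite mulr0.
by rewrite ij jA in iA.
Qed.

(** The square of the distance is the tail of the series of squares. *)
Lemma trunc_cvg u : (fun A => l2norm (u - trunc A u)) @ totally --> (0 : R).
Proof.
have E A : l2sq (u - trunc A u) = l2sq u - \sum_(i <- A) normc (u i) ^+ 2.
  have b : redot (trunc A u) u = \sum_(i <- A) normc (u i) ^+ 2.
    rewrite /trunc; elim: (enum_fset A) => [|i s IH].
      by rewrite !big_nil redotC redot0r.
    rewrite !big_cons redotDl IH redot_delta normc_sq; congr (_ + _).
    by case: (u i) => a c /=; ring.
  have b2 : redot (trunc A u) (trunc A u) = \sum_(i <- A) normc (u i) ^+ 2.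
    rewrite -b.
    have : {subset enum_fset A <= A} by [].
    rewrite {1 3}/trunc; elim: (enum_fset A) => [|i s IH] sA.
      by rewrite !big_nil ![redot 0 _]redotC !redot0r.
    rewrite !big_cons !redotDl IH ?redot_delta ?truncE ?sA ?mem_head// => j js.
    by apply: sA; rewrite in_cons js orbT.
  by rewrite l2sqB redotC b -[l2sq (trunc _ _)]redot_sq b2; ring.
have h : (fun A => l2sq (u - trunc A u)) @ totally --> (0 : R).
  rewrite (funext E) -[X in _ --> X](subrr (l2sq u)).
  by apply: cvgB; [exact: cvg_cst | exact: l2sq_cvg].
have -> : (0 : R) = Num.sqrt 0 by rewrite sqrtr0.
by apply: continuous_cvg h; exact: sqrt_continuous.
Qed.

(** The combinations of basis vectors are dense by [trunc_cvg]; additivity and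
    boundedness propagate the vanishing from the multiples of basis vectors. The
    functional is only additive over the reals, which is why complex multiples
    appear. *)
Lemma ell2_dense (f : ell2 -> R) (M : R) :
  (forall u v, f (u + v) = f u + f v) -> (forall u, `|f u| <= M * l2norm u) ->
  (forall c i, f (c *: delta i) = 0) -> forall u, f u = 0.
Proof.
move=> fD fM f0 u.
have f00 : f 0 = 0 by have := fD 0 0; rewrite addr0; lra.
have ft A : f (trunc A u) = 0.
  rewrite /trunc; elim: (enum_fset A) => [|i s IH]; first by rewrite big_nil.
  by rewrite big_cons fD f0 IH addr0.
apply/eqP; rewrite -normr_le0.
have : (fun A => M * l2norm (u - trunc A u)) @ totally --> M * 0.
  by apply: cvgMr; exact: trunc_cvg.
rewrite mulr0 => h; apply: (cvgr_to_ge h).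
near=> A; rewrite -[X in f X](subrK (trunc A u)) fD ft addr0; exact: fM.
Unshelve. all: by end_near. Qed.

Lemma ell2_of_bound (z : I -> C) (c : R) : 0 <= c ->
  (forall A, \sum_(i <- A) normc (z i) ^+ 2 <= c ^+ 2) ->
  exists2 w : ell2, forall i, w i = z i & l2norm w <= c.
Proof.
move=> c0 zc.
have ec : (\esum_(i in [set: I]) (normc (z i) ^+ 2)%:E <= (c ^+ 2)%:E)%E.
  apply: ge_ereal_sup => _ [X [finX _] <-]; rewrite fsbig_finite//= sumEFin lee_fin.
  exact: zc.
have zP : z \in @ell2_pred R I.
  by apply/asboolP; apply: le_lt_trans ec _; exact: ltry.
exists (Ell2 zP) => //; rewrite -ler_sqr ?nnegrE ?l2norm_ge0// l2norm_sq.
by rewrite -lee_fin -l2sqE.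
Qed.

Lemma l2sq_ge_seq u (s : seq I) : uniq s -> \sum_(i <- s) normc (u i) ^+ 2 <= l2sq u.
Proof.
move=> us; apply: le_trans (l2sq_ge u [fset i in s]%fset).
rewrite le_eqVlt; apply/orP; left; apply/eqP; apply: perm_big.
by apply: uniq_perm => // i; rewrite in_fset.
Qed.

(** Fatou's lemma: each finite partial sum of squares passes to the limit, and
    the bound on all of them gives square summability of the limit. *)
Lemma ell2_fatou (T : Type) (F : set_system T) (FF : ProperFilter F)
    (w : T -> ell2) (z : I -> C) (c : R) : 0 <= c ->
  (forall i, (fun t => w t i) @ F --> z i) ->
  (\forall t \near F, l2norm (w t) <= c) ->
  exists2 w' : ell2, forall i, w' i = z i & l2norm w' <= c.
Proof.
move=> c0 wz wc.
apply: ell2_of_bound => // A.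
have h : (fun t => \sum_(i <- A) normc (w t i) ^+ 2) @ F -->
    \sum_(i <- A) normc (z i) ^+ 2.
  elim: (enum_fset A) => [|i s IH].
    by under eq_fun do rewrite big_nil; rewrite big_nil; exact: cvg_cst.
  under eq_fun do rewrite big_cons; rewrite big_cons; apply: cvgD => //.
  rewrite normc_sq; under eq_fun do rewrite normc_sq !expr2.
  by apply: cvgD; apply: cvgM; do ?exact: cvg_Re; exact: cvg_Im.
apply: (cvgr_to_le h); apply: filterS wc => t wt.
apply: (le_trans (l2sq_ge _ _)); rewrite -l2norm_sq ler_sqr ?nnegrE ?l2norm_ge0//.
Qed.

End Ell2Space.

(** * Functional calculus of bounded symmetric operators *)

Section Operators.
Context {R : realType} {I : choiceType}.
Local Notation C := R[i].
Local Notation normc := (@Normc.normc R).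
Local Notation ell2 := (ell2 R I).
Implicit Types (u v w : ell2) (T S : ell2 -> ell2) (p q : {poly C}).

Definition linop T := forall (c : C) u v, T (c *: u + v) = c *: T u + T v.

Lemma linopD T : linop T -> forall u v, T (u + v) = T u + T v.
Proof. by move=> L u v; rewrite -[u]scale1r L !scale1r. Qed.

Lemma linop0 T : linop T -> T 0 = 0.
Proof. by move=> L; have := L (-1) 0 0; rewrite scaler0 addr0 scaleN1r addNr. Qed.

Lemma linopZ T : linop T -> forall c u, T (c *: u) = c *: T u.
Proof. by move=> L c u; rewrite -[c *: u]addr0 L linop0// addr0. Qed.

Lemma linopB T : linop T -> forall u v, T (u - v) = T u - T v.
Proof. by move=> L u v; rewrite linopD// -scaleN1r linopZ// scaleN1r. Qed.

Lemma linop_scale S (a : C) : linop S -> linop (fun u => a *: S u).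
Proof. by move=> LS c u v; rewrite LS scalerDr !scalerA mulrC. Qed.

Lemma linop_sub S T : linop S -> linop T -> linop (fun u => S u - T u).
Proof. by move=> LS LT c u v; rewrite LT LS scalerBr opprD addrACA. Qed.

Lemma linop_iter T n : linop T -> linop (iter n T).
Proof. by move=> L; elim: n => [|n IH] c u v //; rewrite !iterS IH L. Qed.

Lemma l2normR (t : R) u : 0 <= t -> l2norm (t%:C *: u) = t * l2norm u.
Proof. by move=> t0; rewrite l2normZ normc_real ger0_norm. Qed.

Lemma opnorm_leP T (c : R) : linop T -> 0 <= c ->
  (opnorm T <= c%:E)%E <-> forall u, l2norm (T u) <= c * l2norm u.
Proof.
move=> L c0; split=> [H u|H]; last first.
  apply: ge_ereal_sup => _ [u /= u1 <-]; rewrite lee_fin; apply: le_trans (H u) _.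
  by rewrite ler_piMr.
have [u0|u0] := eqVneq (l2norm u) 0.
  by rewrite (l2norm_eq0 u0) linop0// l2norm0 mulr0.
have {}u0 : 0 < l2norm u by rewrite lt_def u0 l2norm_ge0.
rewrite -[X in l2norm (T X)](_ : (l2norm u)%:C *: ((l2norm u)^-1%:C *: u) = u); last first.
  by rewrite scalerA -rmorphM/= divff ?gt_eqF// scale1r.
rewrite linopZ// l2normR ?(ltW u0)// mulrC ler_pM2r//.
rewrite -lee_fin; apply: le_trans H; apply: ereal_sup_ubound => /=.
exists ((l2norm u)^-1%:C *: u) => //.
by rewrite l2normR ?invr_ge0 ?(ltW u0)// mulVf ?gt_eqF.
Qed.

Lemma opnorm_ge0 T : linop T -> (0 <= opnorm T)%E.
Proof.
move=> L; apply: ereal_sup_ubound; exists 0 => /=; first by rewrite l2norm0.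
by rewrite linop0// l2norm0.
Qed.

(** The extended real-valued operator norm is replaced by inequalities between
    norms of vectors, in which the later estimates are carried out. *)
Lemma opnorm_cvg0P (T_ : nat -> ell2 -> ell2) : (forall n, linop (T_ n)) ->
  (opnorm (T_ n) @[n --> \oo] --> 0%E) <->
  (forall e : R, 0 < e -> \forall n \near \oo, forall u, l2norm (T_ n u) <= e * l2norm u).
Proof.
move=> L; split=> [H e e0|H].
  have nb : nbhs (0%E : \bar R) [set x | (x < e%:E)%E].
    by apply: open_nbhs_nbhs; split; [exact: open_ereal_lt_ereal | rewrite /= lte_fin].
  have : \forall n \near \oo, (opnorm (T_ n) < e%:E)%E by exact: H nb.
  apply: filterS => n /= /ltW h.
  by apply/opnorm_leP => //; exact: ltW.
apply/fine_cvgP; split.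
  apply: filterS (H 1 ltr01) => n Hn; rewrite ge0_fin_numE ?opnorm_ge0//.
  by apply: (@le_lt_trans _ _ 1%:E); [apply/opnorm_leP | rewrite ltry].
apply/cvgrPdist_le => e e0; apply: filterS (H _ e0) => n Hn /=.
have h : (opnorm (T_ n) <= e%:E)%E by apply/opnorm_leP => //; exact: ltW.
rewrite sub0r normrN ger0_norm ?fine_ge0 ?opnorm_ge0//.
by rewrite -lee_fin fineK// ge0_fin_numE ?opnorm_ge0// (le_lt_trans h)// ltry.
Qed.

Lemma operator_polyE n p T u : (size p <= n)%N ->
  operator_poly p T u = \sum_(i < n) p`_i *: iter i T u.
Proof.
move=> pn; rewrite /operator_poly (big_ord_widen n (fun i => p`_i *: iter i T u) pn).
rewrite big_mkcond; apply: eq_bigr => i _; case: ltnP => // h.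
by rewrite nth_default// scale0r.
Qed.

Lemma operator_polyD p q T u :
  operator_poly (p + q) T u = operator_poly p T u + operator_poly q T u.
Proof.
pose n := maxn (size p) (size q).
rewrite !(@operator_polyE n) ?leq_maxl ?leq_maxr ?(leq_trans (size_polyD _ _))//.
by rewrite -big_split; apply: eq_bigr => i _; rewrite coefD scalerDl.
Qed.

Lemma operator_polyZ c p T u :
  operator_poly (c *: p) T u = c *: operator_poly p T u.
Proof.
rewrite !(@operator_polyE (size p)) ?size_scale_leq// scaler_sumr.
by apply: eq_bigr => i _; rewrite coefZ scalerA.
Qed.

Lemma operator_polyB p q T u :
  operator_poly (p - q) T u = operator_poly p T u - operator_poly q T u.
Proof. by rewrite operator_polyD -scaleN1r operator_polyZ scaleN1r. Qed.

Lemma operator_polyC c T u : operator_poly c%:P T u = c *: u.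
Proof.
by rewrite (@operator_polyE 1) ?size_polyC_leq1// big_ord1 coefC.
Qed.

Lemma operator_polyMX p T u : operator_poly (p * 'X) T u = operator_poly p T (T u).
Proof.
rewrite (@operator_polyE (size p).+1); last first.
  by have [->|p0] := eqVneq p 0; rewrite ?mul0r ?size_poly0// size_mulX.
rewrite big_ord_recl coefMX scale0r add0r /operator_poly.
by apply: eq_bigr => i _; rewrite coefMX -iterSr.
Qed.

Lemma linop_poly p T : linop T -> linop (operator_poly p T).
Proof.
move=> L c u v; rewrite /operator_poly scaler_sumr -big_split.
apply: eq_bigr => i _; rewrite (linop_iter i L) scalerDr !scalerA; congr (_ + _).
by rewrite mulrC.
Qed.

Lemma operator_poly_comm p T u : linop T ->
  operator_poly p T (T u) = T (operator_poly p T u).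
Proof.
move=> L; elim/poly_ind: p u => [|p c IH] u.
  by rewrite -polyC0 !operator_polyC !scale0r linop0.
by rewrite !operator_polyD !operator_polyMX !operator_polyC IH (linopD L) (linopZ L).
Qed.

Lemma operator_polyM p q T u : linop T ->
  operator_poly (p * q) T u = operator_poly p T (operator_poly q T u).
Proof.
move=> L; elim/poly_ind: p u => [|p c IH] u.
  by rewrite mul0r -polyC0 !operator_polyC !scale0r.
rewrite mulrDl mul_polyC -mulrA [_ * q]mulrC mulrA !operator_polyD !operator_polyMX.
by rewrite IH operator_poly_comm// operator_polyC operator_polyZ.
Qed.

Lemma operator_polyX T u : operator_poly 'X T u = T u.
Proof. by rewrite -['X]mul1r operator_polyMX operator_polyC scale1r. Qed.

Lemma operator_polyXsubC z T u : operator_poly ('X - z%:P) T u = T u - z *: u.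
Proof. by rewrite operator_polyB operator_polyX operator_polyC. Qed.

Definition bounded_below T := exists2 m : R, 0 < m &
  forall u, m * l2norm u <= l2norm (T u).

(** Over the complex numbers [q] is a product of linear factors, and a product of
    operators that are bounded below is bounded below. *)
Lemma poly_bounded_below q T : linop T -> q != 0 ->
  (forall z, root q z -> bounded_below (fun u => T u - z *: u)) ->
  bounded_below (operator_poly q T).
Proof.
move=> L q0 H; have [r qE] := closed_field_poly_normal q.
have {}H z : z \in r -> bounded_below (fun u => T u - z *: u).
  by move=> zr; apply: H; rewrite qE rootZ ?lead_coef_eq0// root_prod_XsubC.
have [m m0 Hm] : bounded_below (operator_poly (\prod_(z <- r) ('X - z%:P)) T).
  elim: r H {qE} => [|z r IH] H.
    by exists 1 => // u; rewrite big_nil operator_polyC scale1r mul1r.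
  have [|m m0 Hm] := IH; first by move=> y yr; apply: H; rewrite in_cons yr orbT.
  have [k k0 Hk] := H z (mem_head _ _).
  exists (k * m); first exact: mulr_gt0.
  move=> u; rewrite big_cons operator_polyM// operator_polyXsubC.
  by apply: le_trans (Hk _); rewrite -mulrA ler_pM2l.
exists (normc (lead_coef q) * m).
  by rewrite mulr_gt0// lt_def normc_ge0 normc_eq0 lead_coef_eq0 q0.
by move=> u; rewrite {2}qE operator_polyZ l2normZ -mulrA ler_wpM2l ?normc_ge0.
Qed.

Definition symop T := forall u v, redot (T u) v = redot u (T v).

Lemma operator_poly_adj p T u v : linop T -> symop T ->
  redot (operator_poly p T u) v = redot u (operator_poly (map_poly (@conjc R) p) T v).
Proof.
move=> L sT; elim/poly_ind: p u => [|p c IH] u.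
  by rewrite rmorph0 -polyC0 !operator_polyC !scale0r redotC !redot0r.
rewrite rmorphD rmorphM /= map_polyX map_polyC/= !operator_polyD !operator_polyMX.
rewrite !operator_polyC redotDl redotDr IH sT operator_poly_comm//; congr (_ + _).
by rewrite redotZr conjcK.
Qed.

(** For [z = a + i b] the cross term between [T u - a u] and [i b u] vanishes, so
    that the square of the norm of [T u - z u] is at least [b^2] times that of
    [u]. *)
Lemma symop_nonreal T (z : C) : linop T -> symop T -> complex.Im z != 0 ->
  bounded_below (fun u => T u - z *: u).
Proof.
move=> L sT z0; exists `|complex.Im z|; first by rewrite normr_gt0.
move=> u; rewrite -ler_sqr ?nnegrE ?mulr_ge0 ?l2norm_ge0// exprMn !l2norm_sq.
rewrite real_normK ?num_real//.
case: z z0 => a b /= _; set z := a +i* b.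
pose c : C := 0 +i* b.
have zE : z = a%:C + c by apply/eqP; rewrite eq_complex /= addr0 add0r !eqxx.
have cJ : conjc c = - c by apply/eqP; rewrite eq_complex /= oppr0 !eqxx.
have uc : redot u (c *: u) = 0.
  have : redot u (c *: u) = - redot u (c *: u) by rewrite {1}redotZr cJ scaleNr redotNl redotC.
  by lra.
have Tc : redot (T u) (c *: u) = 0.
  have : redot (T u) (c *: u) = - redot (T u) (c *: u).
    by rewrite [LHS]sT (linopZ L) [LHS]redotZr cJ scaleNr redotNl [in RHS]redotC.
  by lra.
rewrite zE scalerDl opprD addrA l2sqB redotBl redotRl uc Tc mulr0 subr0 mul0rn subr0.
rewrite -[l2sq (c *: u)]l2norm_sq l2normZ exprMn l2norm_sq normc_sq /=.
by rewrite expr0n add0r lerDr l2sq_ge0.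
Qed.

Lemma symop_real_root q T : linop T -> symop T -> q != 0 ->
  ~ bounded_below (operator_poly q T) ->
  exists2 t : R, root q t%:C & ~ bounded_below (fun u => T u - t%:C *: u).
Proof.
move=> L sT q0; apply: contra_notP => H; apply: poly_bounded_below => // z qz.
apply: contrapT => nb; apply: H; exists (complex.Re z).
  suff : z = (complex.Re z)%:C by move=> <-.
  apply/eqP; rewrite eq_complex eqxx /=; apply/negP => /negP z0.
  by apply: nb; exact: symop_nonreal.
suff <- : z = (complex.Re z)%:C by [].
apply/eqP; rewrite eq_complex eqxx /=; apply/negP => /negP z0.
by apply: nb; exact: symop_nonreal.
Qed.

Lemma poly_bounded p T (M : R) : linop T -> (forall u, l2norm (T u) <= M * l2norm u) ->
  exists2 c, 0 <= c & forall u, l2norm (operator_poly p T u) <= c * l2norm u.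
Proof.
move=> L HM; elim/poly_ind: p => [|p c [d d0 IH]].
  by exists 0 => // u; rewrite -polyC0 operator_polyC scale0r l2norm0 mul0r.
exists (d * `|M| + normc c); first by rewrite addr_ge0 ?mulr_ge0 ?normc_ge0.
move=> u; rewrite operator_polyD operator_polyMX operator_polyC mulrDl.
apply: le_trans (l2normD _ _) _; rewrite l2normZ lerD2r; apply: le_trans (IH _) _.
rewrite -mulrA ler_wpM2l//; apply: le_trans (HM _) _.
by rewrite ler_wpM2r ?l2norm_ge0// ler_norm.
Qed.

Lemma best_bound S (c : R) : linop S -> (forall u, l2norm (S u) <= c * l2norm u) ->
  exists N : R, [/\ 0 <= N, forall u, l2norm (S u) <= N * l2norm u &
    forall N', 0 <= N' -> (forall u, l2norm (S u) <= N' * l2norm u) -> N <= N'].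
Proof.
move=> L Hc.
have b : (opnorm S <= `|c|%:E)%E.
  apply/opnorm_leP => // u; apply: le_trans (Hc u) _.
  by rewrite ler_wpM2r ?l2norm_ge0// ler_norm.
have f : opnorm S \is a fin_num.
  by rewrite ge0_fin_numE ?opnorm_ge0// (le_lt_trans b)// ltry.
exists (fine (opnorm S)); split; first by rewrite fine_ge0// opnorm_ge0.
  by apply/opnorm_leP; rewrite ?fine_ge0 ?opnorm_ge0// fineK.
by move=> N' N0 HN; rewrite -lee_fin fineK//; apply/opnorm_leP.
Qed.

(** Vectors [u] on which [B = p(T)] almost attains its norm [N] satisfy
    [B^* B u ~ N^2 u]: otherwise [B] would admit a bound smaller than [N]. *)
Lemma norm_not_bounded_below p T (N : R) : linop T -> symop T ->
  (exists u, u != 0) -> 0 <= N ->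
  (forall u, l2norm (operator_poly p T u) <= N * l2norm u) ->
  (forall N', 0 <= N' -> (forall u, l2norm (operator_poly p T u) <= N' * l2norm u) -> N <= N') ->
  ~ bounded_below (operator_poly (p * map_poly (@conjc R) p - ((N ^+ 2)%:C)%:P) T).
Proof.
move=> L sT [u0 u00] N0 HN Nmin [m m0 Hm].
set p' := map_poly _ p in Hm *.
have u0gt : 0 < l2norm u0.
  rewrite lt_def l2norm_ge0 andbT; apply: contra_neq u00; exact: l2norm_eq0.
have adj u v : redot (operator_poly p T u) v = redot u (operator_poly p' T v).
  exact: operator_poly_adj.
have HN' u : l2norm (operator_poly p' T u) <= N * l2norm u.
  have [->|z] := eqVneq (l2norm (operator_poly p' T u)) 0.
    by rewrite mulr_ge0 ?l2norm_ge0.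
  have zgt : 0 < l2norm (operator_poly p' T u) by rewrite lt_def z l2norm_ge0.
  rewrite -(ler_pM2l zgt) -expr2 l2norm_sq -redot_sq -adj.
  apply: le_trans (redot_CS _ _) _; rewrite mulrA ler_wpM2r ?l2norm_ge0//.
  by rewrite mulrC [leRHS]mulrC mulrC [leRHS]mulrC; apply: le_trans (HN _) _; rewrite mulrC.
(* Expand the square of the norm of [B^* B u - N^2 u], and
   bound the norm of [B^* B u] by [N] times that of [B u]. *)
have key u : m ^+ 2 * l2sq u <= N ^+ 2 * (N ^+ 2 * l2sq u - l2sq (operator_poly p T u)).
  have := Hm u; rewrite -ler_sqr ?nnegrE ?mulr_ge0 ?l2norm_ge0 ?(ltW m0)//.
  rewrite exprMn !l2norm_sq; move=> h; apply: le_trans h _.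
  rewrite operator_polyB operator_polyC mulrC operator_polyM// l2sqB l2sqR redotRr.
  rewrite [redot (operator_poly p' _ _) _]redotC -adj redot_sq.
  have h : l2sq (operator_poly p' T (operator_poly p T u)) <=
      N ^+ 2 * l2sq (operator_poly p T u).
    by rewrite -!l2norm_sq -exprMn ler_sqr ?nnegrE ?mulr_ge0 ?l2norm_ge0.
  rewrite -subr_ge0; set x := l2sq (operator_poly p' _ _) in h *.
  set y := l2sq (operator_poly p _ _) in h *.
  rewrite [X in 0 <= X](_ : _ = N ^+ 2 * y - x) ?subr_ge0//; ring.
have [N00|Npos] := eqVneq N 0.
  have := key u0; rewrite N00 expr0n mul0r leNgt => /negP; apply.
  by rewrite mulr_gt0 ?exprn_gt0// -l2norm_sq exprn_gt0.
have {}Npos : 0 < N by rewrite lt_def Npos.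
have Nsq : 0 < N ^+ 2 by rewrite exprn_gt0.
(* By [key] the smaller number [Num.sqrt (N ^+ 2 - d)] is also a bound for [B]. *)
pose d := m ^+ 2 / N ^+ 2.
have d0 : 0 < d by rewrite divr_gt0 ?exprn_gt0.
have key2 u : l2sq (operator_poly p T u) <= (N ^+ 2 - d) * l2sq u.
  rewrite -(ler_pM2l Nsq) /d.
  have := key u; set x := l2sq u; set y := l2sq (operator_poly p T u).
  have -> : N ^+ 2 * ((N ^+ 2 - m ^+ 2 / N ^+ 2) * x) = N ^+ 2 * (N ^+ 2 * x) - m ^+ 2 * x.
    by field; rewrite gt_eqF.
  by rewrite mulrBr; lra.
have Nd : 0 <= N ^+ 2 - d.
  have u0sq : 0 < l2sq u0 by rewrite -l2norm_sq exprn_gt0.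
  by rewrite -(pmulr_lge0 _ u0sq); apply: le_trans (key2 u0); exact: l2sq_ge0.
have := Nmin _ (sqrtr_ge0 (N ^+ 2 - d)) _.
suff H : N <= Num.sqrt (N ^+ 2 - d) -> False.
  move=> h; apply: H; apply: h => u.
  rewrite -ler_sqr ?nnegrE ?mulr_ge0 ?sqrtr_ge0 ?l2norm_ge0//.
  by rewrite exprMn !l2norm_sq sqr_sqrtr.
rewrite -ler_sqr ?nnegrE ?sqrtr_ge0// sqr_sqrtr//; lra.
Qed.

Lemma horner_conj_sq p (t : R) :
  (p * map_poly (@conjc R) p).[t%:C] = ((normc p.[t%:C]) ^+ 2)%:C.
Proof.
have tJ : t%:C = conjc t%:C by apply/eqP; rewrite eq_complex /= oppr0 !eqxx.
rewrite hornerM {2}tJ horner_map /= normc_sq.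
by case: (p.[_]) => a b; apply/eqP; rewrite eq_complex /=; apply/andP; split; apply/eqP; ring.
Qed.

(** The case [p = 'X] of [norm_not_bounded_below] combined with
    [symop_real_root]. *)
Lemma approximate_spectrum_nonempty T (M : R) : linop T -> symop T ->
  (forall u, l2norm (T u) <= M * l2norm u) -> (exists u : ell2, u != 0) ->
  exists t : R, ~ bounded_below (fun u => T u - t%:C *: u).
Proof.
move=> L sT HM n0.
have [N [N0 HN Nmin]] := best_bound L HM.
have Tx : operator_poly 'X T = T by apply/funext => u; rewrite operator_polyX.
have [||t _ ?] := @symop_real_root ('X * map_poly (@conjc R) 'X - ((N ^+ 2)%:C)%:P) T L sT.
- apply/eqP => /(congr1 (fun p : {poly C} => p`_2)); rewrite map_polyX coefB coef0 -expr2.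
  by rewrite coefXn coefC eqxx subr0 => /eqP; rewrite oner_eq0.
- by apply: norm_not_bounded_below => //; rewrite Tx.
by exists t.
Qed.

(** The spectral estimate behind the continuous functional calculus: if [N] is
    the norm of [p(T)], then [|p|^2 - N^2] vanishes somewhere on the real
    approximate spectrum of [T]. *)
Lemma symop_poly_norm p T (M c : R) : linop T -> symop T ->
  (forall u, l2norm (T u) <= M * l2norm u) -> 0 <= c ->
  (forall t : R, ~ bounded_below (fun u => T u - t%:C *: u) -> normc p.[t%:C] <= c) ->
  forall u, l2norm (operator_poly p T u) <= c * l2norm u.
Proof.
move=> L sT HM c0 Hp.
have [[u0 u00]|n0] := pselect (exists u : ell2, u != 0); last first.
  move=> u; have -> : u = 0 by apply/eqP/negP => /negP u0; apply: n0; exists u.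
  by rewrite linop0 ?l2norm0 ?mulr0//; exact: linop_poly.
have n0 : exists u : ell2, u != 0 by exists u0.
have [d d0 Hd] := poly_bounded p L HM.
have [N [N0 HN Nmin]] := best_bound (linop_poly p L) Hd.
suff Nc : N <= c by move=> u; apply: le_trans (HN u) _; rewrite ler_wpM2r ?l2norm_ge0.
suff [t nb /eqP] : exists2 t : R, ~ bounded_below (fun u => T u - t%:C *: u) &
    root (p * map_poly (@conjc R) p - ((N ^+ 2)%:C)%:P) t%:C.
  rewrite hornerD hornerN hornerC horner_conj_sq -rmorphB /= => -[] /eqP.
  rewrite subr_eq0 eqrXn2 ?normc_ge0// => /eqP <-; exact: Hp.
(* If the polynomial is zero every real point of the approximate spectrum is a root. *)
have [q0|q0] := eqVneq (p * map_poly (@conjc R) p - ((N ^+ 2)%:C)%:P) 0.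
  have [t nb] := approximate_spectrum_nonempty L sT HM n0.
  by exists t => //; rewrite q0 root0.
have [|t rt nb] := symop_real_root L sT q0; last by exists t.
exact: norm_not_bounded_below.
Qed.

(** A bounded inverse of [T - z] bounds [T - z] from below. *)
Lemma spectrum_approximate T (z : C) :
  ~ bounded_below (fun u => T u - z *: u) -> spectrum T z.
Proof.
move=> nb [S [[_ [M HM]] ST TS]]; apply: nb; exists (`|M| + 1)^-1.
  by rewrite invr_gt0 ltr_wpDl.
move=> u; rewrite mulrC ler_pdivrMr ?ltr_wpDl//.
rewrite -{1}(ST u); apply: le_trans (HM _) _; rewrite mulrC ler_wpM2l ?l2norm_ge0//.
by apply: le_trans (ler_norm _) _; rewrite lerDl.
Qed.

(** A Cauchy sequence of operators converges in each coordinate of each image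
    vector; [ell2_fatou] turns the uniform Cauchy estimate into an estimate for
    the limit. *)
Lemma operator_complete (S_ : nat -> ell2 -> ell2) : (forall n, linop (S_ n)) ->
  (forall e : R, 0 < e -> exists N, forall m n, (N <= m)%N -> (N <= n)%N ->
     forall u, l2norm (S_ m u - S_ n u) <= e * l2norm u) ->
  exists2 S, linop S & forall e : R, 0 < e -> \forall n \near \oo,
     forall u, l2norm (S_ n u - S u) <= e * l2norm u.
Proof.
move=> L Hc.
have coordc u i (e : R) : 0 < e -> exists N, forall m n, (N <= m)%N -> (N <= n)%N ->
    normc (S_ m u i - S_ n u i) < e.
  move=> e0; have p : 0 < l2norm u + 1 by rewrite ltr_wpDl ?l2norm_ge0.
  have [N HN] := Hc (e / (l2norm u + 1)) (divr_gt0 e0 p).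
  exists N => m n Nm Nn; rewrite -ell2B; apply: le_lt_trans (l2norm_coord _ _) _.
  apply: le_lt_trans (HN _ _ Nm Nn u) _; rewrite -mulrA gtr_pMr//.
  by rewrite mulrC ltr_pdivrMr// mul1r ltrDl.
have creal (f : C -> R) : (forall z y : C, `|f z - f y| <= normc (z - y)) ->
    forall u i, cvg ((fun n => f (S_ n u i)) @ \oo).
  move=> Hf u i; apply: cauchy_cvg; apply/cauchy_exP => e e0.
  have [N HN] := coordc u i e e0.
  exists (f (S_ N u i)); exists N => // n /= Nn; apply: le_lt_trans (Hf _ _) _.
  exact: HN.
pose l u i : C := (lim ((fun n => complex.Re (S_ n u i)) @ \oo)) +i*
                  (lim ((fun n => complex.Im (S_ n u i)) @ \oo)).
have lc u i : (fun n => S_ n u i) @ \oo --> l u i.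
  apply: cvg_ReIm.
    by apply: (creal (@complex.Re R)) => z y; rewrite -raddfB normc_Re.
  by apply: (creal (@complex.Im R)) => z y; rewrite -raddfB normc_Im.
have key (e : R) : 0 < e -> exists N, forall n, (N <= n)%N -> forall u,
    exists2 w : ell2, forall i, w i = S_ n u i - l u i & l2norm w <= e * l2norm u.
  move=> e0; have [N HN] := Hc e e0; exists N => n Nn u.
  apply: (@ell2_fatou _ _ _ \oo _ (fun m => S_ n u - S_ m u) (fun i => S_ n u i - l u i)).
  - by rewrite mulr_ge0 ?l2norm_ge0 ?ltW.
  - by move=> i; apply: cvgB; [exact: cvg_cst | exact: lc].
  - by exists N => // m /= Nm; exact: HN.
have /choice[S SE] u : exists s : ell2, forall i, s i = l u i.
  have [N HN] := key 1 ltr01; have [w wE _] := HN _ (leqnn N) u.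
  by exists (S_ N u - w) => i; rewrite ell2B wE subKr.
exists S => [c u v|e e0].
  apply: ell2P => i; rewrite ell2D ell2Z !SE.
  apply: (cvg_unique _ (lc _ i)); first exact: norm_hausdorff.
  rewrite (_ : (fun n => _) = (fun n => c * S_ n u i + S_ n v i)); last first.
    by apply/funext => n; rewrite L ell2D ell2Z.
  by apply: cvgD; [apply: cvgMr|]; exact: lc.
have [N HN] := key e e0; exists N => // n /= Nn u; have [w wE wn] := HN n Nn u.
by rewrite (_ : S_ n u - S u = w)//; apply: ell2P => i; rewrite wE ell2B SE.
Qed.

Lemma bounded_limit (S_ : nat -> ell2 -> ell2) S : linop S ->
  (forall n, exists M : R, forall u, l2norm (S_ n u) <= M * l2norm u) ->
  (forall e : R, 0 < e -> \forall n \near \oo,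
     forall u, l2norm (S_ n u - S u) <= e * l2norm u) ->
  bounded_operator S.
Proof.
move=> L B H; split=> //; have [N _ HN] := H 1 ltr01; have [M HM] := B N.
exists (M + 1) => u; rewrite mulrDl -{1}(subKr (S_ N u) (S u)).
by apply: le_trans (l2normB _ _) _; apply: lerD; [exact: HM | apply: HN => /=].
Qed.

Lemma l2norm_lim0 u (k : R) : 0 <= k ->
  (forall e : R, 0 < e -> l2norm u <= e * k) -> u = 0.
Proof.
move=> k0 H; apply: l2norm_eq0; apply/eqP; rewrite eq_le l2norm_ge0 andbT.
apply/ler_addgt0Pr => e e0; rewrite add0r.
apply: le_trans (H (e / (k + 1)) _) _; first by rewrite divr_gt0 ?ltr_wpDl.
by rewrite -mulrA ler_piMr ?(ltW e0)// mulrC ler_pdivrMr ?ltr_wpDl// mul1r lerDl.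
Qed.

(** The inverse of [1 - W] is the limit of the sums [S_n] of the first [n] powers
    of [W]: they satisfy [S_n - W S_n = 1 - W^n], and their tails are bounded by
    a geometric series. *)
Lemma neumann W (r : R) : linop W -> 0 <= r < 1 ->
  (forall u, l2norm (W u) <= r * l2norm u) ->
  exists S, [/\ bounded_operator S, forall u, S (u - W u) = u &
    forall u, S u - W (S u) = u].
Proof.
move=> L /andP[r0 r1] HW.
have Wn n u : l2norm (iter n W u) <= r ^+ n * l2norm u.
  elim: n => [|n IH]; first by rewrite expr0 mul1r.
  rewrite iterS exprS -mulrA; apply: le_trans (HW _) _; exact: ler_wpM2l.
pose S_ n u := \sum_(k < n) iter k W u.
have LS n : linop (S_ n).
  move=> c u v; rewrite /S_ scaler_sumr -big_split; apply: eq_bigr => i _.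
  exact: linop_iter.
have tele n u : S_ n u - W (S_ n u) = u - iter n W u.
  elim: n => [|n IH]; first by rewrite /S_ big_ord0 linop0// !subrr.
  by rewrite /S_ big_ord_recr -/(S_ n u) /= linopD// opprD addrACA IH addrA subrK.
have SW n u : S_ n (W u) = W (S_ n u).
  elim: n => [|n IH]; first by rewrite /S_ !big_ord0 linop0.
  by rewrite /S_ !big_ord_recr -!/(S_ n _) /= IH linopD// -iterS -iterSr.
have r10 : 0 < 1 - r by rewrite subr_gt0.
have inc m j u : (1 - r) * l2norm (S_ (m + j)%N u - S_ m u) <=
    r ^+ m * (1 - r ^+ j) * l2norm u.
  elim: j => [|j IH]; first by rewrite addn0 !subrr l2norm0 mulr0 mulr0 mul0r.
  rewrite addnS /S_ big_ord_recr -!/(S_ _ u) /= addrAC.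
  apply: (@le_trans _ _ ((1 - r) * (l2norm (S_ (m + j)%N u - S_ m u) +
    r ^+ (m + j) * l2norm u))).
    rewrite ler_wpM2l ?(ltW r10)//; apply: le_trans (l2normD _ _) _.
    by rewrite lerD2l.
  rewrite mulrDr; apply: le_trans (lerD IH (lexx _)) _.
  rewrite exprD exprSr le_eqVlt; apply/orP; left; apply/eqP; ring.
have geo (e : R) : 0 < e -> exists N, forall n, (N <= n)%N -> r ^+ n <= e.
  move=> e0; have rn : `|r| < 1 by rewrite ger0_norm.
  have /cvgrPdist_le/(_ _ e0)[N _ HN] := cvg_expr rn.
  by exists N => n Nn; have := HN n Nn; rewrite /= sub0r normrN ger0_norm ?exprn_ge0.
have cau (e : R) : 0 < e -> exists N, forall m n, (N <= m)%N -> (N <= n)%N ->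
    forall u, l2norm (S_ m u - S_ n u) <= e * l2norm u.
  move=> e0; have [N HN] := geo _ (mulr_gt0 r10 e0).
  suff H m n : (N <= m)%N -> (m <= n)%N -> forall u, l2norm (S_ n u - S_ m u) <= e * l2norm u.
    exists N => m n Nm Nn u; have [mn|nm] := leqP m n; last exact: H (ltnW nm) u.
    by rewrite l2norm_distC; exact: H.
  move=> Nm /subnKC <- u; rewrite -(ler_pM2l r10); apply: le_trans (inc _ _ _) _.
  rewrite mulrA ler_wpM2r ?l2norm_ge0//; apply: le_trans (HN _ Nm).
  by rewrite ler_piMr ?exprn_ge0// gerBl exprn_ge0.
have [S SL HS] := operator_complete LS cau.
have bS : bounded_operator S.
  apply: (bounded_limit SL _ HS) => n.
  exists (\sum_(k < n) r ^+ k) => u; rewrite /S_ mulr_suml.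
  elim/big_ind2: _ => [|x a y b xa yb|i _]; first by rewrite l2norm0.
    by apply: le_trans (l2normD _ _) _; exact: lerD.
  exact: Wn.
have WS n (d : R) u : l2norm (S_ n u - S u) <= d -> l2norm (W (S_ n u) - W (S u)) <= d.
  move=> h; rewrite -linopB//; apply: le_trans (HW _) (le_trans _ h).
  by rewrite ler_piMl ?l2norm_ge0// ltW.
have right u : S u - W (S u) = u.
  apply/eqP; rewrite -subr_eq0; apply/eqP; apply: (@l2norm_lim0 _ (3 * l2norm u)).
    by rewrite mulr_ge0 ?l2norm_ge0.
  move=> e e0; have [N1 _ H1] := HS e e0; have [N2 H2] := geo e e0.
  pose n := maxn N1 N2.
  have h1 := H1 n (leq_maxl _ _) u; have h2 := H2 n (leq_maxr _ _).
  have -> : S u - W (S u) - u = (W (S_ n u) - W (S u)) - (S_ n u - S u) - iter n W u.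
    have -> : iter n W u = u - (S_ n u - W (S_ n u)) by rewrite tele subKr.
    by apply: ell2P => i; rewrite !ell2B; ring.
  apply: le_trans (l2normB _ _) _.
  have -> : e * (3 * l2norm u) = (e * l2norm u + e * l2norm u) + e * l2norm u by ring.
  apply: lerD; last by apply: le_trans (Wn _ _) _; rewrite ler_wpM2r ?l2norm_ge0.
  by apply: le_trans (l2normB _ _) _; apply: lerD => //; exact: WS.
exists S; split => // u; rewrite linopB// -[RHS]right; congr (_ - _).
apply/eqP; rewrite -subr_eq0; apply/eqP; apply: (@l2norm_lim0 _ (2 * l2norm u)).
  by rewrite mulr_ge0 ?l2norm_ge0.
move=> e e0; have [N1 _ H1] := HS e e0; have h1 := H1 N1 (leqnn _).
have -> : S (W u) - W (S u) = (W (S_ N1 u) - W (S u)) - (S_ N1 (W u) - S (W u)).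
  by rewrite SW; apply: ell2P => i; rewrite !ell2B; ring.
have -> : e * (2 * l2norm u) = e * l2norm u + e * l2norm u by ring.
apply: le_trans (l2normB _ _) _; apply: lerD; first exact: WS.
apply: le_trans (h1 _) _; rewrite ler_wpM2l ?(ltW e0)//; apply: le_trans (HW u) _.
by rewrite ler_piMl ?l2norm_ge0// ltW.
Qed.

(** For [|z| > M] the operator [T - z = - z (1 - z^-1 T)] is inverted by the
    Neumann series. *)
Lemma spectrum_bound T (M : R) (z : C) : linop T ->
  (forall u, l2norm (T u) <= M * l2norm u) -> 0 <= M -> spectrum T z -> normc z <= M.
Proof.
move=> L HM M0 sp; rewrite leNgt; apply/negP => Mz.
have z0 : z != 0 by rewrite -normc_eq0 gt_eqF// (le_lt_trans M0).
have zp : 0 < normc z by exact: le_lt_trans M0 Mz.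
have LW : linop (fun u => z^-1 *: T u) by exact: linop_scale.
have [||S [[LS [N HN]] S1 S2]] := @neumann (fun u => z^-1 *: T u) (M / normc z) LW.
- by rewrite divr_ge0 ?normc_ge0//= ltr_pdivrMr// mul1r.
- move=> u; rewrite l2normZ; have -> : normc z^-1 = (normc z)^-1.
    have zn : normc z != 0 by rewrite gt_eqF.
    by apply: (mulfI zn); rewrite -Normc.normcM !divff// Normc.normc1.
  by rewrite [M / _]mulrC -mulrA ler_pM2l ?invr_gt0.
apply: sp; exists (fun u => - z^-1 *: S u); split.
- split; first exact: linop_scale.
  exists (normc (- z^-1) * N) => u.
  by rewrite l2normZ -mulrA ler_wpM2l ?normc_ge0.
- move=> u; rewrite -(linopZ LS) -[RHS]S1; congr S.
  by apply: ell2P => i; rewrite ell2Z !ell2B !ell2Z; field.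
- move=> u; rewrite -[RHS]S2; apply: ell2P => i.
  by rewrite (linopZ L) !ell2B !ell2Z; field.
Qed.

Section FunctionalCalculus.
Variables (T : ell2 -> ell2) (M : R).
Hypotheses (LT : linop T) (sT : symop T) (M0 : 0 <= M).
Hypothesis HM : forall u, l2norm (T u) <= M * l2norm u.

Lemma poly_norm_spectrum p (c : R) : 0 <= c ->
  (forall t : R, spectrum T t%:C -> normc p.[t%:C] <= c) ->
  forall u, l2norm (operator_poly p T u) <= c * l2norm u.
Proof.
move=> c0 H; apply: (symop_poly_norm LT sT HM c0) => t nb; apply: H.
exact: spectrum_approximate.
Qed.

Lemma spectrum_real_bound (t : R) : spectrum T t%:C -> `|t| <= M.
Proof. by move=> /(spectrum_bound LT HM M0); rewrite normc_real. Qed.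

(** The polynomials defining [S] approximate [phi] on the spectrum, where [p] is
    also close to [phi], and [poly_norm_spectrum] applies to their difference
    with [p]. Closeness on an interval, rather than on the spectrum, allows one
    [p] to serve a whole family of operators. *)
Lemma functional_calculus_dist (phi : R -> C) S p (c : R) : 0 <= c ->
  is_functional_calculus phi T S ->
  (forall t : R, `|t| <= M -> normc (p.[t%:C] - phi t) <= c) ->
  forall u, l2norm (operator_poly p T u - S u) <= c * l2norm u.
Proof.
move=> c0 [[LS _] [q [Hq Hop]]] Hp u.
have {}Hop : forall e : R, 0 < e -> \forall n \near \oo,
    forall u, l2norm (operator_poly (q n) T u - S u) <= e * l2norm u.
  by apply/opnorm_cvg0P => // n; apply: linop_sub => //; exact: linop_poly.
suff H (e : R) : 0 < e -> l2norm (operator_poly p T u - S u) <= (c + e + e) * l2norm u.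
  have [u0|u0] := eqVneq (l2norm u) 0.
    by have := H 1 ltr01; rewrite u0 !mulr0.
  have up : 0 < l2norm u by rewrite lt_def u0 l2norm_ge0.
  rewrite -ler_pdivrMr//; apply/ler_addgt0Pr => e e0.
  by rewrite ler_pdivrMr// [e]splitr addrA; apply: H; rewrite divr_gt0.
move=> e0; have [n [Hn1 Hn2]] : exists n,
    (forall t : R, spectrum T t%:C -> normc ((q n).[t%:C] - phi t) < e) /\
    (forall u, l2norm (operator_poly (q n) T u - S u) <= e * l2norm u).
  have [N1 _ H1] := Hq e e0; have [N2 _ H2] := Hop e e0.
  exists (maxn N1 N2); split; first by apply: H1; rewrite /= leq_maxl.
  by apply: H2; rewrite /= leq_maxr.
have -> : operator_poly p T u - S u =
    operator_poly (p - q n) T u + (operator_poly (q n) T u - S u).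
  by rewrite operator_polyB addrA subrK.
apply: le_trans (l2normD _ _) _; rewrite mulrDl; apply: lerD => //.
apply: poly_norm_spectrum => [|t st]; first by rewrite addr_ge0// ltW.
rewrite hornerD hornerN -(subrK (phi t) p.[_]) -addrA.
apply: le_trans (le_normcD _ _) _; apply: lerD.
  by apply: Hp; exact: spectrum_real_bound.
by rewrite normcB; apply/ltW/Hn1.
Qed.

(** Uniform convergence of [p n] on an interval containing the spectrum makes
    the operators [(p n)(T)] a Cauchy sequence. *)
Lemma functional_calculus_exists (phi : R -> C) (p : nat -> {poly C}) :
  (forall e : R, 0 < e -> \forall n \near \oo,
     forall t : R, `|t| <= M -> normc ((p n).[t%:C] - phi t) < e) ->
  is_functional_calculus phi T (functional_calculus phi T).
Proof.
move=> Hp; apply: (@xgetPex _ (fun=> 0) [set S | is_functional_calculus phi T S]).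
have [|e e0|S LS HS] := @operator_complete (fun n => operator_poly (p n) T).
- by move=> n; exact: linop_poly.
- have [N _ HN] := Hp (e / 2) (divr_gt0 e0 (ltr0Sn _ 1)); exists N => m n Nm Nn u.
  rewrite -operator_polyB; apply: poly_norm_spectrum; first exact: ltW.
  move=> t /spectrum_real_bound tM; rewrite hornerD hornerN.
  rewrite -(subrK (phi t) (p m).[_]) -addrA; apply: le_trans (le_normcD _ _) _.
  rewrite [e]splitr; apply: lerD; first exact: ltW (HN m Nm t tM).
  by rewrite normcB; exact: ltW (HN n Nn t tM).
exists S; split.
  apply: (bounded_limit LS _ HS) => n.
  by have [d _ Hd] := poly_bounded (p n) LT HM; exists d.
exists p; split.
  move=> e e0; apply: filterS (Hp e e0) => n Hn t st.
  by apply: Hn; exact: spectrum_real_bound.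
by apply/opnorm_cvg0P => // n; apply: linop_sub => //; exact: linop_poly.
Qed.

End FunctionalCalculus.

End Operators.

(** * Weierstrass approximation *)

Section Weierstrass.
Context {R : realType}.
Local Notation C := R[i].
Local Notation normc := (@Normc.normc R).

(** The Bernstein polynomial with nodal values [g 0, .., g n], as the expectation
    of [g] at the number of successes in [n] independent trials of probability
    [l], by conditioning on the first trial. The recursion replaces binomial
    coefficients; [binomial_mean] is the same expectation for real values. *)
Fixpoint bernstein (l : {poly C}) n (g : nat -> C) : {poly C} :=
  if n is n'.+1 then
    l * bernstein l n' (fun k => g k.+1) + (1 - l) * bernstein l n' g
  else (g 0%N)%:P.

Fixpoint binomial_mean (x : R) n (g : nat -> R) : R :=
  if n is n'.+1 then
    x * binomial_mean x n' (fun k => g k.+1) + (1 - x) * binomial_mean x n' g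
  else g 0%N.

(** The triangle inequality for expectations. *)
Lemma bernstein_dist (l : {poly C}) (z : C) (x : R) n g (c : C) :
  l.[z] = x%:C -> 0 <= x <= 1 ->
  normc ((bernstein l n g).[z] - c) <= binomial_mean x n (fun k => normc (g k - c)).
Proof.
move=> lz /andP[x0 x1]; elim: n g => [|n IH] g /=; first by rewrite hornerC.
rewrite hornerD !hornerM hornerD hornerN hornerC lz.
set a := (bernstein _ _ _).[z]; set b := (bernstein _ _ _).[z].
have -> : x%:C * a + (1 - x%:C) * b - c = x%:C * (a - c) + (1 - x)%:C * (b - c).
  by rewrite rmorphB rmorph1; ring.
apply: le_trans (le_normcD _ _) _; rewrite !Normc.normcM !normc_real.
rewrite !ger0_norm ?subr_ge0//; apply: lerD; apply: ler_wpM2l; rewrite ?subr_ge0//; exact: IH.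
Qed.

Lemma binomial_mean_le (x : R) n g h : 0 <= x <= 1 ->
  (forall k, (k <= n)%N -> g k <= h k) -> binomial_mean x n g <= binomial_mean x n h.
Proof.
move=> /andP[x0 x1]; elim: n g h => [|n IH] g h gh /=; first exact: gh.
apply: lerD; apply: ler_wpM2l; rewrite ?subr_ge0//; apply: IH => k kn; apply: gh => //.
exact: leqW.
Qed.

(** The binomial distribution has mean [n x] and variance [n x (1 - x)]; keeping
    the centre [y] arbitrary lets the induction go through. *)
Lemma binomial_mean_quadratic (x a b y : R) n :
  binomial_mean x n (fun k => a + b * (k%:R - y) ^+ 2) =
  a + b * ((n%:R * x - y) ^+ 2 + n%:R * (x * (1 - x))).
Proof.
elim: n y => [|n IH] y /=; first by ring.
rewrite (_ : (fun k : nat => a + b * (k.+1%:R - y) ^+ 2) =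
             (fun k : nat => a + b * (k%:R - (y - 1)) ^+ 2)); last first.
  by apply/funext => k; rewrite -natr1; ring.
by rewrite !IH -natr1; ring.
Qed.

(** Uniform continuity handles the points at distance less than some [d]; for
    the others the quadratic term is at least twice a bound of [|phi|]. The
    quadratic form of the modulus is what [binomial_mean_quadratic] averages. *)
Lemma modulus_of_continuity (phi : R -> C) (M e : R) : continuous phi -> 0 < e ->
  exists2 k : R, 0 <= k & forall s t, `|s| <= M -> `|t| <= M ->
    normc (phi s - phi t) <= e + k * (s - t) ^+ 2.
Proof.
move=> cphi e0.
have /compact_near_coveringP cov := @segment_compact R (- M) M.
have inM s : `|s| <= M -> `[- M, M]%classic s by rewrite /= in_itv /= ler_norml.
have [B B0 HB] : exists2 B : R, 0 < B & forall s, `|s| <= M -> normc (phi s) <= B.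
  have /(_ _)[|B [Br HB]] := cov R +oo%R (fun B s => normc (phi s) <= B) _.
    move=> s _; have /cvgC_normP/(_ _ ltr01) H := cphi s.
    near=> s' B => /=.
    have h1 : normc (phi s - phi s') < 1 by near: s'; exact: H.
    rewrite -(subrK (phi s) (phi s')); apply: le_trans (le_normcD _ _) _.
    rewrite normcB; apply: le_trans (lerD (ltW h1) (lexx _)) _.
    near: B; apply: nbhs_pinfty_ge; exact: num_real.
  exists (`|B| + 1); first by rewrite ltr_wpDl.
  move=> s /inM Ms; apply: HB => //; apply: le_lt_trans (ler_norm B) _.
  by rewrite ltrDl.
have [d d0 Hd] : exists2 d : R, 0 < d & forall s t, `|s| <= M -> `|s - t| < d ->
    normc (phi s - phi t) <= e.
  have e2 : 0 < e / 2 by rewrite divr_gt0.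
  have /(_ _)[|d /= d0 Hd] := cov R 0^'+
    (fun d s => forall t, `|s - t| < d -> normc (phi s - phi t) <= e) _.
    move=> s _; have /cvgC_normP/(_ _ e2)/nbhs_ballP[r /= r0 H] := cphi s.
    have r2 : 0 < r / 2 by rewrite divr_gt0.
    near=> s' d => t /= s't.
    have h0 : `|s - s'| < r / 2 by near: s'; exact: nbhsx_ballx.
    have h1 : normc (phi s - phi s') < e / 2.
      by apply: H; apply: lt_trans h0 _; rewrite ltr_pdivrMr// ltr_pMr// ltr1n.
    have h2 : normc (phi s - phi t) < e / 2.
      apply: H; rewrite /ball /= -(subrK s' s) -addrA; apply: le_lt_trans (ler_normD _ _) _.
      rewrite [r]splitr ltrD//; apply: lt_le_trans s't _; near: d.
      exact: nbhs_right_le.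
    rewrite -(subrK (phi s) (phi s')) -addrA [e]splitr; apply: le_trans (le_normcD _ _) _.
    by rewrite [normc (phi s' - _)]normcB lerD ?ltW.
  exists (d / 2); first by rewrite divr_gt0.
  have d2 : 0 < d / 2 by rewrite divr_gt0.
  move=> s t /inM Ms st; apply: (Hd (d / 2)) => //.
  by rewrite /ball/= sub0r normrN gtr0_norm// ltr_pdivrMr// ltr_pMr// ltr1n.
exists (2 * B / d ^+ 2); first by rewrite divr_ge0 ?sqr_ge0// mulr_ge0// ltW.
move=> s t Ms Mt; have [st|st] := ltP `|s - t| d.
  by apply: le_trans (Hd _ _ Ms st) _; rewrite lerDl mulr_ge0 ?sqr_ge0// divr_ge0 ?sqr_ge0// mulr_ge0// ltW.
apply: le_trans (le_normcD _ _) _; rewrite normcN.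
apply: le_trans (lerD (HB _ Ms) (HB _ Mt)) _; apply: ler_wpDl; first exact: ltW.
rewrite mulrAC ler_pdivlMr ?exprn_gt0//.
have -> : B + B = 2 * B by ring.
rewrite ler_pM2l ?mulr_gt0//.
by rewrite -[leRHS]real_normK ?num_real// ler_sqr ?nnegrE// ltW.
Unshelve. all: by end_near. Qed.

(** Bernstein's proof: the error at [t] is at most [e / 2] plus a constant times
    the variance of the node, which decreases like [1 / n]. *)
Theorem weierstrass (phi : R -> C) (M : R) : continuous phi -> 0 < M ->
  exists p : nat -> {poly C}, forall e : R, 0 < e -> \forall n \near \oo,
    forall t : R, `|t| <= M -> normc ((p n).[t%:C] - phi t) < e.
Proof.
(* [l] maps the interval from [- M] to [M] onto the unit interval and the node
   [node n k] to [k / n]. *)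
move=> cphi M0; pose l : {poly C} := ((2 * M)^-1)%:C *: ('X + (M%:C)%:P).
pose node n k : R := 2 * M * (k%:R / n%:R) - M.
exists (fun n => bernstein l n (fun k => phi (node n k))) => e e0.
have e2 : 0 < e / 2 by rewrite divr_gt0.
have [k k0 Hk] := @modulus_of_continuity phi M (e / 2) cphi e2.
near=> n => t tM.
have n0 : 0 < n%:R :> R by rewrite ltr0n; near: n; exact: nbhs_infty_gt.
have := tM; rewrite ler_norml => /andP[tM1 tM2].
have M20 : 0 < 2 * M by rewrite mulr_gt0.
pose x := (t + M) / (2 * M).
have x01 : 0 <= x <= 1.
  by rewrite /x divr_ge0 ?(ltW M20) ?ler_pdivrMr//=; lra.
have lt : l.[t%:C] = x%:C.
  by rewrite hornerZ hornerD hornerX hornerC -rmorphD -rmorphM /= /x mulrC.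
apply: le_lt_trans (bernstein_dist _ _ _ lt x01) _.
pose b := k * (2 * M) ^+ 2 / n%:R ^+ 2.
apply: (@le_lt_trans _ _ (binomial_mean x n (fun j => e / 2 + b * (j%:R - n%:R * x) ^+ 2))).
  apply: binomial_mean_le => // j jn.
  have jn0 : 0 <= (j%:R / n%:R : R) <= 1.
    by rewrite divr_ge0//= ler_pdivrMr// mul1r ler_nat.
  have nodeM : `|node n j| <= M.
    move/andP: jn0 => [j0 j1]; rewrite ler_norml /node; set y := j%:R / n%:R in j0 j1 *.
    by apply/andP; split; nra.
  apply: le_trans (Hk _ _ nodeM tM) _; rewrite lerD2l /b le_eqVlt; apply/orP; left.
  by apply/eqP; rewrite /node /x; field; rewrite !gt_eqF.
rewrite binomial_mean_quadratic subrr expr0n add0r [ltRHS]splitr ltrD2l.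
have xx : 0 <= x * (1 - x) <= 1 by move/andP: x01 => [x0 x1]; apply/andP; split; nra.
have b0 : 0 <= b by rewrite divr_ge0 ?sqr_ge0// mulr_ge0 ?sqr_ge0.
apply: (@le_lt_trans _ _ (b * n%:R)).
  by rewrite ler_wpM2l// ler_piMr ?(ltW n0)//; case/andP: xx.
have -> : b * n%:R = k * (2 * M) ^+ 2 / n%:R by rewrite /b; field; rewrite gt_eqF.
rewrite ltr_pdivrMr// [ltRHS]mulrC -ltr_pdivrMr//.
near: n; exact: nbhs_infty_gtr.
Unshelve. all: by end_near. Qed.

End Weierstrass.

(** * The Chabauty-Fell topology and the space of Delone sets *)

Lemma near_seq (T : choiceType) (P : Type) (F : set_system P) (FF : Filter F)
    (s : seq T) (Q : T -> P -> Prop) :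
  (forall z, z \in s -> \forall p \near F, Q z p) ->
  \forall p \near F, forall z, z \in s -> Q z p.
Proof.
elim: s => [|z s IH] H; first by apply: nearW.
have h1 := H z (mem_head _ _).
have h2 : \forall p \near F, forall y, y \in s -> Q y p.
  by apply: IH => y ys; apply: H; rewrite in_cons ys orbT.
by apply: filterS2 h1 h2 => p h3 h4 y; rewrite in_cons => /predU1P[->|/h4].
Qed.

Section Fell.
Context {Z : topologicalType}.
Implicit Types (Y : closed_set Z) (C O : set Z).

Lemma fell_base_open i : fell_index i -> open (fell_base i : set (closed_set Z)).
Proof.
move=> ii; exists [set i]; first by move=> _ ->.
by rewrite bigcup_set1.
Qed.

Lemma open_hit O : open O -> open [set Y : closed_set Z | O `&` Y !=set0].
Proof.
move=> oO; have := @fell_base_open (set0, [set O]).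
rewrite (_ : fell_base _ = [set Y : closed_set Z | O `&` Y !=set0]).
  by apply; split => /=; [exact: compact0 | exact: finite_set1 | by move=> _ ->].
apply/seteqP; split=> Y /=; first by case=> _; apply.
by move=> h; split=> [|_ ->//]; rewrite set0I.
Qed.

Lemma open_miss C : compact C -> open [set Y : closed_set Z | C `&` Y = set0].
Proof.
move=> cC; have := @fell_base_open (C, set0).
rewrite (_ : fell_base _ = [set Y : closed_set Z | C `&` Y = set0]).
  by apply; split => //=; exact: finite_set0.
by apply/seteqP; split=> Y /=; [case | move=> h; split].
Qed.

Definition carrier (A : set (closed_set Z)) (Y : A) : set Z := cset (set_val Y).

Lemma nbhs_fell (A : set (closed_set Z)) (Y : A) (B : set A) :
  nbhs Y B -> exists C (Os : set (set Z)), [/\ compact C, finite_set Os & Os `<=` open] /\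
    [/\ C `&` carrier Y = set0, (forall O, Os O -> O `&` carrier Y !=set0) &
    forall Y' : A, C `&` carrier Y' = set0 ->
      (forall O, Os O -> O `&` carrier Y' !=set0) -> B Y'].
Proof.
move=> [_ [[W [D' D'D <-] <-] [i D'i /= [dY mY]] WB]].
have [ci fi oi] := D'D i D'i.
exists i.1, i.2; split; split=> // Y' dY' mY'; apply: WB => /=.
by exists i.
Qed.

(** A basic open set involves one compact set to be missed and finitely many open
    sets to be hit, which are treated one at a time. *)
Lemma cvg_fell (A : set (closed_set Z)) (F : set_system A) (FF : Filter F) (Y : A) :
  (forall O, open O -> O `&` carrier Y !=set0 -> \forall Y' \near F, O `&` carrier Y' !=set0) ->
  (forall C, compact C -> C `&` carrier Y = set0 -> \forall Y' \near F, C `&` carrier Y' = set0) ->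
  F --> Y.
Proof.
move=> hit miss B /nbhs_fell[C [Os [[cC fOs oOs] [dY mY H]]]].
have h2 : \forall Y' \near F, forall O, Os O -> O `&` carrier Y' !=set0.
  have /finite_fsetP[X XE] := fOs; rewrite XE.
  have HX O : O \in X -> \forall Y' \near F, O `&` carrier Y' !=set0.
    by move=> OX; apply: hit; [apply: oOs; rewrite XE | apply: mY; rewrite XE].
  exact: (@near_seq _ _ F FF (enum_fset X) (fun O (Y' : A) => O `&` carrier Y' !=set0)).
by apply: filterS2 (miss C cC dY) h2 => Y' h3 h4; exact: H.
Qed.

Lemma near_hit (A : set (closed_set Z)) (Y : A) O : open O -> O `&` carrier Y !=set0 ->
  \forall Y' \near Y, O `&` carrier Y' !=set0.
Proof.
move=> oO h; have c := @initial_continuous A (closed_set Z) set_val Y.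
exact: (c _ (open_nbhs_nbhs (conj (open_hit oO) h))).
Qed.

Lemma near_miss (A : set (closed_set Z)) (Y : A) C : compact C -> C `&` carrier Y = set0 ->
  \forall Y' \near Y, C `&` carrier Y' = set0.
Proof.
move=> cC h; have c := @initial_continuous A (closed_set Z) set_val Y.
exact: (c _ (open_nbhs_nbhs (conj (open_miss cC) h))).
Qed.

(** Local compactness provides one compact neighbourhood; regularity of compact
    Hausdorff spaces shrinks it. *)
Lemma locally_compact_inside (x : Z) (B : set Z) : hausdorff_space Z ->
  locally_compact [set: Z] -> nbhs x B -> exists C, [/\ compact C, nbhs x C & C `<=` B].
Proof.
move=> hZ lZ xB; have := lZ x I; rewrite withinET => -[V' V'x [cV' _]].
have [W xW WB] := compact_regular hZ cV' V'x xB.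
exists (closure W `&` V'); split.
- apply: (subclosed_compact _ cV') => //; apply: closedI; first exact: closed_closure.
  exact: compact_closed.
- by apply: filterI => //; apply: filterS xW; exact: subset_closure.
- by move=> y [/WB].
Qed.

(** A point of [Y] outside [Y'] has a compact neighbourhood missing [Y']: its
    interior is hit near [Y], and it is missed near [Y']. *)
Lemma fell_hausdorff (A : set (closed_set Z)) : hausdorff_space Z ->
  locally_compact [set: Z] -> hausdorff_space A.
Proof.
move=> hZ lZ Y1 Y2 cl; apply: val_inj; apply: closed_set_inj.
suff H (Y Y' : A) : cluster (nbhs Y) Y' -> carrier Y `<=` carrier Y'.
  by apply/seteqP; split; apply: H => // B1 B2 h1 h2; rewrite setIC; exact: cl.
move=> {}cl x Yx; apply: contrapT => nY'x.
have /(locally_compact_inside hZ lZ)[C [cC xC CY']] : nbhs x (~` (carrier Y')).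
  by apply: open_nbhs_nbhs; split=> //; apply: closed_openC; exact: cset_closed.
have oC : open (C°) by exact: open_interior.
have hit : C° `&` carrier Y !=set0 by exists x; split=> //; exact: nbhs_interior xC.
have miss : C `&` carrier Y' = set0 by apply/disjoints_subset.
have [D [[z [Cz Dz]] h2]] := cl _ _ (near_hit oC hit) (near_miss cC miss).
suff : (set0 : set Z) z by [].
by rewrite -h2; split=> //; exact: interior_subset.
Qed.

Lemma continuous_injective_hausdorff (S T : topologicalType) (f : S -> T) :
  hausdorff_space T -> continuous f -> injective f -> hausdorff_space S.
Proof.
move=> hT cf If x y xy; apply/If/hT => A B fxA fyB.
by have [z [? ?]] := xy _ _ (cf x A fxA) (cf y B fyB); exists (f z).
Qed.

Lemma set_type_compact (T : topologicalType) (A : set T) :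
  compact A -> compact [set: A].
Proof.
move=> cA F PF _.
have FA : F (set_val @^-1` A) by apply: filterE => x; exact: set_valP.
have [x [Ax clx]] := cA (set_val @ F) _ FA.
exists (exist _ x (mem_set Ax)); split=> // B V FB [_ [[W oW <-] /= Wx] WV].
have [|_ [[z Bz <-] Wz]] := clx (set_val @` B) W _ (open_nbhs_nbhs (conj oW Wx)).
  have : F (set_val @^-1` (set_val @` B)) by apply: filterS FB => z Bz; exists z.
  exact.
by exists z; split=> //; exact: WV.
Qed.

End Fell.

Section DeloneSpace.
Context {G : topGroupType} (U K : set G).
Hypotheses (hausG : hausdorff_space G) (lcG : locally_compact [set: G]).
Hypotheses (openU : open U) (U1 : U 1%g) (compactK : compact K).
Local Notation Del := (Delone U K).
Implicit Types (D : Del) (g x y : G).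

Lemma mulg_cvg (T : Type) (F : set_system T) (FF : Filter F) (f h : T -> G) (a b : G) :
  f @ F --> a -> h @ F --> b -> (fun t => (f t * h t)%g) @ F --> (a * b)%g.
Proof.
move=> fa hb; apply: (@cvg_comp _ _ _ (fun t => (f t, h t)) (fun p : G * G => (p.1 * p.2)%g) _ (nbhs (a, b))).
  exact: cvg_pair.
exact: (@mulg_continuous G (a, b)).
Qed.

Lemma mulgl_continuous g : continuous (fun x : G => (g * x)%g).
Proof. by move=> x; apply: mulg_cvg; [exact: cvg_cst | exact: cvg_id]. Qed.

Lemma translate_open g (A : set G) : open A -> open (translate g A).
Proof.
move=> oA; rewrite translateE; apply: open_comp => // x _; exact: mulgl_continuous.
Qed.

Lemma translate_compact g (A : set G) : compact A -> compact (translate g A).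
Proof.
move=> cA; apply: continuous_compact => //; apply: continuous_subspaceT.
exact: mulgl_continuous.
Qed.

Lemma pts_unique D g x y : translate g U x -> translate g U y ->
  pts D x -> pts D y -> x = y.
Proof. by move=> gx gy Dx Dy; have [_ H _] := set_mem (valP D); apply: (H g). Qed.

Lemma pts_cover D g : exists2 k, K k & pts D (g * k^-1)%g.
Proof.
have [_ _ H] := set_mem (valP D); have : [set: G] g by [].
by rewrite -H => -[[d k] /= [Dd Kk] <-]; exists k => //; rewrite mulgK.
Qed.

(** An ultrafilter of Delone sets converges to the set of those points all of
    whose neighbourhoods are hit. The limit is again a Delone set: two of its
    points in one translate of [U] would be approached by two points of a single
    Delone set in that translate, and a translate of [K^-1] that it missed would
    be missed by some Delone set. *)
Lemma Delone_compact : compact [set: Del].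
Proof.
rewrite compact_ultra => F UF _.
have FF : ProperFilter F by exact: ultra_proper.
pose Y : set G := [set z | forall O, open O -> O z -> F [set D | O `&` pts D !=set0]].
have cY : closed Y.
  rewrite closure_id; apply/seteqP; split; first exact: subset_closure.
  move=> z clz O oO Oz; have [z' [Yz' Oz']] := clz O (open_nbhs_nbhs (conj oO Oz)).
  exact: Yz'.
have missY C : compact C -> C `&` Y = set0 -> F [set D | C `&` pts D = set0].
  move=> /compact_near_coveringP cov CY.
  suff : \forall D \near F, C `<=` (fun z => ~ pts D z).
    by apply: filterS => D h; apply/disjoints_subset.
  apply: cov => z Cz.
  have /existsNP[V /not_implyP[oV /not_implyP[Vz nV]]] : ~ Y z.
    by move=> Yz; have : (C `&` Y) z by []; rewrite CY.
  have [//|FV] := in_ultra_setVsetC [set D : Del | V `&` pts D !=set0] UF.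
  exists (V, ~` [set D : Del | V `&` pts D !=set0]) => /=.
    by split=> //; exact: open_nbhs_nbhs.
  by move=> [z' D] /= [Vz' nD] Dz'; apply: nD; exists z'.
have hitY O : open O -> O `&` Y !=set0 -> F [set D | O `&` pts D !=set0].
  by move=> oO [z [Oz Yz]]; exact: Yz.
have YK g : exists2 k, K k & Y (g * k^-1)%g.
  apply: contrapT => nY.
  pose C := translate g [set (k^-1)%g | k in K].
  have cC : compact C.
    apply: translate_compact; apply: continuous_compact => //; apply: continuous_subspaceT.
    exact: invg_continuous.
  have : F set0.
    apply: filterS (missY C cC _) => [D h|].
      have [k Kk Dk] := pts_cover D g; suff : (set0 : set G) (g * k^-1)%g by [].
      by rewrite -h; split=> //; exists k^-1%g => //; exists k.
    apply/disjoints_subset => _ [_ [k Kk <-] <-] Yk; apply: nY; by exists k.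
  exact: filter_not_empty.
have YD : Delone U K (ClosedSet cY).
  split.
  - by have [k _ Yk] := YK 1%g; exists (1 * k^-1)%g.
  - move=> g x y [gx Yx] [gy Yy]; apply/eqP/negP => /negP xy.
    move: hausG; rewrite open_hausdorff => /(_ x y xy)[[A B] /= [/set_mem Ax /set_mem By] [oA oB /eqP AB]].
    have ogU := translate_open g openU.
    have hA := hitY _ (openI oA ogU) (ex_intro _ x (conj (conj Ax gx) Yx)).
    have hB := hitY _ (openI oB ogU) (ex_intro _ y (conj (conj By gy) Yy)).
    have [D [[x' [[Ax' gx'] Dx']] [y' [[By' gy'] Dy']]]] := @filter_ex _ F FF _ (filterI hA hB).
    have E := pts_unique gx' gy' Dx' Dy'.
    suff : (set0 : set G) x' by [].
    by rewrite -AB; split=> //; rewrite E.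
  - apply/seteqP; split=> // g _; have [k Kk Yk] := YK g.
    by exists ((g * k^-1)%g, k) => //=; rewrite mulgVK.
exists (exist _ (ClosedSet cY) (mem_set YD)); split=> //.
by apply: cvg_fell => [V oV h|C cC h]; [exact: hitY | exact: missY].
Qed.

Lemma Delone_hausdorff : hausdorff_space Del.
Proof. exact: fell_hausdorff. Qed.

Lemma translate_setI g (A B : set G) :
  A `&` translate g B = translate g (translate (g^-1)%g A `&` B).
Proof.
rewrite !translateE invgK; apply/seteqP; split=> x /=; first by rewrite mulVKg.
by rewrite mulVKg.
Qed.

Lemma translate_nonempty g (A : set G) : translate g A !=set0 <-> A !=set0.
Proof.
by split=> [[_ [x Ax _]]|[x Ax]]; [exists x | exists (g * x)%g; exists x].
Qed.

Lemma Delone_act_continuous g : continuous (@Delone_act G U K g).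
Proof.
move=> D; apply: cvg_fell => [|V oV h|C cC h].
  by apply: (@fmap_filter _ _ _ (nbhs D)); exact: nbhs_filter.
  have h' : translate (g^-1)%g V `&` carrier D !=set0.
    by move: h; rewrite /carrier /= translate_setI translate_nonempty.
  apply: filterS (near_hit (translate_open (g^-1)%g oV) h') => D'.
  by rewrite /carrier /= translate_setI translate_nonempty.
have e0 (A : set G) : translate g A = set0 <-> A = set0.
  split=> [H|->]; last by rewrite /translate image_set0.
  apply/eqP/negP => /negP/set0P[x Ax]; suff : (set0 : set G) (g * x)%g by [].
  by rewrite -H; exists x.
have h' : translate (g^-1)%g C `&` carrier D = set0.
  by move: h; rewrite /carrier /= translate_setI e0.
have hm := near_miss (@translate_compact (g^-1)%g _ cC) h'.
suff : \forall D' \near D, C `&` carrier (Delone_act g D') = set0 by [].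
by apply: filterS hm => D'; rewrite /carrier /= translate_setI e0.
Qed.

(** Each of the finitely many translates of [U] contains at most one point of a
    Delone set, so that their number bounds the number of points in the compact
    set, uniformly in the Delone set. *)
Lemma compact_translates (L : set G) : compact L ->
  exists s : seq G, forall x, L x -> exists2 g, g \in s & translate g U x.
Proof.
rewrite compact_cover => /(_ G L (fun g => translate g U)) [].
- by move=> g _; exact: translate_open.
- by move=> x Lx; exists x => //; exists 1%g => //; rewrite mulg1.
by move=> s _ Hs; exists (enum_fset s) => x /Hs[g /= gs gx]; exists g.
Qed.

Lemma pts_local_seq (L : set G) (s : seq G) :
  (forall x, L x -> exists2 g, g \in s & translate g U x) ->
  forall D, exists t : seq G, [/\ uniq t, (size t <= size s)%N,
    (forall z, z \in t -> pts D z) & forall z, pts D z -> L z -> z \in t].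
Proof.
(* [pk g] is the point of [D] in the translate of [U] by [g], if there is one. *)
move=> Ls D; pose pk (g : G) : option G :=
  if pselect (exists z, pts D z /\ translate g U z) is left e then Some (projT1 (cid e)) else None.
exists (undup (pmap pk s)); split; first exact: undup_uniq.
- by apply: leq_trans (size_undup _) _; rewrite size_pmap; exact: count_size.
- move=> z; rewrite mem_undup mem_pmap => /mapP[g _]; rewrite /pk.
  by case: pselect => // e [->]; have [] := projT2 (cid e).
- move=> z Dz /Ls[g gs gz]; rewrite mem_undup mem_pmap; apply/mapP; exists g => //.
  rewrite /pk; case: pselect => [e|]; last by case; exists z.
  have [h1 h2] := projT2 (cid e); congr Some; exact: (pts_unique gz h2 Dz h1).
Qed.

End DeloneSpace.

(** The value of [\sum_(z \in A)] is the default [0] for an infinite support; the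
    list [t] certifies that the support is finite. *)
Lemma fsum_seq (R : nmodType) (T : choiceType) (A : set T) (f : T -> R) (t : seq T) :
  uniq t -> (forall z, z \in t -> A z) -> (forall z, A z -> f z != 0 -> z \in t) ->
  \sum_(z \in A) f z = \sum_(z <- t) f z.
Proof.
move=> ut tA At; rewrite (fsbig_seq _ _ ut); apply/esym/fsbig_widen => // z [Az /= nz].
by apply/eqP/negP => /negP fz; apply: nz; exact: At.
Qed.

Lemma hausdorff_separate (T : topologicalType) (s : seq T) : hausdorff_space T -> uniq s ->
  exists W : T -> set T, (forall z, z \in s -> open (W z) /\ W z z) /\
    (forall z y x, z \in s -> y \in s -> W z x -> W y x -> z = y).
Proof.
rewrite open_hausdorff => hT; elim: s => [|a s IH] /=; first by exists (fun=> setT).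
move=> /andP[as_ us]; have [W [W1 W2]] := IH us.
have /choice[AB HAB] z : exists AB : set T * set T, z \in s ->
    [/\ open AB.1, open AB.2, AB.1 a, AB.2 z & AB.1 `&` AB.2 = set0].
  case: (boolP (z \in s)) => zs; last by exists (set0, set0).
  have [|[A B] /= [/set_mem Aa /set_mem Bz] [oA oB /eqP AB0]] := hT a z.
    by apply: contraNneq as_ => ->.
  by exists (A, B).
exists (fun z => if z == a then \bigcap_(y in [set` s]) (AB y).1 else W z `&` (AB z).2).
have aW z x : z \in s -> (\bigcap_(y in [set` s]) (AB y).1) x -> (W z `&` (AB z).2) x -> False.
  move=> zs h [_ h2]; have [_ _ _ _ H] := HAB z zs.
  suff : (set0 : set T) x by [].
  by rewrite -H; split=> //; exact: h.
split=> [z|z y x].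
  rewrite in_cons; case: eqVneq => [->|za] /= zs.
    split; last by move=> y ys; have [] := HAB y ys.
    rewrite bigcap_seq big_seq; apply: big_ind; [exact: openT | exact: openI |].
    by move=> y ys; have [] := HAB y ys.
  have [h1 h2] := W1 z zs; have [? ? ? ? ?] := HAB z zs.
  by split=> //; exact: openI.
rewrite !in_cons; case: eqVneq => [->|za] /= zs; case: eqVneq => [->|ya] //= ys.
- by move=> h1 h2; have := aW _ _ ys h1 h2.
- by move=> h1 h2; have := aW _ _ zs h2 h1.
- by move=> [h1 _] [h2 _]; exact: W2 h1 h2.
Qed.

Section LocalSums.
Context {R : realType} {G : topGroupType} (U K : set G).
Hypotheses (hausG : hausdorff_space G) (openU : open U) (U1 : U 1%g).
Local Notation Del := (Delone U K).
Local Notation C := R[i].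
Local Notation normc := (@Normc.normc R).

(** Near a Delone set [D] every Delone set has exactly one point close to each
    of the finitely many points of [D] in a compact set, and no other points
    there; hence local sums of continuous summands vary continuously. *)
Lemma local_sum_cvg (P : Type) (F : set_system P) (FF : Filter F) (D_ : P -> Del) (D : Del)
    (c : P -> G -> C) (c0 : G -> C) (L : set G) :
  D_ @ F --> D -> compact L ->
  (\forall p \near F, forall z, pts (D_ p) z -> c p z != 0 -> L z) ->
  (forall z, pts D z -> c0 z != 0 -> L z) ->
  (forall z, pts D z -> forall e : R, 0 < e -> \forall p \near F & z' \near z,
     pts (D_ p) z' -> normc (c p z' - c0 z) < e) ->
  (fun p => \sum_(z \in pts (D_ p)) c p z) @ F --> \sum_(z \in pts D) c0 z.
Proof.
move=> DF cL supp supp0 cc.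
have [s0 Hs0] := compact_translates openU U1 cL.
have [t [ut _ tD Lt]] := pts_local_seq Hs0 D.
have -> : \sum_(z \in pts D) c0 z = \sum_(z <- t) c0 z.
  by apply: fsum_seq => // z Dz /(supp0 z Dz); exact: Lt.
apply/cvgC_normP => e e0.
pose e' := e / (size t).+1%:R.
have e'0 : 0 < e' by rewrite divr_gt0.
have [W [W1 W2]] := hausdorff_separate hausG ut.
have /choice[V HV] z : exists V : set G, z \in t -> [/\ open V, V z, V `<=` W z,
    V `<=` translate z U & \forall p \near F, forall z', V z' -> pts (D_ p) z' ->
      normc (c p z' - c0 z) < e'].
  case: (boolP (z \in t)) => [zt|_]; last by exists set0.
  have [[Q1 Q2] /= [FQ1 zQ2] HQ] := cc z (tD z zt) e' e'0.
  have [oW Wz] := W1 z zt.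
  exists (Q2° `&` (W z `&` translate z U)) => _; split.
  - by apply: openI; [exact: open_interior | apply: openI => //; exact: translate_open].
  - split; first exact: nbhs_singleton (nbhs_interior zQ2).
    by split=> //; exists 1%g => //; rewrite mulg1.
  - by move=> x [_ []].
  - by move=> x [_ []].
  - apply: filterS FQ1 => p Q1p z' [/interior_subset Q2z' _] Dz'.
    exact: (HQ (p, z')).
have hit : \forall p \near F, forall z, z \in t -> V z `&` pts (D_ p) !=set0.
  have Hz z : z \in t -> \forall p \near F, V z `&` pts (D_ p) !=set0.
    move=> zt; have [oV Vz _ _ _] := HV z zt.
    have h : V z `&` carrier D !=set0 by exists z; split=> //; exact: tD.
    exact: (DF [set D' : Del | V z `&` pts D' !=set0] (near_hit oV h)).
  exact: near_seq.
have near_c : \forall p \near F, forall z, z \in t ->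
    forall z', V z z' -> pts (D_ p) z' -> normc (c p z' - c0 z) < e'.
  have Hz z : z \in t -> \forall p \near F, forall z', V z z' -> pts (D_ p) z' -> normc (c p z' - c0 z) < e'.
    by move=> zt; have [] := HV z zt.
  exact: near_seq.
have miss : \forall p \near F, (L `\` \bigcup_(z in [set` t]) V z) `&` pts (D_ p) = set0.
  have cM : compact (L `\` \bigcup_(z in [set` t]) V z).
    apply: (subclosed_compact _ cL); last by move=> x [].
    rewrite setDE; apply: closedI; first exact: compact_closed.
    by apply: open_closedC; apply: bigcup_open => z zt; have [] := HV z zt.
  have h : (L `\` \bigcup_(z in [set` t]) V z) `&` carrier D = set0.
    apply/disjoints_subset => z [Lz nV] Dz; apply: nV; exists z; first exact: Lt.
    by have [] := HV z (Lt z Dz Lz).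
  exact: (DF [set D' : Del | (L `\` \bigcup_(z in [set` t]) V z) `&` pts D' = set0] (near_miss cM h)).
apply: filterS (filterI (filterI hit near_c) (filterI miss supp)) => p [[Hhit Hc] [Hmiss Hsupp]].
have /choice[zeta Hz] z : exists y, z \in t -> V z y /\ pts (D_ p) y.
  case: (boolP (z \in t)) => zt; last by exists z.
  by have [y [? ?]] := Hhit z zt; exists y.
have -> : \sum_(z \in pts (D_ p)) c p z = \sum_(z <- t) c p (zeta z).
  rewrite -(big_map zeta xpredT (c p)); apply: fsum_seq.
  - rewrite map_inj_in_uniq// => z y zt yt E.
    have [Vz _] := Hz z zt; have [Vy _] := Hz y yt.
    have [_ _ VWz _ _] := HV z zt; have [_ _ VWy _ _] := HV y yt.
    by apply: (W2 z y (zeta z)) => //; [exact: VWz | rewrite E; exact: VWy].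
  - by move=> _ /mapP[z zt ->]; have [] := Hz z zt.
  - move=> x Dx cx; have Lx := Hsupp x Dx cx.
    have [[z zt Vzx]|nV] := pselect ((\bigcup_(z in [set` t]) V z) x); last first.
      suff : (set0 : set G) x by [].
      by rewrite -Hmiss.
    apply/mapP; exists z => //; have [Vz Dz] := Hz z zt.
    have [_ _ _ VU _] := HV z zt.
    exact: (pts_unique (VU _ Vzx) (VU _ Vz) Dx Dz).
rewrite -sumrB; apply: le_lt_trans (normc_sum _ _) _.
apply: (@le_lt_trans _ _ (\sum_(z <- t) e')).
  rewrite !big_seq; apply: ler_sum => z zt; rewrite normcB; apply: ltW.
  by have [Vz Dz] := Hz z zt; exact: Hc.
rewrite big_const_seq count_predT iter_addr_0 -mulr_natr /e' -mulrA gtr_pMr//.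
by rewrite mulrC ltr_pdivrMr// mul1r ltr_nat.
Qed.

End LocalSums.

(** * The Riesz representation theorem on a compact Hausdorff space *)

Lemma continuous_borel_measurable (R : realType) (X : ptopologicalType) (f : X -> R) :
  continuous f -> measurable_fun [set: borel X] (f : borel X -> R).
Proof.
move=> cf; apply: (measurability _ (measurable_realfun.RGenOInfty.measurableE R)) => _ [_ [x ->] <-].
rewrite setTI; apply: sub_sigma_algebra.
by apply: open_comp => // ? _; exact: cf.
Qed.

Lemma continuous_bounded_integrable (R : realType) (X : ptopologicalType)
    (mu : probability (borel X) R) (f : X -> R) (M : R) :
  continuous f -> (forall x, `|f x| <= M) -> mu.-integrable [set: borel X] (EFin \o (f : borel X -> R)).
Proof.
move=> cf fM; apply: measurable_bounded_integrable => //.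
- by apply: le_lt_trans (probability_le1 mu measurableT) _; rewrite ltry.
- exact: continuous_borel_measurable.
- exists M; split; first exact: num_real.
  by move=> y My x _; apply: le_trans (fM x) (ltW My).
Qed.

Lemma compact_continuous_bounded (R : realType) (X : topologicalType) (f : X -> R) :
  compact [set: X] -> continuous f -> exists2 M : R, 0 < M & forall x, `|f x| <= M.
Proof.
move=> compX cf; move/compact_near_coveringP : compX => /(_ R +oo%R (fun M x => `|f x| <= M)) [].
  move=> x _; have /cvgrPdist_lt/(_ _ ltr01) H := cf x.
  near=> y M => /=.
  have h : `|f x - f y| < 1 by near: y; exact: H.
  rewrite -(subrK (f x) (f y)); apply: le_trans (ler_normD _ _) _.
  rewrite distrC; apply: le_trans (lerD (ltW h) (lexx _)) _.
  by near: M; apply: nbhs_pinfty_ge; exact: num_real.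
move=> M [_ HM]; exists (`|M| + 1); first by rewrite ltr_wpDl.
by move=> x; apply: HM => //; apply: le_lt_trans (ler_norm M) _; rewrite ltrDl.
Unshelve. all: by end_near. Qed.

Section CompactIntegration.
Context {R : realType} {X : ptopologicalType}.
Hypothesis compX : compact [set: X].
Variable mu : probability (borel X) R.
Implicit Types (f g : X -> R).

Lemma continuous_integrable f : continuous f ->
  mu.-integrable [set: borel X] (EFin \o (f : borel X -> R)).
Proof.
move=> cf; have [M _ HM] := compact_continuous_bounded compX cf.
exact: continuous_bounded_integrable HM.
Qed.

Definition mean f : R := \int[mu]_x (f : borel X -> R) x.

Lemma meanD f g : continuous f -> continuous g -> mean (fun x => f x + g x) = mean f + mean g.
Proof. by move=> cf cg; apply: RintegralD => //; exact: continuous_integrable. Qed.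

Lemma meanB f g : continuous f -> continuous g -> mean (fun x => f x - g x) = mean f - mean g.
Proof. by move=> cf cg; apply: RintegralB => //; exact: continuous_integrable. Qed.

Lemma meanZ (c : R) f : continuous f -> mean (fun x => c * f x) = c * mean f.
Proof. by move=> cf; apply: RintegralZl => //; exact: continuous_integrable. Qed.

Lemma mean_le f g : continuous f -> continuous g -> (forall x, f x <= g x) -> mean f <= mean g.
Proof. by move=> cf cg fg; apply: le_Rintegral => //; exact: continuous_integrable. Qed.

Lemma mean_cst (c : R) : mean (fun=> c) = c.
Proof.
rewrite /mean (Rintegral_cst mu measurableT).
transitivity (c * fine (1%E : \bar R)); last by rewrite mulr1.
by congr (c * fine _); exact: probability_setT.
Qed.

Lemma mean_norm f (M : R) : continuous f -> (forall x, `|f x| <= M) -> `|mean f| <= M.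
Proof.
move=> cf fM; rewrite ler_norml -{1}(mean_cst M) -{2}(mean_cst M).
have cM : continuous (fun _ : X => M) by move=> x; exact: cvg_cst.
have -> : - mean (fun=> M) = mean (fun=> - M) by rewrite !mean_cst.
have cN : continuous (fun _ : X => - M) by move=> x; exact: cvg_cst.
have fM' x := ler_normlP _ _ (fM x).
by apply/andP; split; apply: mean_le => // x; have [] := fM' x; rewrite // lerNl.
Qed.

End CompactIntegration.

Section Riesz.
Context {R : realType} {X : ptopologicalType}.
Hypothesis hausX : hausdorff_space X.
Hypothesis compX : compact [set: X].
Variable L : (X -> R) -> R.
Hypothesis LD : forall f g : X -> R, continuous f -> continuous g ->
  L (fun x => f x + g x) = L f + L g.
Hypothesis LZ : forall (c : R) (f : X -> R), continuous f -> L (fun x => c * f x) = c * L f.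
Hypothesis L_ge0 : forall f : X -> R, continuous f -> (forall x, 0 <= f x) -> 0 <= L f.
Hypothesis L1 : L (fun=> 1) = 1.
Implicit Types (f g : X -> R) (V : set X).

Let contD f g : continuous f -> continuous g -> continuous (fun x => f x + g x).
Proof. by move=> cf cg x; apply: cvgD; [exact: cf|exact: cg]. Qed.

Let contZ (c : R) f : continuous f -> continuous (fun x => c * f x).
Proof. by move=> cf x; apply: cvgM; [exact: cvg_cst|exact: cf]. Qed.

Let contB f g : continuous f -> continuous g -> continuous (fun x => f x - g x).
Proof. by move=> cf cg x; apply: cvgB; [exact: cf|exact: cg]. Qed.

Let cont_cst (c : R) : continuous (fun _ : X => c).
Proof. by move=> x; exact: cvg_cst. Qed.

Let cont_max f g : continuous f -> continuous g -> continuous (fun x => Num.max (f x) (g x)).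
Proof. by move=> cf cg x; apply: continuous_max; [exact: cf|exact: cg]. Qed.

Let cont_min f g : continuous f -> continuous g -> continuous (fun x => Num.min (f x) (g x)).
Proof. by move=> cf cg x; apply: continuous_min; [exact: cf|exact: cg]. Qed.

Lemma riesz_sub f g : continuous f -> continuous g -> L (fun x => f x - g x) = L f - L g.
Proof.
move=> cf cg; rewrite -[- L g]mulN1r -LZ// -LD//; last exact: contZ.
by congr L; apply/funext => x; rewrite mulN1r.
Qed.

Lemma riesz_le f g : continuous f -> continuous g -> (forall x, f x <= g x) -> L f <= L g.
Proof.
by move=> cf cg fg; rewrite -subr_ge0 -riesz_sub// L_ge0//; [exact: contB | move=> x; rewrite subr_ge0].
Qed.

Lemma riesz_cst (c : R) : L (fun=> c) = c.
Proof.
rewrite -[RHS]mulr1 -{1}L1 -(LZ c (@cont_cst 1)).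
by congr L; apply/funext => x; rewrite mulr1.
Qed.

(** Such a function need only vanish outside [V], which is weaker than having its
    support inside [V]; [cut] recovers the closed set inside [V] that the
    arguments need. *)
Definition below V : set (X -> R) := [set f : X -> R | [/\ continuous f,
  forall x, 0 <= f x <= 1 & forall x, f x != 0 -> V x]].

(** The measure of an open set is the supremum of the functional on the functions
    below its indicator, and [riesz_measure] is the outer measure generated by
    these values. *)
Definition open_content V : \bar R := ereal_sup [set (L f)%:E | f in below V].

Definition riesz_measure (A : set X) : \bar R :=
  ereal_inf [set open_content V | V in [set V | open V /\ A `<=` V]].

Lemma below0 V : below V (fun=> 0).
Proof. by split=> [|x|x]; rewrite ?eqxx ?lexx ?ler01//; exact: cont_cst. Qed.

Lemma open_content_ge0 V : (0 <= open_content V)%E.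
Proof. by apply: ereal_sup_ubound; exists (fun=> 0); [exact: below0 | rewrite riesz_cst]. Qed.

Lemma open_content_le1 V : (open_content V <= 1)%E.
Proof.
apply: ge_ereal_sup => _ [f [cf f01 _] <-]; rewrite lee_fin -L1.
by apply: riesz_le => // x; have /andP[] := f01 x.
Qed.

Lemma le_open_content V V' : V `<=` V' -> (open_content V <= open_content V')%E.
Proof.
move=> OO'; apply: ereal_sup_le => _ [f [cf f01 fO] <-].
by exists f => //; split=> // x /fO/OO'.
Qed.

Lemma open_content_ubound V f : below V f -> ((L f)%:E <= open_content V)%E.
Proof. by move=> Of; apply: ereal_sup_ubound; exists f. Qed.

Lemma riesz_measure_open V : open V -> riesz_measure V = open_content V.
Proof.
move=> oO; apply/eqP; rewrite eq_le; apply/andP; split.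
  by apply: ereal_inf_lbound; exists V => //; split.
by apply: le_ereal_inf_tmp => _ [V' [oO' OO'] <-]; exact: le_open_content.
Qed.

Lemma riesz_measure_ge0 A : (0 <= riesz_measure A)%E.
Proof. by apply: le_ereal_inf_tmp => _ [V _ <-]; exact: open_content_ge0. Qed.

Lemma le_riesz_measure : {homo riesz_measure : A B / A `<=` B >-> (A <= B)%E}.
Proof.
move=> A B AB; apply: le_ereal_inf_tmp => _ [V [oO BO] <-].
by apply: ereal_inf_lbound; exists V => //; split=> //; exact: subset_trans BO.
Qed.

(** Subtracting a level [e] from [f] leaves a function that lives on the closed
    set where [f >= e], at the price of an error [e] ([riesz_cut]). *)
Definition cut (e : R) f : X -> R := fun x => Num.max (f x - e) 0.

Lemma cut_continuous e f : continuous f -> continuous (cut e f).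
Proof. by move=> cf; apply: cont_max => //; apply: contB. Qed.

Lemma cut_neq0 e f x : cut e f x != 0 -> e < f x.
Proof.
rewrite /cut; case: (ltP e (f x)) => // fe.
by rewrite max_r ?eqxx// subr_le0.
Qed.

Lemma cut01 e f x : 0 <= e -> 0 <= f x <= 1 -> 0 <= cut e f x <= 1.
Proof.
move=> e0 /andP[f0 f1]; rewrite /cut le_max lexx orbT/= ge_max ler01 andbT.
by rewrite lerBlDr (le_trans f1)// lerDl.
Qed.

Lemma riesz_cut e f : continuous f -> L f <= L (cut e f) + e.
Proof.
move=> cf; rewrite -{2}(riesz_cst e) -LD//; last exact: cut_continuous.
apply: riesz_le => // [|x]; first by apply: contD => //; exact: cut_continuous.
by rewrite /cut -lerBlDr le_max lexx.
Qed.

Lemma closed_level (e : R) f : continuous f -> closed [set x | e <= f x].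
Proof. by move=> cf; apply: (closed_comp _ (@closed_ge _ e)) => x _; exact: cf. Qed.

(** Urysohn's lemma splits a function supported in [V1 `|` V2], cut off at a
    positive level, into functions supported in [V1] and in [V2]. *)
Lemma open_contentU V1 V2 : open V1 -> open V2 ->
  (open_content (V1 `|` V2) <= open_content V1 + open_content V2)%E.
Proof.
move=> o1 o2; apply: ge_ereal_sup => _ [f [cf f01 fO] <-].
apply/lee_addgt0Pr => e e0.
pose C := [set x | e <= f x].
have cC : closed C by exact: closed_level.
(* [f1] is 0 outside [V1] and 1 on the part of [C] outside [V2]; the minimum
   of [cut e f] and [f1] is the part of the function below [V1]. *)
have [|f1 [cf1 f1_0 f1_1 f1r]] := @urysohn_ext_itv X R (compact_normal hausX compX)
   (~` V1) (C `&` ~` V2) 0 1 (open_closedC o1) (closedI cC (open_closedC o2)) _ ltr01.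
  rewrite eqEsubset; split=> // x [nO1 [Cx nO2]]; have [] // : (V1 `|` V2) x.
  by apply: fO; rewrite gt_eqF// (lt_le_trans e0).
have f1x x : 0 <= f1 x <= 1 by have := f1r (f1 x) (ex_intro2 _ _ x I erefl); rewrite /= in_itv.
pose h := cut e f; pose h1 x := Num.min (h x) (f1 x).
have ch : continuous h by exact: cut_continuous.
have h01 x : 0 <= h x <= 1 by apply: cut01 => //; exact: ltW.
have ch1 : continuous h1 by exact: cont_min.
have b1 : below V1 h1.
  split=> // x; first by rewrite /h1 le_min ge_min; case/andP: (h01 x) => -> ->; case/andP: (f1x x) => ->.
  move=> h1x; apply: contrapT => nO1; move: h1x; rewrite /h1.
  have -> : f1 x = 0 by apply: f1_0; exists x.
  by rewrite min_r ?eqxx//; case/andP: (h01 x).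
have b2 : below V2 (fun x => h x - h1 x).
  split; first exact: contB.
    move=> x; rewrite /h1 subr_ge0 ge_min lexx /= lerBlDr; case/andP: (h01 x) => h0 hx.
    by apply: le_trans hx _; rewrite lerDl le_min h0; case/andP: (f1x x).
  move=> x h2x; apply: contrapT => nO2; move: h2x; rewrite /h1 subr_eq0.
  have [hx|hx] := eqVneq (h x) 0; first by rewrite hx min_l ?eqxx//; case/andP: (f1x x).
  have -> : f1 x = 1.
    by apply: f1_1; exists x => //; split => //; apply: ltW; exact: cut_neq0.
  by rewrite min_l ?eqxx//; case/andP: (h01 x).
apply: (@le_trans _ _ ((L h + e)%:E)); first by rewrite lee_fin riesz_cut.
rewrite EFinD leeD2r// -[h](_ : (fun x => h1 x + (h x - h1 x)) = h); last first.
  by apply/funext => x; rewrite addrC subrK.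
by rewrite LD//; [rewrite EFinD; apply: leeD; exact: open_content_ubound | exact: contB].
Qed.

(** After cutting, a function below the union lives on a compact set, which is
    covered by finitely many of the sets. *)
Lemma open_content_bigcup (V : nat -> set X) : (forall n, open (V n)) ->
  (open_content (\bigcup_n V n) <= \sum_(0 <= n <oo) open_content (V n))%E.
Proof.
move=> oO.
have fin n : (open_content (\bigcup_(i < n) V i) <= \sum_(0 <= i < n) open_content (V i))%E.
  elim: n => [|n IH].
    rewrite big_geq// bigcup_mkord big_ord0; apply: ge_ereal_sup => _ [f [cf _ f0] <-].
    have -> : f = (fun=> 0) by apply/funext => x; apply/eqP; apply/negP => /negP/f0.
    by rewrite riesz_cst.
  rewrite big_nat_recr//= bigcup_mkord big_ord_recr/= -bigcup_mkord.
  apply: le_trans (open_contentU _ _) _; last 1 first.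
  - by rewrite leeD2r.
  - by apply: bigcup_open => i _.
  - exact: oO.
apply: ge_ereal_sup => _ [f [cf f01 fO] <-]; apply/lee_addgt0Pr => e e0.
pose C := [set x | e <= f x].
have cC : compact C by apply: subclosed_compact compX _ => //; exact: closed_level.
have [N HN] : exists N, C `<=` \bigcup_(i < N) V i.
  move/compact_near_coveringP : cC => /(_ nat \oo (fun n x => (\bigcup_(i < n) V i) x)) [].
    move=> x Cx; have [k _ Okx] : (\bigcup_n V n) x.
      by apply: fO; rewrite gt_eqF// (lt_le_trans e0).
    exists (V k, [set n | (k < n)%N]) => /=.
      by split; [exact: open_nbhs_nbhs | exact: nbhs_infty_gt].
    by move=> [y n] /= [Oky kn]; exists k.
  by move=> N _ HN; exists N; apply: HN => /=.
apply: (@le_trans _ _ ((L (cut e f) + e)%:E)); first by rewrite lee_fin riesz_cut.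
rewrite EFinD leeD2r//; apply: le_trans (@open_content_ubound (\bigcup_(i < N) V i) _ _) _.
  split; [exact: cut_continuous | by move=> x; apply: cut01 => //; exact: ltW |].
  by move=> x /cut_neq0/ltW/HN.
apply: le_trans (fin N) _; apply: nneseries_lim_ge => *; exact: open_content_ge0.
Qed.

Lemma riesz_measure_approx A (e : R) : 0 < e -> exists V, [/\ open V, A `<=` V &
  (open_content V <= riesz_measure A + e%:E)%E].
Proof.
move=> e0; have f : riesz_measure A \is a fin_num.
  rewrite ge0_fin_numE ?riesz_measure_ge0//.
  apply: (@le_lt_trans _ _ (open_content setT)); last by rewrite (le_lt_trans (open_content_le1 _))// ltry.
  by apply: ereal_inf_lbound; exists setT => //; split=> //; exact: openT.
have /ereal_inf_lt[_ [V [oO AO] <-] H] : (riesz_measure A < riesz_measure A + e%:E)%E.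
  by rewrite lteDl// lte_fin.
by exists V; split=> //; exact: ltW.
Qed.

Lemma riesz_measure0 : riesz_measure set0 = 0%E.
Proof.
rewrite riesz_measure_open; last exact: open0.
apply/eqP; rewrite eq_le open_content_ge0 andbT; apply: ge_ereal_sup => _ [f [cf _ f0] <-].
have -> : f = (fun=> 0) by apply/funext => x; apply/eqP; apply/negP => /negP/f0.
by rewrite riesz_cst.
Qed.

Lemma riesz_measure_subadditive : sigma_subadditive riesz_measure.
Proof.
move=> F; apply/lee_addgt0Pr => e e0.
have /choice[V HO] n : exists V, [/\ open V, F n `<=` V &
    (open_content V <= riesz_measure (F n) + (e / (2 ^ n.+1)%:R)%:E)%E].
  by apply: riesz_measure_approx; rewrite divr_gt0// ltr0n expn_gt0.
apply: (@le_trans _ _ (\sum_(0 <= n <oo) open_content (V n))%E).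
  apply: le_trans (open_content_bigcup _); last by move=> n; have [] := HO n.
  apply: ereal_inf_lbound; exists (\bigcup_n V n) => //; split.
    by apply: bigcup_open => n _; have [] := HO n.
  by apply: subset_bigcup => n _; have [] := HO n.
apply: le_trans (epsilon_trick xpredT _ (ltW e0)); last by move=> n; exact: riesz_measure_ge0.
by apply: lee_nneseries => [n _ _|n _]; [exact: open_content_ge0 | have [] := HO n].
Qed.

(** A function [f] below [W `&` V], cut at level [e], and a function below
    [W `&` ~` [set x | e <= f x]] have disjoint supports, so that their sum is
    below [W]; the second open set contains [W `&` ~` V]. *)
Lemma riesz_open_caratheodory V A : open V ->
  (riesz_measure (A `&` V) + riesz_measure (A `&` ~` V) <= riesz_measure A)%E.
Proof.
move=> oV; apply: le_ereal_inf_tmp => _ [W [oW AW] <-].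
apply: (@le_trans _ _ (open_content (W `&` V) + riesz_measure (W `&` ~` V))%E).
  apply: leeD; last by apply: le_riesz_measure; exact: setSI.
  rewrite -riesz_measure_open; last exact: openI.
  by apply: le_riesz_measure; exact: setSI.
have fN : riesz_measure (W `&` ~` V) \is a fin_num.
  rewrite ge0_fin_numE ?riesz_measure_ge0//; apply: (@le_lt_trans _ _ (riesz_measure setT)).
    exact: le_riesz_measure.
  by rewrite riesz_measure_open ?(le_lt_trans (open_content_le1 _)) ?ltry//; exact: openT.
rewrite -leeBrDr//; apply: ge_ereal_sup => _ [f [cf f01 fV] <-].
rewrite leeBrDr//; apply/lee_addgt0Pr => e e0.
pose C := [set x | e <= f x].
have oWC : open (W `&` ~` C) by apply: openI => //; apply: closed_openC; exact: closed_level.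
have H : ((L (cut e f))%:E + open_content (W `&` ~` C) <= open_content W)%E.
  rewrite addeC -leeBrDr//; apply: ge_ereal_sup => _ [g [cg g01 gWC] <-].
  rewrite leeBrDr// -EFinD -LD//; last exact: cut_continuous.
  apply: open_content_ubound; split; first by apply: contD => //; exact: cut_continuous.
    move=> x; have [gx|gx] := eqVneq (g x) 0.
      by rewrite gx add0r; apply: cut01 => //; exact: ltW.
    have -> : cut e f x = 0.
      apply/eqP/negP => /negP/cut_neq0/ltW fx.
      by have [_] := gWC x gx.
    by rewrite addr0.
  move=> x; have [gx|gx] := eqVneq (g x) 0; last by have [] := gWC x gx.
  rewrite gx add0r => /cut_neq0 fx.
  by have [] // : (W `&` V) x by apply: fV; rewrite gt_eqF// (lt_trans e0).
apply: (@le_trans _ _ ((L (cut e f) + e)%:E + riesz_measure (W `&` ~` V))%E).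
  by rewrite leeD2r// lee_fin riesz_cut.
rewrite EFinD addeAC leeD2r//; apply: le_trans H; rewrite leeD2l//.
rewrite -riesz_measure_open//; apply: le_riesz_measure => x [Wx nVx]; split=> // Cx.
apply: nVx; have [] // : (W `&` V) x by apply: fV; rewrite gt_eqF// (lt_le_trans e0).
Qed.

Definition riesz_outer : {outer_measure set X -> \bar R} :=
  HB.pack_for {outer_measure set X -> \bar R} riesz_measure
    (isOuterMeasure.Build R X riesz_measure riesz_measure0 riesz_measure_ge0
       le_riesz_measure riesz_measure_subadditive).

(** The sets measurable for an outer measure form a sigma-algebra, which contains
    the open sets. *)
Lemma borel_caratheodory (A : set (borel X)) : measurable A -> riesz_outer.-caratheodory A.
Proof.
apply: smallest_sub.
  split; first exact: caratheodory_measurable_set0.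
    by move=> B mB; rewrite setTD; exact: caratheodory_measurable_setC.
  exact: caratheodory_measurable_bigcup.
move=> V oV; apply: le_caratheodory_measurable => B.
exact: riesz_open_caratheodory.
Qed.

Lemma riesz_measure_sigma_additive :
  semi_sigma_additive (riesz_measure : set (borel X) -> \bar R).
Proof.
move=> F mF tF mUF; apply: (@caratheodory_measure_sigma_additive _ _ riesz_outer) => //.
  by move=> i; exact: borel_caratheodory.
exact: borel_caratheodory.
Qed.

Lemma riesz_measureT : riesz_measure setT = 1%E.
Proof.
rewrite riesz_measure_open; last exact: openT.
apply/eqP; rewrite eq_le open_content_le1 -L1; apply: open_content_ubound; split=> //.
by move=> x; rewrite ler01 lexx.
Qed.

Definition riesz_measure_borel : {measure set (borel X) -> \bar R} :=
  HB.pack_for {measure set (borel X) -> \bar R} (riesz_measure : set (borel X) -> \bar R)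
    (isMeasure.Build _ _ _ (riesz_measure : set (borel X) -> \bar R) riesz_measure0 riesz_measure_ge0
       riesz_measure_sigma_additive).

Definition riesz_probability : probability (borel X) R :=
  HB.pack_for (probability (borel X) R) (riesz_measure : set (borel X) -> \bar R)
    riesz_measure_borel
    (Measure_isProbability.Build _ _ _ riesz_measure_borel riesz_measureT).

Local Notation nu := riesz_probability.

(** The slice of [f] between the heights [a + d] and [a + 2 d] is [d] times a
    function below the open set where [f > a + d], and on this set the slice just
    below has the constant value [d]. *)
Let step_mean (a d : R) f : continuous f -> 0 < d ->
  L (fun x => Num.min (f x) (a + d + d) - Num.min (f x) (a + d)) <=
  mean nu (fun x => Num.min (f x) (a + d) - Num.min (f x) a).
Proof.
move=> cf d0.
have cm b : continuous (fun x => Num.min (f x) b) by exact: cont_min.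
pose V := [set x | a + d < f x].
have oV : open V by apply: (open_comp _ (@open_gt _ (a + d))) => x _; exact: cf.
pose g x := d^-1 * (Num.min (f x) (a + d + d) - Num.min (f x) (a + d)).
have cg : continuous g by apply: contZ; exact: contB.
have gV : below V g.
  split=> // x; rewrite /g; last first.
    rewrite /V /=; case: (ltP (a + d) (f x)) => // fx; rewrite min_l ?subrr ?mulr0 ?eqxx//.
    by rewrite (le_trans fx)// lerDl ltW.
  rewrite mulr_ge0 ?invr_ge0 ?(ltW d0)//=; last first.
    by rewrite subr_ge0 le_min ge_min lexx /= ge_min lerDl (ltW d0) orbT.
  rewrite mulrC ler_pdivrMr// mul1r lerBlDr.
  case: (leP (f x) (a + d)) => fx; first by rewrite ge_min lerDr (ltW d0).
  by rewrite ge_min [d + _]addrC lexx orbT.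
have mV : measurable (V : set (borel X)) by exact: sub_sigma_algebra.
have -> : (fun x => Num.min (f x) (a + d + d) - Num.min (f x) (a + d)) = (fun x => d * g x).
  by apply/funext => x; rewrite /g mulrA divff ?gt_eqF// mul1r.
rewrite LZ//.
apply: (@le_trans _ _ (d * fine (nu V))).
  rewrite ler_pM2l// -lee_fin fineK ?fin_num_measure//.
  by rewrite [leRHS](riesz_measure_open oV) open_content_ubound.
have iV : nu.-integrable [set: borel X] (EFin \o (\1_V : borel X -> R)).
  by apply: integrable_indic => //; rewrite ?fin_num_fun_lty ?fin_num_measure.
have -> : fine (nu V) = \int[nu]_x (\1_V : borel X -> R) x.
  by rewrite /Rintegral integral_indic// setIT.
rewrite -RintegralZl//; apply: le_Rintegral => //.
- exact: (integrableZl measurableT d iV).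
- by apply: continuous_integrable => //; exact: contB.
move=> x _; rewrite indicE; case: (boolP (x \in V)) => [/set_mem fx|_].
  rewrite mulr1 min_r ?min_r; last by rewrite ltW.
    by rewrite addrAC subrr add0r.
  by rewrite (le_trans _ (ltW fx))// lerDl ltW.
by rewrite mulr0 subr_ge0 le_min ge_min lexx /= ge_min lerDl (ltW d0) orbT.
Qed.

(** The range of [f] is cut into slices of height [d]; by [step_mean] each slice
    is dominated by the one below it, and the resulting shift costs [d]. *)
Let L_le_mean01 f : continuous f -> (forall x, 0 <= f x <= 1) -> L f <= mean nu f.
Proof.
move=> cf f01; apply/ler_addgt0Pr => e e0.
have [n ne] : exists n : nat, e^-1 < n.+1%:R.
  have [n _ Hn] := nbhs_infty_gtr e^-1; exists n; apply: lt_le_trans (Hn n (leqnn n)) _.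
  by rewrite ler_nat.
have n0 : 0 < n.+1%:R :> R by [].
pose d : R := n.+1%:R^-1.
have d0 : 0 < d by rewrite invr_gt0.
have de : d <= e by rewrite ltW// /d -(invrK e) ltf_pV2 ?posrE ?invr_gt0.
have cm b : continuous (fun x => Num.min (f x) b) by exact: cont_min.
have H k : L (fun x => Num.min (f x) (k%:R * d + d)) <= mean nu (fun x => Num.min (f x) (k%:R * d)) + d.
  elim: k => [|k IH].
    have -> : (fun x => Num.min (f x) (0%:R * d)) = (fun=> 0).
      by apply/funext => x; rewrite mul0r min_r//; case/andP: (f01 x).
    rewrite mean_cst add0r -[leRHS]riesz_cst; apply: riesz_le => // x.
    by rewrite mul0r add0r ge_min lexx orbT.
  have Ek : k.+1%:R * d = k%:R * d + d by rewrite -natr1 mulrDl mul1r.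
  have -> : (fun x => Num.min (f x) (k.+1%:R * d + d)) = (fun x =>
     Num.min (f x) (k%:R * d + d) + (Num.min (f x) (k%:R * d + d + d) - Num.min (f x) (k%:R * d + d))).
    by apply/funext => x; rewrite Ek; ring.
  rewrite LD//; last exact: contB.
  apply: le_trans (lerD IH (step_mean _ cf d0)) _.
  by rewrite addrAC -meanD//; [rewrite lerD2r le_eqVlt; apply/orP; left; apply/eqP;
     congr mean; apply/funext => x; rewrite Ek; ring | exact: contB].
have := H n; have -> : (fun x => Num.min (f x) (n%:R * d + d)) = f.
  apply/funext => x; rewrite min_l//; case/andP: (f01 x) => _ fx.
  by rewrite -[X in _ + X]mul1r -mulrDl natr1 divff// gt_eqF.
move=> /le_trans; apply; apply: lerD => //; apply: mean_le => // x.
by rewrite ge_min lexx.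
Qed.

(** The Riesz-Markov representation theorem. It suffices to treat [0 <= g <= 1],
    where the inequality [L g <= mean nu g], applied to [g] and to [1 - g], is an
    equality. *)
Lemma riesz_representation f : continuous f -> L f = mean nu f.
Proof.
move=> cf; have [M M0 fM] := compact_continuous_bounded compX cf.
have M20 : 0 < 2 * M by rewrite mulr_gt0.
pose g x := (2 * M)^-1 * (f x + M).
have cg : continuous g by apply: contZ; exact: contD.
have g01 x : 0 <= g x <= 1.
  have /ler_normlP[h1 h2] := fM x.
  rewrite /g mulr_ge0 ?invr_ge0 ?(ltW M20)//=; last by rewrite -lerBlDr sub0r lerNl.
  by rewrite mulrC ler_pdivrMr// mul1r mulr2n mulrDl mul1r lerD2r.
have Lg : L g = mean nu g.
  apply/eqP; rewrite eq_le L_le_mean01//=.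
  have c1g : continuous (fun x => 1 - g x) by exact: contB.
  have := L_le_mean01 c1g _; rewrite riesz_sub// meanB// mean_cst// L1 lerD2l lerN2.
  by apply=> x; case/andP: (g01 x) => h1 h2; rewrite subr_ge0 h2 gerBl.
have fE : f = (fun x => 2 * M * g x - M).
  by apply/funext => x; rewrite /g mulrA divff ?gt_eqF// mul1r addrK.
rewrite fE riesz_sub ?meanB//; try exact: contZ.
by rewrite LZ// meanZ// Lg riesz_cst mean_cst.
Qed.

(** A homeomorphism preserving the functional preserves the representing
    measure, because the latter is defined through the functional. *)
Lemma riesz_measure_invariant (h h' : X -> X) : continuous h -> continuous h' ->
  cancel h h' -> cancel h' h -> (forall f, continuous f -> L (f \o h) = L f) ->
  forall A, riesz_measure (h @^-1` A) = riesz_measure A.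
Proof.
move=> ch ch' hK h'K Lh A.
have pre V : open_content (h @^-1` V) = open_content V.
  apply/eqP; rewrite eq_le; apply/andP; split; apply: ge_ereal_sup => _ [f [cf f01 fV] <-].
    have cfh' : continuous (f \o h') by move=> x; apply: continuous_comp; [exact: ch'|exact: cf].
    rewrite -[f](_ : (f \o h') \o h = f); last by apply/funext => x /=; rewrite hK.
    rewrite Lh//; apply: open_content_ubound; split=> // x /=; first exact: f01.
    by move=> /fV /=; rewrite h'K.
  rewrite -Lh//; apply: open_content_ubound; split=> [x||x] //=.
    by apply: continuous_comp; [exact: ch|exact: cf].
  by move=> /fV.
congr ereal_inf; apply/seteqP; split=> _ [V [oV AV] <-].
  exists (h' @^-1` V); last by rewrite -pre -comp_preimage; congr open_content; apply/funext => x /=; rewrite /preimage /= hK.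
  split; first by apply: open_comp => // x _; exact: ch'.
  by move=> x Ax; apply: AV; rewrite /= h'K.
exists (h @^-1` V); last exact: pre.
split; first by apply: open_comp => // x _; exact: ch.
by move=> x; exact: AV.
Qed.

End Riesz.

(** * Kernels of finite type and random operators *)

Section Schur.
Context {R : realType} {I : choiceType}.
Local Notation C := R[i].
Local Notation normc := (@Normc.normc R).

(** A kernel with at most [N] entries, bounded by [M], in each row and column:
    the square of an entry of the image is at most [(M N)^2] times the sum of the
    squares of the entries of [u] in the row, and each entry of [u] occurs in at
    most [N] rows. *)
Lemma schur_test (k : I -> I -> C) (M : R) (N : nat) (r : I -> seq I) (u : ell2 R I) :
  0 <= M -> (forall x, uniq (r x)) -> (forall x, (size (r x) <= N)%N) ->
  (forall x y, k x y != 0 -> y \in r x /\ x \in r y) ->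
  (forall x y, normc (k x y) <= M) ->
  exists2 v : ell2 R I, forall x, v x = \sum_(y <- r x) k x y * u y &
    l2norm v <= M * N%:R * N%:R * l2norm u.
Proof.
move=> M0 ur sr kr kM.
have c0 : 0 <= M * N%:R * N%:R * l2norm u by rewrite !mulr_ge0 ?l2norm_ge0.
apply: ell2_of_bound => // A.
pose f y := normc (u y) ^+ 2.
have f0 y : 0 <= f y by exact: sqr_ge0.
have row x : normc (\sum_(y <- r x) k x y * u y) ^+ 2 <=
    (M * N%:R) ^+ 2 * \sum_(y <- r x | x \in r y) f y.
  set Q := \sum_(y <- r x | x \in r y) f y.
  have Q0 : 0 <= Q by rewrite sumr_ge0.
  have bd y : y \in r x -> normc (k x y * u y) <= M * Num.sqrt Q.
    move=> yx; rewrite Normc.normcM; have [->|kxy] := eqVneq (k x y) 0.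
      by rewrite Normc.normc0 mul0r mulr_ge0 ?sqrtr_ge0.
    apply: ler_pM; rewrite ?normc_ge0//.
    rewrite -ler_sqr ?nnegrE ?normc_ge0 ?sqrtr_ge0// sqr_sqrtr//.
    have [_ xy] := kr _ _ kxy.
    rewrite /Q big_mkcond (bigD1_seq y)//= xy lerDl sumr_ge0// => z _.
    by case: ifP.
  have h : normc (\sum_(y <- r x) k x y * u y) <= M * N%:R * Num.sqrt Q.
    apply: le_trans (normc_sum _ _) _.
    apply: (@le_trans _ _ (\sum_(y <- r x) M * Num.sqrt Q)).
      by rewrite big_seq [leRHS]big_seq; apply: ler_sum.
    rewrite big_const_seq count_predT iter_addr_0 -[_ *+ size _]mulr_natr mulrAC.
    by rewrite ler_wpM2r ?sqrtr_ge0// ler_wpM2l// ler_nat.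
  rewrite -[leRHS](_ : (M * N%:R * Num.sqrt Q) ^+ 2 = _).
    by rewrite ler_sqr ?nnegrE ?normc_ge0 ?mulr_ge0 ?sqrtr_ge0.
  by rewrite [LHS]exprMn sqr_sqrtr.
apply: le_trans (ler_sum _ (fun x _ => row x)) _.
have -> : (M * N%:R * N%:R * l2norm u) ^+ 2 =
    (M * N%:R) ^+ 2 * (N%:R ^+ 2 * l2norm u ^+ 2) by ring.
rewrite -mulr_sumr ler_wpM2l ?sqr_ge0//.
pose B := undup (flatten [seq r x | x <- enum_fset A]).
have rB x : x \in A -> \sum_(y <- r x | x \in r y) f y =
    \sum_(y <- B | (y \in r x) && (x \in r y)) f y.
  move=> xA; rewrite -[RHS]big_filter_cond; apply: perm_big; apply: uniq_perm => //.
    by apply: filter_uniq; exact: undup_uniq.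
  move=> y; rewrite mem_filter mem_undup; case: (boolP (y \in r x)) => //= yx.
  by apply/esym/flattenP; exists (r x) => //; apply/mapP; exists x.
rewrite (eq_big_seq _ rB) (exchange_big_dep xpredT)//=.
apply: (@le_trans _ _ (\sum_(y <- B) N%:R * f y)).
  apply: ler_sum => y _; rewrite (eq_bigl (fun x => (y \in r x) && (x \in r y)))//.
  rewrite -big_filter big_const_seq count_predT iter_addr_0 -[f y *+ _]mulr_natl ler_wpM2r// ler_nat.
  apply: leq_trans (sr y); apply: uniq_leq_size; first by rewrite filter_uniq.
  by move=> x; rewrite mem_filter => /andP[/andP[]].
rewrite -mulr_sumr; apply: ler_pM; rewrite ?sumr_ge0//.
  by rewrite expr2 -natrM ler_nat; case: (N) => // n; rewrite leq_pmulr.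
by rewrite l2norm_sq l2sq_ge_seq// undup_uniq.
Qed.

End Schur.

Section KernelOperators.
Context {R : realType} {G : topGroupType} (U K : set G).
Hypotheses (openU : open U) (U1 : U 1%g).
Local Notation Del := (Delone U K).
Local Notation C := R[i].
Local Notation normc := (@Normc.normc R).
Local Notation dom := (@kernel_domain G U K).
Implicit Types (a b : dom -> C) (D : Del).

(** Translating a cover of [L] by [x] makes the bound independent of [x]. *)
Lemma pts_local_seq_sub (L : set G) : compact L -> exists N : nat,
  forall D (x : pts D), exists t : seq (pts D), [/\ uniq t, (size t <= N)%N &
    forall y : pts D, L ((set_val x)^-1 * set_val y)%g -> y \in t].
Proof.
move=> cL; have [s Hs] := compact_translates openU U1 cL.
exists (size s) => D x; pose g := set_val x.
have [|t [ut st tD tL]] := @pts_local_seq G U K (translate g L) [seq (g * h)%g | h <- s] _ D.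
  move=> _ [l Ll <-]; have [h hs [u Uu hu]] := Hs l Ll.
  by exists (g * h)%g; [rewrite map_f | exists u => //; rewrite -mulgA hu].
exists (pmap insub t); split.
- by apply: pmap_sub_uniq.
- by move: st; rewrite size_map; apply: leq_trans; rewrite size_pmap; exact: count_size.
- move=> y Ly; rewrite mem_pmap_sub; apply: tL; first exact: set_valP.
  by exists (g^-1 * set_val y)%g => //; rewrite mulVKg.
Qed.

(** What the boundedness of kernel operators rests on; this class of kernels is
    closed under differences and adjoints. *)
Definition finite_range a := (exists M : R, forall p, normc (a p) <= M) /\
  exists L : set G, [/\ compact L, forall x, L x -> L x^-1%g &
    forall p : dom, ~ L ((set_val p).1.1^-1 * (set_val p).2)%g -> a p = 0].

Lemma finite_type_range a : finite_type a -> finite_range a.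
Proof.
move=> [_ bd [L [cL LV aL]] _]; split=> //; exists L; split=> // x Lx.
by rewrite -LV; exists x.
Qed.

Lemma finite_rangeB a b : finite_range a -> finite_range b -> finite_range (a - b)%R.
Proof.
move=> [[M aM] [L [cL LV aL]]] [[M' bM] [L' [cL' LV' bL]]]; split.
  exists (M + M') => p; rewrite [(a - b)%R p]/=; apply: le_trans (le_normcD _ _) _.
  by rewrite normcN lerD.
exists (L `|` L'); split; first exact: compactU.
  by move=> x [/LV|/LV']; [left|right].
move=> p /not_orP[h1 h2]; have -> : (a - b)%R p = a p - b p by [].
by rewrite aL// bL// subr0.
Qed.

Lemma kernel_adjointE a p : kernel_adjoint a p = conjc (a (kernel_flip p)).
Proof. by []. Qed.

Lemma finite_range_adjoint a : finite_range a -> finite_range (kernel_adjoint a).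
Proof.
move=> [[M aM] [L [cL LV aL]]]; split.
  by exists M => p; rewrite kernel_adjointE normc_conj.
exists L; split=> // p nL; rewrite kernel_adjointE aL; first exact: conjc0.
by move=> /= /LV; rewrite invgM invgK.
Qed.

(** The Schur test shows that the default value in the definition of
    [kernel_operator] is never taken, with a bound uniform in the Delone set. *)
Lemma kernel_operator_exists a : finite_range a -> exists2 c : R, 0 <= c &
  forall D (u : ell2 R (pts D)),
    (forall x, kernel_operator a u x = \sum_(y \in [set: pts D]) a (kernel_pair x y) * u y) /\
    l2norm (kernel_operator a u) <= c * l2norm u.
Proof.
move=> [[M aM] [L [cL LV aL]]]; have [N HN] := pts_local_seq_sub cL.
exists (`|M| * N%:R * N%:R); first by rewrite !mulr_ge0.
move=> D u; have /choice[r Hr] := HN D.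
have kr (x y : pts D) : a (kernel_pair x y) != 0 -> y \in r x /\ x \in r y.
  move=> axy; have Lxy : L ((set_val x)^-1 * set_val y)%g.
    by apply: contrapT => nL; move/eqP: axy; apply; exact: aL.
  have [_ _ h1] := Hr x; have [_ _ h2] := Hr y; split; first exact: h1.
  by apply: h2; move/LV: Lxy; rewrite invgM invgK.
have [||||v vE vn] := @schur_test _ _ (fun x y : pts D => a (kernel_pair x y)) `|M| N r u (normr_ge0 M).
- by move=> x; have [] := Hr x.
- by move=> x; have [] := Hr x.
- exact: kr.
- by move=> x y; apply: le_trans (aM _) _; exact: ler_norm.
have vE' x : v x = \sum_(y \in [set: pts D]) a (kernel_pair x y) * u y.
  rewrite vE; apply/esym/fsum_seq => // [|y _].
    by have [] := Hr x.
  by move=> /eqP h; apply: (kr x y _).1; apply/eqP => a0; apply: h; rewrite a0 mul0r.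
have -> : kernel_operator a u = v.
  rewrite /kernel_operator -[RHS](valKd 0); congr insubd; apply/funext => x; exact/esym/vE'.
by [].
Qed.

Lemma kernel_operatorE a D (u : ell2 R (pts D)) x : finite_range a ->
  kernel_operator a u x = \sum_(y \in [set: pts D]) a (kernel_pair x y) * u y.
Proof. by move=> /kernel_operator_exists[c _ H]; have [] := H D u. Qed.

Lemma kernel_row_seq a D (x : pts D) : finite_range a -> exists t : seq (pts D), uniq t /\
  forall y, a (kernel_pair x y) != 0 -> y \in t.
Proof.
move=> [_ [L [cL LV aL]]]; have [N HN] := pts_local_seq_sub cL.
have [t [ut _ Ht]] := HN D x; exists t; split=> // y axy; apply: Ht.
by apply: contrapT => nL; move/eqP: axy; apply; exact: aL.
Qed.

(** Sums along a row over any finite list containing its support, so that two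
    kernels can be compared on a common list. *)
Lemma kernel_operator_seq a D (u : ell2 R (pts D)) x (t : seq (pts D)) : finite_range a ->
  uniq t -> (forall y, a (kernel_pair x y) != 0 -> y \in t) ->
  kernel_operator a u x = \sum_(y <- t) a (kernel_pair x y) * u y.
Proof.
move=> fa ut Ht; rewrite kernel_operatorE//; apply: fsum_seq => // y _ h; apply: Ht.
by apply: contraNneq h => ->; rewrite mul0r.
Qed.

Lemma kernel_operator_linop a D : finite_range a -> linop (@kernel_operator R G U K a D).
Proof.
move=> fa c u v; apply: ell2P => x; have [t [ut Ht]] := kernel_row_seq x fa.
rewrite ell2D ell2Z !(kernel_operator_seq _ fa ut Ht) mulr_sumr -big_split.
by apply: eq_bigr => y _; rewrite ell2D ell2Z /=; ring.
Qed.

Lemma kernel_operatorB a b D (u : ell2 R (pts D)) : finite_range a -> finite_range b ->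
  kernel_operator (a - b)%R u = kernel_operator a u - kernel_operator b u.
Proof.
move=> fa fb; apply: ell2P => x; have [t [ut Ht]] := kernel_row_seq x fa.
have [t' [ut' Ht']] := kernel_row_seq x fb.
have us : uniq (undup (t ++ t')) by exact: undup_uniq.
rewrite ell2B !(@kernel_operator_seq _ _ _ x (undup (t ++ t')))//; try exact: finite_rangeB.
- by rewrite -sumrB; apply: eq_bigr => y _; rewrite -mulrBl.
- by move=> y h; rewrite mem_undup mem_cat Ht'// orbT.
- by move=> y h; rewrite mem_undup mem_cat Ht.
- move=> y; rewrite mem_undup mem_cat; case: (eqVneq (a (kernel_pair x y)) 0) => [a0|/Ht->//].
  case: (eqVneq (b (kernel_pair x y)) 0) => [b0|/Ht'->]; last by rewrite orbT.
  have -> : (a - b)%R (kernel_pair x y) = a (kernel_pair x y) - b (kernel_pair x y) by [].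
  by rewrite a0 b0 subrr eqxx.
Qed.

Lemma kernel_operator_delta a D (x y : pts D) : finite_range a ->
  kernel_operator a (delta y) x = a (kernel_pair x y).
Proof.
move=> fa; rewrite kernel_operatorE// (@fsum_seq _ _ _ _ [:: y])//.
  by rewrite big_seq1 deltaE eqxx mulr1.
move=> z _ h; rewrite inE; apply: contraNT h => /negbTE zy.
by rewrite deltaE zy mulr0.
Qed.

Lemma kernel_norm_le a (e : R) : finite_range a -> 0 <= e -> (kernel_norm a <= e%:E)%E ->
  forall D (u : ell2 R (pts D)), l2norm (kernel_operator a u) <= e * l2norm u.
Proof.
move=> fa e0 H D; apply/opnorm_leP => //; first exact: kernel_operator_linop.
by apply: le_trans H; apply: ereal_sup_ubound; exists D.
Qed.

Section RandomOperator.
Variables (a : @completion R G U K) (A : forall D : Del, ell2 R (pts D) -> ell2 R (pts D)).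
Hypotheses (sa : self_adjoint a) (rep : forall D, represents a (@A D)).

Let fr n : finite_range (a n). Proof. exact/finite_type_range/approx_finite_type. Qed.

Lemma random_linop D : linop (@A D).
Proof. by have [[]] := rep D. Qed.

(** The Cauchy condition is uniform in the Delone set, hence so is the
    approximation of [A] by kernel operators. *)
Lemma random_approx (e : R) : 0 < e -> exists N, forall n, (N <= n)%N ->
  forall D (u : ell2 R (pts D)), l2norm (kernel_operator (a n) u - A u) <= e * l2norm u.
Proof.
move=> e0; have e2 : 0 < e / 2 by rewrite divr_gt0.
have [N HN] := approx_cauchy a e2; exists N => n Nn D u.
have [_ cv] := rep D.
have {}cv : forall e : R, 0 < e -> \forall n \near \oo, forall u : ell2 R (pts D),
    l2norm (kernel_operator (a n) u - A u) <= e * l2norm u.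
  apply/opnorm_cvg0P => // k; apply: linop_sub; last exact: random_linop.
  exact: kernel_operator_linop.
have [N' _ HN'] := cv _ e2; pose m := maxn N N'.
have -> : kernel_operator (a n) u - A u =
    kernel_operator (a n - a m)%R u + (kernel_operator (a m) u - A u).
  by rewrite kernel_operatorB// addrA subrK.
apply: le_trans (l2normD _ _) _; rewrite [e]splitr mulrDl; apply: lerD.
  apply: kernel_norm_le; [exact: finite_rangeB | exact: ltW |].
  by apply/ltW/HN => //; rewrite leq_maxl.
by apply: HN'; rewrite /= leq_maxr.
Qed.

Lemma random_bounded : exists2 M : R, 0 <= M &
  forall D (u : ell2 R (pts D)), l2norm (A u) <= M * l2norm u.
Proof.
have [N HN] := random_approx ltr01.
have [c c0 Hc] := kernel_operator_exists (fr N).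
exists (c + 1); first by rewrite addr_ge0.
move=> D u; rewrite -(subKr (kernel_operator (a N) u) (A u)) mulrDl.
by apply: le_trans (l2normB _ _) _; apply: lerD; [have [] := Hc D u | exact: HN].
Qed.

(** The matrix entries of [A] are limits of those of the kernels [a n], whose
    distance to their adjoints tends to 0. *)
Lemma random_hermitian D (x y : pts D) :
  (A (delta y) : ell2 R (pts D)) x = conjc ((A (delta x) : ell2 R (pts D)) y).
Proof.
apply/eqP; rewrite -subr_eq0 -normc_eq0; apply/eqP.
apply/eqP; rewrite eq_le normc_ge0 andbT; apply/ler_addgt0Pr => e e0; rewrite add0r.
have e3 : 0 < e / 3 by rewrite divr_gt0.
have [N HN] := random_approx e3.
have sa' : forall e : R, 0 < e -> \forall n \near \oo,
    (kernel_norm (a n - kernel_adjoint (a n))%R < e%:E)%E.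
  move=> d d0.
  have nb : nbhs (0%E : \bar R) [set x | (x < d%:E)%E].
    by apply: open_nbhs_nbhs; split; [exact: open_ereal_lt_ereal | rewrite /= lte_fin].
  exact: (sa nb).
have [N' _ HN'] := sa' _ e3; pose n := maxn N N'.
have ap (x' y' : pts D) : normc ((A (delta y') : ell2 R (pts D)) x' - a n (kernel_pair x' y')) <= e / 3.
  rewrite -kernel_operator_delta// -ell2B; apply: le_trans (l2norm_coord _ _) _.
  rewrite l2norm_distC; have := HN n (leq_maxl _ _) D (delta y').
  by rewrite l2norm_delta mulr1.
have ad : normc (a n (kernel_pair x y) - conjc (a n (kernel_pair y x))) <= e / 3.
  have fd : finite_range (a n - kernel_adjoint (a n))%R.
    by apply: finite_rangeB => //; exact: finite_range_adjoint.
  have -> : a n (kernel_pair x y) - conjc (a n (kernel_pair y x)) =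
      (a n - kernel_adjoint (a n))%R (kernel_pair x y).
    rewrite [RHS]/=; congr (_ - conjc (a n _)); exact: val_inj.
  rewrite -(kernel_operator_delta x y fd); apply: le_trans (l2norm_coord _ _) _.
  have := kernel_norm_le fd (ltW e3) (ltW (HN' n (leq_maxr _ _))) (delta y).
  by rewrite l2norm_delta mulr1.
set Axy := (A (delta y) : ell2 R (pts D)) x; set Ayx := (A (delta x) : ell2 R (pts D)) y.
have -> : Axy - conjc Ayx = (Axy - a n (kernel_pair x y)) +
    (a n (kernel_pair x y) - conjc (a n (kernel_pair y x))) - conjc (Ayx - a n (kernel_pair y x)).
  by rewrite rmorphB /=; ring.
have -> : e = e / 3 + e / 3 + e / 3 by field.
apply: le_trans (le_normcD _ _) _; rewrite normcN normc_conj; apply: lerD; last exact: ap.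
by apply: le_trans (le_normcD _ _) _; apply: lerD => //; exact: ap.
Qed.

(** Symmetry holds on multiples of basis vectors by [random_hermitian], and extends
    to each argument in turn by [ell2_dense]. *)
Lemma random_symop D : symop (@A D).
Proof.
have [M M0 HM] := random_bounded; have L := @random_linop D.
have ZA (c : C) (x : pts D) : A (c *: delta x) = c *: A (delta x) by exact: linopZ.
have dd (c d : C) (x y : pts D) : redot (A (c *: delta x)) (d *: delta y) =
    redot (c *: delta x) (A (d *: delta y)).
  rewrite !ZA redot_delta redotC redot_delta !ell2Z random_hermitian.
  by case: c d (A (delta y) x) => [c1 c2] [d1 d2] [w1 w2] /=; ring.
have bd (u v : ell2 R (pts D)) : `|redot (A u) v - redot u (A v)| <= 2 * M * l2norm v * l2norm u.
  apply: le_trans (ler_normB _ _) _.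
  have h1 := redot_CSabs (A u) v; have h2 := redot_CSabs u (A v).
  have h3 := ler_wpM2r (l2norm_ge0 v) (HM D u); have h4 := ler_wpM2l (l2norm_ge0 u) (HM D v).
  by lra.
move=> u v; apply/eqP; rewrite -subr_eq0; apply/eqP.
apply: (@ell2_dense _ _ (fun u => redot (A u) v - redot u (A v)) (2 * M * l2norm v)).
- by move=> u1 u2; rewrite (linopD L) !redotDl opprD addrACA.
- by move=> w; exact: bd.
move=> c x.
apply: (@ell2_dense _ _ (fun v => redot (A (c *: delta x)) v - redot (c *: delta x) (A v))
  (2 * M * l2norm (c *: delta x : ell2 R (pts D)))).
- by move=> u1 u2; rewrite (linopD L) !redotDr opprD addrACA.
- by move=> w; apply: le_trans (bd _ _) _; rewrite mulrAC.
by move=> d y; rewrite dd subrr.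
Qed.

End RandomOperator.

End KernelOperators.

(** * Continuity of the local density of states *)

Section KernelContinuity.
Context {R : realType} {G : topGroupType} (U K : set G).
Hypotheses (hausG : hausdorff_space G) (lcG : locally_compact [set: G]).
Hypotheses (openU : open U) (U1 : U 1%g).
Local Notation Del := (Delone U K).
Local Notation C := R[i].
Local Notation normc := (@Normc.normc R).
Local Notation dom := (@kernel_domain G U K).
Implicit Types (g a : dom -> C) (D : Del).

Definition kernel_set (p : dom) : Del := (set_val p).1.2.

Definition kernel_row (p : dom) : pts (kernel_set p) :=
  exist (fun x => x \in pts (kernel_set p)) (set_val p).1.1 (mem_set (set_mem (valP p)).1).

Definition kernel_col (p : dom) : pts (kernel_set p) :=
  exist (fun x => x \in pts (kernel_set p)) (set_val p).2 (mem_set (set_mem (valP p)).2).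

(** Extension of a kernel by zero, so that it can be evaluated without
    membership proofs. *)
Definition kernel_ext g (q : G * Del * G) : C :=
  if pselect (kernel_domain q) is left h then g (exist _ q (mem_set h)) else 0.

Lemma kernel_extE g (p : dom) : kernel_ext g (set_val p) = g p.
Proof.
rewrite /kernel_ext; case: pselect => [h|]; last by case; exact: set_valP.
by congr g; exact: val_inj.
Qed.

Lemma kernel_ext_pair g D (x y : pts D) :
  kernel_ext g (set_val x, D, set_val y) = g (kernel_pair x y).
Proof. by rewrite -kernel_extE. Qed.

Lemma kernel_ext0 g q : ~ kernel_domain q -> kernel_ext g q = 0.
Proof. by rewrite /kernel_ext; case: pselect. Qed.

(** Along points of the kernel domain only: the extension by zero is in general
    discontinuous at the boundary of this closed set. *)
Lemma kernel_ext_cvg g (q : G * Del * G) : continuous g -> dom q ->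
  kernel_ext g @ within dom (nbhs q) --> kernel_ext g q.
Proof.
move=> cg dq; pose p : dom := exist _ q (mem_set dq).
have -> : kernel_ext g q = g p by rewrite -[q]/(set_val p) kernel_extE.
apply/cvgC_normP => e e0; have /cvgC_normP/(_ e e0)[_ [[W oW <-] /= Wp] HW] := cg p.
suff : \forall x \near q, dom x -> normc (g p - kernel_ext g x) < e by [].
apply: filterS (open_nbhs_nbhs (conj oW Wp)) => x Wx dx.
pose p' : dom := exist _ x (mem_set dx).
have h : normc (g p - g p') < e by exact: HW p' Wx.
by rewrite -[x]/(set_val p') kernel_extE.
Qed.

(** The kernel of a family of operators, on the same domain as the kernels of
    finite type. *)
Definition matrix_coef (T : forall D, ell2 R (pts D) -> ell2 R (pts D)) : dom -> C :=
  fun p => T (kernel_set p) (delta (kernel_col p)) (kernel_row p).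

Lemma matrix_coefE (T : forall D, ell2 R (pts D) -> ell2 R (pts D)) D (x y : pts D) :
  matrix_coef T (kernel_pair x y) = T D (delta y) x.
Proof.
rewrite /matrix_coef.
have -> : kernel_row (kernel_pair x y) = x by exact: val_inj.
by have -> : kernel_col (kernel_pair x y) = y by exact: val_inj.
Qed.

Lemma uniform_limit_continuous (X : topologicalType) (f : X -> C) :
  (forall e : R, 0 < e -> exists2 h : X -> C, continuous h & forall x, normc (f x - h x) <= e) ->
  continuous f.
Proof.
move=> H x; apply/cvgC_normP => e e0.
have e4 : 0 < e / 4 by rewrite divr_gt0.
have [h ch fh] := H _ e4; have /cvgC_normP/(_ _ e4) := ch x.
apply: filterS => y hxy.
have -> : f x - f y = (f x - h x) + (h x - h y) - (f y - h y) by ring.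
have -> : e = e / 4 + e / 4 + e / 4 + e / 4 by field.
apply: le_lt_trans (le_normcD _ _) _; rewrite normcN.
apply: (@le_lt_trans _ _ (normc (f x - h x) + normc (h x - h y) + normc (f y - h y))).
  by rewrite lerD2r le_normcD.
have := fh x; have := fh y; lra.
Qed.

Lemma continuous_sum (X : topologicalType) (J : Type) (s : seq J) (f : J -> X -> C) :
  (forall j, continuous (f j)) -> continuous (fun x => \sum_(j <- s) f j x).
Proof.
move=> cf; elim: s => [|j s IH] x.
  have -> : (fun x => \sum_(j <- [::]) f j x) = (fun=> 0) by apply/funext => y; rewrite big_nil.
  exact: cvg_cst.
have -> : (fun x => \sum_(i <- j :: s) f i x) = (fun x => f j x + \sum_(i <- s) f i x).
  by apply/funext => y; rewrite big_cons.
by apply: cvgD; [exact: cf | exact: IH].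
Qed.

(** A matrix coefficient is bounded by the operator norm, so that uniform
    approximation of operators gives uniform approximation of kernels. *)
Lemma matrix_coef_limit (T : forall D, ell2 R (pts D) -> ell2 R (pts D)) :
  (forall e : R, 0 < e -> exists2 S : forall D, ell2 R (pts D) -> ell2 R (pts D),
     continuous (matrix_coef S) &
     forall D (u : ell2 R (pts D)), l2norm (T D u - S D u) <= e * l2norm u) ->
  continuous (matrix_coef T).
Proof.
move=> H; apply: uniform_limit_continuous => e e0; have [S cS HS] := H e e0.
exists (matrix_coef S) => // p; rewrite /matrix_coef -ell2B.
apply: le_trans (l2norm_coord _ _) _; apply: le_trans (HS _ _) _.
by rewrite l2norm_delta mulr1.
Qed.

Lemma set_val_cvg (p : dom) : (fun q : dom => set_val q) @ p --> set_val p.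
Proof. exact: initial_continuous. Qed.

Lemma kernel_set_cvg (p : dom) : kernel_set @ p --> kernel_set p.
Proof.
have c1 : (fun q : dom => (set_val q).1) @ p --> (set_val p).1.
  by apply: (cvg_comp _ _ (@set_val_cvg p)); exact: cvg_fst.
by apply: (cvg_comp _ _ c1); exact: cvg_snd.
Qed.

Lemma kernel_row_cvg (p : dom) : (fun q : dom => (set_val q).1.1) @ p --> (set_val p).1.1.
Proof.
have c1 : (fun q : dom => (set_val q).1) @ p --> (set_val p).1.
  by apply: (cvg_comp _ _ (@set_val_cvg p)); exact: cvg_fst.
by apply: (cvg_comp _ _ c1); exact: cvg_fst.
Qed.

Lemma kernel_col_cvg (p : dom) : (fun q : dom => (set_val q).2) @ p --> (set_val p).2.
Proof. by apply: (cvg_comp _ _ (@set_val_cvg p)); exact: cvg_snd. Qed.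

Lemma fsum_pts D (f : G -> C) :
  \sum_(z \in [set: pts D]) f (set_val z) = \sum_(z \in pts D) f z.
Proof.
rewrite -(@fsbig_image _ _ _ _ _ [set: pts D] set_val f); last by move=> x y _ _; exact: val_inj.
suff -> : range (@set_val G (pts D)) = pts D by [].
apply/seteqP; split=> [_ [z _ <-]|z Dz]; first exact: set_valP.
by exists (exist _ z (mem_set Dz)).
Qed.

Lemma within_dom_cvg (T : topologicalType) (t : T) (W : set T) (f : T -> G * Del * G) :
  f @ t --> f t -> (forall s, W s -> dom (f s)) ->
  f @ within W (nbhs t) --> within dom (nbhs (f t)).
Proof.
move=> ft Wd B HB.
have : \forall s \near t, dom (f s) -> B (f s) by exact: (ft _ HB).
by apply: filterS => s h Ws; exact/h/Wd.
Qed.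

Lemma within_cvg (T Y : topologicalType) (t : T) (W : set T) (f : T -> Y) (y : Y) :
  f @ t --> y -> f @ within W (nbhs t) --> y.
Proof.
move=> ft B yB; have : \forall s \near t, B (f s) by exact: ft yB.
by apply: filterS => s Bs _.
Qed.

(** The entry at [(x, D, y)] of the product is the sum over the points [z] of [D] of
    [a(x, D, z) T(z, D, y)], whose support is in a fixed compact set for [x] near
    a given point because [a] has finite range; [local_sum_cvg] applies. *)
Lemma matrix_coef_comp a (T : forall D, ell2 R (pts D) -> ell2 R (pts D)) :
  finite_range a -> continuous a -> continuous (matrix_coef T) ->
  continuous (matrix_coef (fun D u => kernel_operator a (T D u))).
Proof.
move=> fa ca cT p0.
pose c (p : dom) (z : G) := kernel_ext a ((set_val p).1.1, kernel_set p, z) *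
  kernel_ext (matrix_coef T) (z, kernel_set p, (set_val p).2).
have cE : matrix_coef (fun D u => kernel_operator a (T D u)) =
    (fun p => \sum_(z \in pts (kernel_set p)) c p z).
  apply/funext => p; rewrite /matrix_coef kernel_operatorE// -fsum_pts.
  apply: eq_fsbigr => z _; rewrite /c -[(set_val p).1.1]/(set_val (kernel_row p)).
  rewrite -[(set_val p).2]/(set_val (kernel_col p)) !kernel_ext_pair.
  by rewrite matrix_coefE.
rewrite cE; have [_ [L [cL LV aL]]] := fa.
have [V [cV xV _]] := locally_compact_inside hausG lcG (filterT : nbhs (set_val p0).1.1 setT).
pose LL := [set (q.1 * q.2)%g | q in V `*` L].
have supp p z : V (set_val p).1.1 -> c p z != 0 -> LL z.
  move=> Vx cz; pose q := ((set_val p).1.1, kernel_set p, z).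
  have dq : dom q.
    apply: contrapT => nd; move/eqP: cz; apply; rewrite /c kernel_ext0//; exact: mul0r.
  exists ((set_val p).1.1, ((set_val p).1.1^-1 * z)%g); last by rewrite /= mulVKg.
  split=> //=; apply: contrapT => nL; move/eqP: cz; apply; rewrite /c.
  pose p' : dom := exist _ q (mem_set dq).
  by rewrite -[X in kernel_ext a X]/(set_val p') kernel_extE aL// mul0r.
apply: (@local_sum_cvg _ _ U K hausG openU U1 _ (nbhs p0) (nbhs_filter p0) _ _ _ _ LL).
- exact: kernel_set_cvg.
- apply: continuous_compact; last exact: compact_setX.
  by apply: continuous_subspaceT => q; exact: mulg_continuous.
- have h : \forall p \near p0, V (set_val p).1.1 by exact: (@kernel_row_cvg p0 V xV).
  by apply: filterS h => p Vp z _; exact: supp.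
- by move=> z _; apply: supp; exact: nbhs_singleton xV.
move=> z Dz e e0.
pose W := [set q : dom * G | pts (kernel_set q.1) q.2].
suff : (fun q : dom * G => c q.1 q.2) @ within W (nbhs (p0, z)) --> c p0 z.
  move=> /cvgC_normP/(_ e e0) H.
  have : \forall q \near (p0, z), W q -> normc (c p0 z - c q.1 q.2) < e by exact: H.
  by apply: filterS => -[p z'] /= h Wq; rewrite normcB; exact: h.
have c1 : (fun q : dom * G => q.1) @ (p0, z) --> p0 by exact: cvg_fst.
have c2 : (fun q : dom * G => q.2) @ (p0, z) --> z by exact: cvg_snd.
have cs : (fun q : dom * G => kernel_set q.1) @ (p0, z) --> kernel_set p0.
  exact: (cvg_comp _ _ c1 (@kernel_set_cvg p0)).
have cr : (fun q : dom * G => (set_val q.1).1.1) @ (p0, z) --> (set_val p0).1.1.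
  exact: (cvg_comp _ _ c1 (@kernel_row_cvg p0)).
have cc : (fun q : dom * G => (set_val q.1).2) @ (p0, z) --> (set_val p0).2.
  exact: (cvg_comp _ _ c1 (@kernel_col_cvg p0)).
apply: cvgM.
  apply: (cvg_comp _ _ (@within_dom_cvg _ (p0, z) W
    (fun q => ((set_val q.1).1.1, kernel_set q.1, q.2)) _ _)).
  - exact: (cvg_pair (cvg_pair cr cs) c2).
  - by move=> q Wq; split=> //=; exact: (set_mem (valP q.1)).1.
  - by apply: kernel_ext_cvg => //; split=> //=; exact: (set_mem (valP p0)).1.
apply: (cvg_comp _ _ (@within_dom_cvg _ (p0, z) W
  (fun q => (q.2, kernel_set q.1, (set_val q.1).2)) _ _)).
- exact: (cvg_pair (cvg_pair c2 cs) cc).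
- by move=> q Wq; split=> //=; exact: (set_mem (valP q.1)).2.
- by apply: kernel_ext_cvg => //; split=> //=; exact: (set_mem (valP p0)).2.
Qed.

(** Two points of a Delone set that are close to one point lie in a common
    translate of [U], hence coincide: the identity kernel is locally constant. *)
Lemma matrix_coef_id : continuous (matrix_coef (fun D (u : ell2 R (pts D)) => u)).
Proof.
move=> p0; apply/(cvgC_normP (nbhs_filter p0)) => e e0.
have E p : matrix_coef (fun D (u : ell2 R (pts D)) => u) p =
    ((set_val p).1.1 == (set_val p).2)%:R by [].
have ceq : \forall p \near p0, ((set_val p).1.1 == (set_val p).2) =
    ((set_val p0).1.1 == (set_val p0).2).
  have [E0|N0] := eqVneq (set_val p0).1.1 (set_val p0).2.
    have nU : nbhs (set_val p0).1.1 (translate (set_val p0).1.1 U).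
      apply: open_nbhs_nbhs; split; first exact: translate_open.
      by exists 1%g => //; rewrite mulg1.
    have h1 : \forall p \near p0, translate (set_val p0).1.1 U (set_val p).1.1.
      exact: (@kernel_row_cvg p0 _ nU).
    rewrite E0 in nU.
    have h2 : \forall p \near p0, translate (set_val p0).2 U (set_val p).2.
      exact: (@kernel_col_cvg p0 _ nU).
    apply: filterS2 h1 h2 => p Ux Uy; rewrite -E0 in Uy; apply/eqP.
    have [Dx Dy] := set_mem (valP p).
    exact: (pts_unique Ux Uy Dx Dy).
  move: hausG; rewrite open_hausdorff => /(_ _ _ N0)[[V W] /= [/set_mem Vx /set_mem Wy] [oV oW /eqP VW]].
  have h1 : \forall p \near p0, V (set_val p).1.1.
    exact: (@kernel_row_cvg p0 _ (open_nbhs_nbhs (conj oV Vx))).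
  have h2 : \forall p \near p0, W (set_val p).2.
    exact: (@kernel_col_cvg p0 _ (open_nbhs_nbhs (conj oW Wy))).
  apply: filterS2 h1 h2 => p Vp Wp; apply/negP => /eqP E0.
  suff : (set0 : set G) (set_val p).1.1 by [].
  by rewrite -VW; split=> //; rewrite E0.
by apply: filterS ceq => p; rewrite !E => ->; rewrite subrr Normc.normc0.
Qed.

Section RandomContinuity.
Variables (a : @completion R G U K) (A : forall D : Del, ell2 R (pts D) -> ell2 R (pts D)).
Hypotheses (sa : self_adjoint a) (rep : forall D, represents a (@A D)).

Lemma random_comp_continuous (T : forall D, ell2 R (pts D) -> ell2 R (pts D)) (M : R) : 0 <= M ->
  (forall D (u : ell2 R (pts D)), l2norm (T D u) <= M * l2norm u) ->
  continuous (matrix_coef T) -> continuous (matrix_coef (fun D u => @A D (T D u))).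
Proof.
move=> M0 HM cT; apply: matrix_coef_limit => e e0.
have M1 : 0 < M + 1 by rewrite ltr_wpDl.
have [N HN] := random_approx openU U1 rep (divr_gt0 e0 M1).
exists (fun D u => kernel_operator (a N) (T D u)).
  have [ca _ _ _] := approx_finite_type a N.
  by apply: matrix_coef_comp => //; exact: finite_type_range (approx_finite_type a N).
move=> D u; rewrite l2norm_distC; apply: le_trans (HN N (leqnn N) D _) _.
rewrite mulrAC ler_pdivrMr// -mulrA ler_wpM2l ?(ltW e0)// mulrC.
by apply: le_trans (HM _ _) _; rewrite ler_wpM2r ?l2norm_ge0// lerDl ler01.
Qed.

Lemma random_iter_continuous k : continuous (matrix_coef (fun D => iter k (@A D))).
Proof.
have [M M0 HM] := random_bounded openU U1 rep.
have Hk j D (u : ell2 R (pts D)) : l2norm (iter j (@A D) u) <= M ^+ j * l2norm u.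
  elim: j => [|j IH]; first by rewrite expr0 mul1r.
  rewrite iterS exprS -mulrA; apply: le_trans (HM _ _) _; exact: ler_wpM2l.
elim: k => [|k IH]; first exact: matrix_coef_id.
exact: (random_comp_continuous (exprn_ge0 k M0) (fun D u => Hk k D u) IH).
Qed.

Lemma random_poly_continuous (p : {poly C}) :
  continuous (matrix_coef (fun D => operator_poly p (@A D))).
Proof.
have -> : matrix_coef (fun D => operator_poly p (@A D)) =
    (fun q => \sum_(i < size p) p`_i * matrix_coef (fun D => iter i (@A D)) q).
  apply/funext => q; rewrite /matrix_coef /operator_poly ell2_sum.
  by apply: eq_bigr => i _; rewrite ell2Z.
apply: continuous_sum => i q.
exact: (cvgM (cvg_cst p`_i) (@random_iter_continuous i q)).
Qed.

(** The matrix coefficients of [phi(A_D)] are jointly continuous, being uniform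
    limits of those of polynomials in [A_D], which in turn are uniform limits of
    finite sums of products of kernel values. *)
Lemma random_calculus_continuous (phi : R -> C) : continuous phi ->
  continuous (matrix_coef (fun D => functional_calculus phi (@A D))).
Proof.
move=> cphi; have [M M0 HM] := random_bounded openU U1 rep.
have M1 : 0 < M + 1 by rewrite ltr_wpDl.
have HM1 D (u : ell2 R (pts D)) : l2norm (A u) <= (M + 1) * l2norm u.
  by apply: le_trans (HM D u) _; rewrite ler_wpM2r ?l2norm_ge0// lerDl.
have [p Hp] := weierstrass cphi M1.
have L D := @random_linop R G U K a A rep D.
have sT D := @random_symop R G U K openU U1 a A sa rep D.
apply: matrix_coef_limit => e e0; have [N _ HN] := Hp e e0.
exists (fun D => operator_poly (p N) (@A D)); first exact: random_poly_continuous.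
move=> D u; rewrite l2norm_distC.
apply: (functional_calculus_dist (L D) (sT D) (ltW M1) (HM1 D) (ltW e0)).
  exact: (functional_calculus_exists (L D) (sT D) (ltW M1) (HM1 D) Hp).
by move=> t tM; apply/ltW/HN => /=.
Qed.

(** The density is the sum over the points of [D] of [rho] times the diagonal
    matrix coefficients of [phi(A_D)], a local sum because [rho] has compact
    support. *)
Lemma density_continuous (rho : G -> R) (phi : R -> C) : Cc 0 rho -> continuous phi ->
  continuous (fun D : Del => \sum_(x \in [set: pts D]) (rho (set_val x))%:C *
    l2dot (delta x) (functional_calculus phi (@A D) (delta x))).
Proof.
move=> [crho srho] cphi D0.
pose g := matrix_coef (fun D => functional_calculus phi (@A D)).
have cg : continuous g by exact: random_calculus_continuous.
pose c D z := (rho z)%:C * kernel_ext g (z, D, z).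
rewrite (_ : (fun D => _) = (fun D => \sum_(z \in pts D) c D z)); last first.
  apply/funext => D; rewrite -fsum_pts; apply: eq_fsbigr => z _.
  by rewrite /c kernel_ext_pair /g matrix_coefE l2dot_delta.
have supp D z : c D z != 0 -> closure [set x | rho x <> 0] z.
  move=> cz; apply: subset_closure => /= r0; move/eqP: cz; apply.
  by rewrite /c r0 mul0r.
apply: (@local_sum_cvg _ _ U K hausG openU U1 _ (nbhs D0) (nbhs_filter D0) _ _ _ _
  (closure [set x | rho x <> 0])).
- exact: cvg_id.
- exact: srho.
- by apply: nearW => D z _; exact: supp.
- by move=> z _; exact: supp.
move=> z Dz e e0.
pose W := [set q : Del * G | pts q.1 q.2].
suff : (fun q : Del * G => c q.1 q.2) @ within W (nbhs (D0, z)) --> c D0 z.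
  move=> /cvgC_normP/(_ e e0) H.
  have : \forall q \near (D0, z), W q -> normc (c D0 z - c q.1 q.2) < e by exact: H.
  by apply: filterS => -[p z'] /= h Wq; rewrite normcB; exact: h.
have c1 : (fun q : Del * G => q.1) @ (D0, z) --> D0 by exact: cvg_fst.
have c2 : (fun q : Del * G => q.2) @ (D0, z) --> z by exact: cvg_snd.
apply: cvgM.
  have h : (fun q : Del * G => (rho q.2)%:C) @ (D0, z) --> (rho z)%:C.
    apply: (@cvg_comp _ _ _ _ (fun x => (rho x)%:C) _ _ _ c2).
    by apply: cvg_ReIm => /=; [exact: crho | exact: cvg_cst].
  exact: within_cvg h.
apply: (cvg_comp _ _ (@within_dom_cvg _ (D0, z) W (fun q => (q.2, q.1, q.2)) _ _)).
- exact: (cvg_pair (cvg_pair c2 c1) c2).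
- by move=> q Wq; split.
- by apply: kernel_ext_cvg => //; split.
Qed.

End RandomContinuity.

End KernelContinuity.

(** * Limits of invariant measures *)

Lemma ultra_fmap (T S : Type) (F : set_system T) (f : T -> S) :
  UltraFilter F -> UltraFilter (f @ F).
Proof.
move=> UF; have PF : ProperFilter F by exact: ultra_proper.
have PfF : ProperFilter (f @ F) by apply: fmap_proper_filter.
apply: Build_UltraFilter => H PH FH; apply/seteqP; split=> // A HA.
have [//|FnA] := in_ultra_setVsetC (f @^-1` A) UF.
have HnA : H (~` A) by apply: FH.
by have [x []] := @filter_ex _ H PH _ (filterI HA HnA).
Qed.

(** The image of an ultrafilter in a compact interval is an ultrafilter, which
    converges. *)
Lemma ultra_bounded_cvg (R : realType) (T : Type) (F : set_system T) (u : T -> R) (M : R) :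
  UltraFilter F -> (forall t, `|u t| <= M) -> cvg (u @ F).
Proof.
move=> UF uM; have := @segment_compact R (- M) M.
rewrite compact_ultra => /(_ (u @ F) (ultra_fmap u UF)) [].
  have FF : ProperFilter F by exact: ultra_proper.
  have : F (u @^-1` `[- M, M]) by apply: filterE => t; rewrite /= in_itv /= -ler_norml.
  by [].
by move=> x [_ ux]; apply/cvg_ex; exists x.
Qed.

Lemma continuous_borel_map (X Y : ptopologicalType) (f : X -> Y) :
  continuous f -> measurable_fun [set: borel X] (f : borel X -> borel Y).
Proof.
move=> cf.
apply: (@measurability _ _ (borel X) (borel Y) setT f (@open Y)) => [//|_ [V oV <-]].
rewrite setTI; apply: sub_sigma_algebra; apply: open_comp => // x _; exact: cf.
Qed.

Lemma eq_measure_mean (R : realType) (X : ptopologicalType) (mu nu : probability (borel X) R)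
    (f : X -> R) : (forall B : set (borel X), measurable B -> mu B = nu B) ->
  mean mu f = mean nu f.
Proof.
move=> E; rewrite /mean /Rintegral; congr fine; apply: eq_measure_integral => B mB _.
exact: E.
Qed.

Section Phase.
Context {R : realType} {G : topGroupType} (U K : set G).
Hypotheses (hausG : hausdorff_space G) (lcG : locally_compact [set: G]).
Hypotheses (openU : open U) (compactK : compact K).
Local Notation Del := (Delone U K).
Implicit Types (Om : invariant_sets U K).

Definition phase_val Om (w : phase Om) : Del := set_val w.

Lemma phase_val_continuous Om : continuous (@phase_val Om).
Proof. exact: initial_continuous. Qed.

Lemma phase_valP Om (w : phase Om) : cset (set_val Om) (phase_val w).
Proof. exact: set_valP. Qed.

Lemma phase_compact Om : compact [set: phase Om].
Proof.
apply: set_type_compact; apply: (subclosed_compact _ (Delone_compact hausG openU compactK)) => //.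
exact: cset_closed.
Qed.

Lemma phase_hausdorff Om : hausdorff_space (phase Om).
Proof.
apply: (continuous_injective_hausdorff (Delone_hausdorff hausG lcG) (@phase_val_continuous Om)).
exact: val_inj.
Qed.

Lemma phase_act_continuous Om (g : G) : continuous (@phase_act G U K Om g).
Proof.
move=> w B [_ [[V oV <-] /= Vw] VB].
have c1 : (fun w' : phase Om => Delone_act g (phase_val w')) @ w --> Delone_act g (phase_val w).
  apply: (@continuous_comp _ _ _ (@phase_val Om) (Delone_act g)).
    exact: phase_val_continuous.
  exact: Delone_act_continuous.
have : \forall w' \near w, V (Delone_act g (phase_val w')).
  exact: (c1 _ (open_nbhs_nbhs (conj oV Vw))).
by apply: filterS => w' Vw'; exact: VB.
Qed.

Lemma phase_actK Om (g h : G) : (g * h)%g = 1%g ->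
  cancel (@phase_act G U K Om h) (@phase_act G U K Om g).
Proof.
move=> gh w; apply: val_inj; apply: val_inj; apply: closed_set_inj => /=.
rewrite translateM gh translateE invg1; apply/seteqP; split=> x /=; by rewrite mul1g.
Qed.

Lemma mean_invariant Om (mu : probability (borel (phase Om)) R) (g : G) (f : phase Om -> R) :
  invariant_measure mu -> continuous f -> mean mu (f \o phase_act g) = mean mu f.
Proof.
move=> imu cf; have cact := @phase_act_continuous Om g.
have mact := continuous_borel_map cact.
rewrite /mean /Rintegral; congr fine.
have cfg : continuous (f \o phase_act g).
  by move=> w; apply: continuous_comp; [exact: cact | exact: cf].
pose h : borel (phase Om) -> borel (phase Om) := phase_act g.
rewrite [RHS](eq_measure_integral (pushforward mu h)); last first.
  by move=> B mB _; rewrite /pushforward; exact/esym/imu.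
rewrite integral_pushforward//.
- by apply/measurable_realfun.measurable_EFinP; exact: continuous_borel_measurable.
- rewrite preimage_setT; exact: (continuous_integrable (@phase_compact Om) mu cfg).
Qed.

(** The Tietze extension theorem for the closed set of all points of the
    system. *)
Lemma phase_extension Om (h : phase Om -> R) : continuous h ->
  exists2 E : Del -> R, continuous E & forall w, E (phase_val w) = h w.
Proof.
move=> ch; have [M M0 hM] := compact_continuous_bounded (@phase_compact Om) ch.
pose A := cset (set_val Om).
pose f : Del -> R := 'valL_ 0 (h : A -> R).
have fE (w : phase Om) : f (phase_val w) = h w.
  by have := congr1 (fun k => k w) (valLK 0 (h : A -> R)).
have normalDel : normal_space Del.
  by apply: compact_normal; [exact: Delone_hausdorff | exact: Delone_compact].
have cA : closed A by exact: cset_closed.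
have wf : {within A, continuous f} by apply/subspace_valL_continuousP'.
have fM D : A D -> `|f D| <= M.
  by move=> AD; rewrite -[D]/(phase_val (exist _ D (mem_set AD) : phase Om)) fE.
have [E [EA cE _]] := continuous_bounded_extension normalDel cA M0 wf fM.
exists E => // w; rewrite -fE; apply/esym/EA; apply/mem_set; exact: phase_valP.
Qed.

Section Limit.
Variables (Om : invariant_sets U K) (Om_ : nat -> invariant_sets U K).
Variable mu_ : forall l, probability (borel (phase (Om_ l))) R.
Hypothesis invariant_mu_ : forall l, invariant_measure (mu_ l).
Hypothesis Om_cvg : Om_ @ \oo --> Om.
Implicit Types f : Del -> R.

Definition system_mean l f : R := mean (mu_ l) (f \o @phase_val (Om_ l)).

Let contval (Om' : invariant_sets U K) f : continuous f -> continuous (f \o @phase_val Om').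
Proof.
by move=> cf w; apply: continuous_comp; [exact: phase_val_continuous | exact: cf].
Qed.

Let DelC : compact [set: Del] := Delone_compact hausG openU compactK.

(** The set where a function vanishing on the limit system is at least [e] in
    modulus is compact, hence eventually missed. *)
Lemma system_mean_vanish f : continuous f -> (forall w : phase Om, f (phase_val w) = 0) ->
  system_mean l f @[l --> \oo] --> 0.
Proof.
move=> cf f0; apply/cvgr0Pnorm_le => e e0.
pose C := [set D | e <= `|f D|].
have clC : closed C.
  apply: (@closed_comp _ _ (fun D => `|f D|) [set x | e <= x]); last exact: closed_ge.
  by move=> D _; exact: (cvg_norm (cf D)).
have cC : compact C by apply: (subclosed_compact clC DelC).
have miss : C `&` carrier Om = set0.
  apply/seteqP; split=> // D [/= eD OmD]; move: eD.
  have fD : f D = 0 by exact: (f0 (exist _ D (mem_set OmD))).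
  by rewrite /C /= fD normr0 leNgt e0.
have near_l := Om_cvg (near_miss cC miss).
near=> l.
have missl : C `&` carrier (Om_ l) = set0 by near: l.
apply: (mean_norm (@phase_compact (Om_ l))); first exact: contval.
move=> w /=; rewrite leNgt; apply/negP => ew.
have : (C `&` carrier (Om_ l)) (phase_val w) by split; [exact: ltW | exact: phase_valP].
by rewrite missl.
Unshelve. all: by end_near. Qed.

Variable F : set_system nat.
Hypotheses (UF : UltraFilter F) (ooF : \oo `<=` F).

Let PF : ProperFilter F := @ultra_proper _ _ UF.

Definition limit_mean f : R := lim (system_mean l f @[l --> F]).

Lemma limit_mean_cvg f : continuous f -> system_mean l f @[l --> F] --> limit_mean f.
Proof.
move=> cf; have [M _ fM] := compact_continuous_bounded DelC cf.
apply: (@ultra_bounded_cvg R nat F _ M UF) => l.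
by apply: (mean_norm (@phase_compact (Om_ l))) => [|w /=]; [exact: contval | exact: fM].
Qed.

Lemma limit_meanP f (a : R) : system_mean l f @[l --> F] --> a -> limit_mean f = a.
Proof. by move=> fa; exact: (cvg_lim (@Rhausdorff R) fa). Qed.

Lemma limit_meanD f g : continuous f -> continuous g ->
  limit_mean (fun D => f D + g D) = limit_mean f + limit_mean g.
Proof.
move=> cf cg; apply: limit_meanP.
rewrite (_ : (fun l => _) = (fun l => system_mean l f + system_mean l g)); last first.
  apply/funext => l; exact: (meanD (@phase_compact (Om_ l)) _ (contval cf) (contval cg)).
by apply: cvgD; exact: limit_mean_cvg.
Qed.

Lemma limit_meanZ (c : R) f : continuous f -> limit_mean (fun D => c * f D) = c * limit_mean f.
Proof.
move=> cf; apply: limit_meanP.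
rewrite (_ : (fun l => _) = (fun l => c * system_mean l f)); last first.
  apply/funext => l; exact: (meanZ (@phase_compact (Om_ l)) _ c (contval cf)).
by apply: cvgM; [exact: cvg_cst | exact: limit_mean_cvg].
Qed.

Lemma limit_mean_eq f g : continuous f -> continuous g ->
  (forall w : phase Om, f (phase_val w) = g (phase_val w)) -> limit_mean f = limit_mean g.
Proof.
move=> cf cg fg.
have cfg : continuous (fun D => f D - g D).
  by move=> D; exact: (cvgB (cf D) (cg D)).
have h : system_mean l (fun D => f D - g D) @[l --> F] --> (0 : R).
  apply: cvg_trans (system_mean_vanish cfg _); last by move=> w; rewrite fg subrr.
  by move=> B; exact: ooF.
rewrite -[f](_ : (fun D => (f D - g D) + g D) = f); last first.
  by apply/funext => D; rewrite subrK.
by rewrite limit_meanD// (limit_meanP h) add0r.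
Qed.

(** A continuous function on the limit system is extended to the whole space of
    Delone sets in order to be averaged over the other systems; by
    [limit_mean_eq] the value does not depend on the extension. *)
Lemma limit_probability : exists2 nu : probability (borel (phase Om)) R,
  invariant_measure nu &
  forall f, continuous f -> system_mean l f @[l --> F] --> mean nu (f \o @phase_val Om).
Proof.
have /choice[ext extP] (h : phase Om -> R) : exists E : Del -> R,
    continuous h -> continuous E /\ forall w, E (phase_val w) = h w.
  have [ch|nch] := pselect (continuous h); last by exists (fun=> 0).
  by have [E cE Eh] := phase_extension ch; exists E.
have cext (h : phase Om -> R) (ch : continuous h) := (extP h ch).1.
have extE (h : phase Om -> R) (ch : continuous h) := (extP h ch).2.
pose L h := limit_mean (ext h).
have LE f : continuous f -> L (f \o @phase_val Om) = limit_mean f.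
  move=> cf; have cfv := contval (Om' := Om) cf.
  by apply: limit_mean_eq => // [|w]; [exact: cext | rewrite extE].
have LD (h k : phase Om -> R) : continuous h -> continuous k -> L (fun w => h w + k w) = L h + L k.
  move=> ch ck; have c : continuous (fun D => ext h D + ext k D).
    by move=> D; exact: (cvgD (cext h ch D) (cext k ck D)).
  transitivity (L ((fun D => ext h D + ext k D) \o @phase_val Om)).
    by congr L; apply/funext => w /=; rewrite !extE.
  by rewrite LE// limit_meanD//; exact: cext.
have LZ (c : R) (h : phase Om -> R) : continuous h -> L (fun w => c * h w) = c * L h.
  move=> ch; have cc : continuous (fun D => c * ext h D).
    by move=> D; exact: (cvgM (cvg_cst c) (cext h ch D)).
  transitivity (L ((fun D => c * ext h D) \o @phase_val Om)).
    by congr L; apply/funext => w /=; rewrite !extE.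
  by rewrite LE// limit_meanZ//; exact: cext.
have L0 (h : phase Om -> R) : continuous h -> (forall w, 0 <= h w) -> 0 <= L h.
  move=> ch h0; have c : continuous (fun D => `|ext h D|).
    by move=> D; exact: (cvg_norm (cext h ch D)).
  have -> : L h = L ((fun D => `|ext h D|) \o @phase_val Om).
    by congr L; apply/funext => w /=; rewrite extE// ger0_norm.
  rewrite LE//; apply: (cvgr_to_ge (limit_mean_cvg c)); apply: nearW => l.
  by apply: Rintegral_ge0 => w _ /=.
have L1 : L (fun=> 1) = 1.
  transitivity (L ((fun _ : Del => 1) \o @phase_val Om)); first by [].
  have c1 : continuous (fun _ : Del => 1 : R) by exact: cst_continuous.
  rewrite (LE _ c1).
  apply: limit_meanP; apply: cvg_trans (@cvg_cst _ _ _ F _ : (fun=> 1) @ F --> (1 : R)).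
  by apply: near_eq_cvg; apply: nearW => l; rewrite /= /system_mean mean_cst.
pose nu := riesz_probability (@phase_hausdorff Om) (@phase_compact Om) LD LZ L0 L1.
have Lnu := riesz_representation (@phase_hausdorff Om) (@phase_compact Om) LD LZ L0 L1.
exists nu; last first.
  by move=> f cf; rewrite -Lnu ?LE//; [exact: limit_mean_cvg | exact: contval].
move=> g B _.
rewrite -[LHS]/(riesz_measure L (phase_act g @^-1` B)) -[RHS]/(riesz_measure L B).
apply: (riesz_measure_invariant (h' := phase_act (g^-1)%g)).
- exact: phase_act_continuous.
- exact: phase_act_continuous.
- by apply: phase_actK; rewrite mulVg.
- by apply: phase_actK; rewrite mulgV.
move=> h ch; have c : continuous (ext h \o Delone_act g).
  by move=> D; apply: continuous_comp; [exact: Delone_act_continuous | exact: cext].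
have -> : h \o phase_act g = (ext h \o Delone_act g) \o @phase_val Om.
  by apply/funext => w /=; rewrite -extE.
rewrite LE//; apply: limit_meanP.
apply: cvg_trans (limit_mean_cvg (cext _ ch)).
apply: near_eq_cvg; apply: nearW => l; rewrite /= /system_mean.
have E := mean_invariant g (@invariant_mu_ l) (contval (cext _ ch)).
rewrite -E.
by [].
Qed.

End Limit.

(** Every ultrafilter refining the filter of neighbourhoods of infinity yields
    the only invariant probability measure of the limit system. *)
Lemma system_mean_cvg (Om : invariant_sets U K) (mu : probability (borel (phase Om)) R)
    (Om_ : nat -> invariant_sets U K) (mu_ : forall l, probability (borel (phase (Om_ l))) R)
    (f : Del -> R) :
  uniquely_ergodic R Om -> invariant_measure mu -> (forall l, invariant_measure (mu_ l)) ->
  Om_ @ \oo --> Om -> continuous f ->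
  system_mean mu_ l f @[l --> \oo] --> mean mu (f \o @phase_val Om).
Proof.
move=> [_ uniq] imu imu_ Om_cvg cf; apply/cvgrPdist_lt => e e0.
apply: contrapT => nnear.
pose S := [set l | e <= `|mean mu (f \o @phase_val Om) - system_mean mu_ l f|].
(* If the filter were not proper, the indices would eventually lie outside [S]. *)
have PS : ProperFilter (within S \oo).
  apply: Build_ProperFilter => //; apply: contra_not nnear.
  rewrite /within /= => h; near=> l; rewrite ltNge; apply/negP => Sl.
  by move: (Sl); near: l; apply: filterS h => l h Sl; exact: h.
have [F [UF SF]] := ultraFilterLemma PS.
have ooF : \oo `<=` F.
  by move=> B oB; apply: SF; apply: filterS oB => l Bl _.
have PF : ProperFilter F by exact: ultra_proper.
have FS : F S by apply: SF; exact: withinT.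
have [nu inu nu_cvg] := limit_probability imu_ Om_cvg UF ooF.
have munu : mean mu (f \o @phase_val Om) = mean nu (f \o @phase_val Om).
  by apply: eq_measure_mean => B; exact: uniq.
have /cvgrPdist_lt/(_ e e0) near_nu := nu_cvg f cf.
have [l [Sl]] := filter_ex (filterI FS near_nu).
by rewrite -munu ltNge => /negP.
Unshelve. all: by end_near. Qed.

End Phase.

Theorem corollary2 (R : realType) (G : topGroupType)
    (HausdorffG : hausdorff_space G)
    (locally_compactG : locally_compact [set: G])
    (second_countableG : @second_countable G)
    (unimodularG : unimodular R G)
    (U K : set G) (openU : open U) (U1 : U 1%g) (compactK : compact K)
    (m : {measure set (borel G) -> \bar R}) (haar_m : left_haar_measure m)
    (rho : G -> R) (Cc_rho : Cc 0 rho) (rho_ge0 : forall x, 0 <= rho x)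
    (rho_int : (\int[m]_x (rho x)%:E = 1)%E)
    (Omega : invariant_sets U K)
    (mu : probability (borel (phase Omega)) R)
    (uniqueOmega : uniquely_ergodic R Omega)
    (invariant_mu : invariant_measure mu)
    (Omega_ : nat -> invariant_sets U K)
    (mu_ : forall l, probability (borel (phase (Omega_ l))) R)
    (invariant_mu_ : forall l, invariant_measure (mu_ l))
    (Omega_cvg : Omega_ @ \oo --> Omega)
    (A : forall D : Delone U K, ell2 R (pts D) -> ell2 R (pts D))
    (selfadjointA : self_adjoint_random_operator A)
    (eta_ : nat -> {measure set (measurableTypeR R) -> \bar R})
    (eta : {measure set (measurableTypeR R) -> \bar R})
    (eta_dos_ : forall l, density_of_states rho A (mu_ l) (eta_ l))
    (eta_dos : density_of_states rho A mu eta) :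
  weak_star_cvg eta_ eta.
Proof.
case: selfadjointA => a sa rep phi Cc_phi; case: (Cc_phi) => cphi _.
rewrite (eta_dos.2 phi Cc_phi).
pose f (D : Delone U K) : R[i] := \sum_(x \in [set: pts D]) (rho (set_val x))%:C *
    l2dot (delta x) (functional_calculus phi (A D) (delta x)).
have cf : continuous f.
  exact: (density_continuous HausdorffG locally_compactG openU U1 sa rep Cc_rho cphi).
rewrite (_ : (fun l => _) =
  (fun l => complex_integral (mu_ l) (f \o @phase_val G U K (Omega_ l)))); last first.
  by apply/funext => l; exact: (eta_dos_ l).2 phi Cc_phi.
apply: cvg_ReIm.
  apply: (system_mean_cvg HausdorffG locally_compactG openU compactK uniqueOmega
    invariant_mu invariant_mu_ Omega_cvg (f := fun D => complex.Re (f D))) => D.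
  exact: (@cvg_Re R _ _ (nbhs_filter D) f _ (cf D)).
apply: (system_mean_cvg HausdorffG locally_compactG openU compactK uniqueOmega
  invariant_mu invariant_mu_ Omega_cvg (f := fun D => complex.Im (f D))) => D.
exact: (@cvg_Im R _ _ (nbhs_filter D) f _ (cf D)).
Qed.
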